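(* Let $(E,\phi)$ be an abelian $A$-module of dimension $d$ on a rigid analytic space $X$ over $L$, and let $\mathrm{Sp}\,B$ be a member of an admissible affinoid covering of $X$ which refines a covering $\{X_i\}$ on which there are natural numbers $n_{i,a}$ with $(\iota(a)-\phi_a')^{n_{i,a}}\mathrm{Lie}\,E|_{X_i}=0$ ($a\in A$), and such that $E|_{\mathrm{Sp}\,B}$ is free. Fix coordinates $\kappa:\Gamma(\mathrm{Sp}\,B,E)\cong B^d$ and the induced coordinates on $\mathrm{Lie}\,E$, by means of which $\phi_a$ and $\phi_a'$ are regarded as maps $B^d\to B^d$. Then there exists a unique sequence of matrices $(e_j)_{j\ge0}$ in $M_d(B)$ with $e_0=\mathrm{Id}$ and $\lim_{j\to\infty}q^{-j}\log|e_j|=-\infty$ defining a rigid analytic function $$\exp_{E,\mathrm{Sp}\,B}:B^d\longrightarrow B^d,\qquad z\mapsto\sum_{j=0}^\infty e_jz^{(j)},$$ that satisfies for each $a\in A$ the identity $\exp_{E,\mathrm{Sp}\,B}\circ\phi_a'=\phi_a\circ\exp_{E,\mathrm{Sp}\,B}$.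
   Context: Setting. $\mathbb F_q$ is the finite field with $q$ elements, $C$ a complete, smooth, geometrically irreducible curve over $\mathbb F_q$, $\infty\in C$ a closed point, $A$ the ring of regular functions on $C\smallsetminus\{\infty\}$, $K=\mathrm{Frac}(A)$, $K_\infty$ the completion of $K$ at $\infty$, $\mathbb C_\infty$ the completion of an algebraic closure of $K_\infty$, $L$ a complete valued field with $K_\infty\subset L\subset\mathbb C_\infty$, and $\iota:A\subset K_\infty\subset L$. Abelian $A$-modules. $\mathbf{Vec}(X)$ is the category of locally free coherent $\mathcal O_X$-modules with $\mathbb F_q$-linear algebraic group homomorphisms, i.e. maps $E\to E'$ which on an admissible affinoid covering $\{\mathrm{Sp}\,B_i\}$ trivializing $E,E'$ are given by polynomials $\sum_{\nu=0}^{m_i}A_{i,\nu}\sigma^\nu$ with matrices $A_{i,\nu}$ over $B_i$ and $\sigma$ the componentwise $q$-power map. $\mathbb G_a$ is the object $\mathcal O_X$, $\mathrm{Lie}\,E$ is the tangent space of $E$ along the zero section, and $\alpha'$ denotes the differential of $\alpha$. An abelian $A$-module of dimension $d$ and rank $r$ on $X$ is a vector bundle $E$ of rank $d$ with a ring homomorphism $\phi:A\to\mathrm{End}_{\mathbf{Vec}(X)}(E)$, $a\mapsto\phi_a$, such that: there are an admissible covering $\{X_i\}$ of $X$ and natural numbers $n_{i,a}$ with $(\iota(a)-\phi_a')^{n_{i,a}}\mathrm{Lie}\,E|_{X_i}=0$ for all $a\in A$; the sheaf $M(E):=\mathrm{Hom}_{\mathbf{Vec}(X)}(E,\mathbb G_a)$,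 with $a\in A$ acting by right composition with $\phi_a$, is a finitely generated $\mathcal O_X\otimes_{\mathbb F_q}A$-module; and $M(E)$ is flat over $\mathcal O_X$ with fiber at every $x\in X$ locally free of rank $r$ over $k(x)\otimes_{\mathbb F_q}A$. In coordinates $\phi_a=\sum_{k=0}^{s_a}G_k(a)\sigma^k$ and $\phi_a'=G_0(a)$ with $G_k(a)\in M_d(B)$ and $G_0(a)-\iota(a)\mathrm{Id}$ nilpotent; $\sigma$ is the componentwise $q$-power map on $B^d$ and $z^{(j)}$ is the componentwise $q^j$-power. $|\cdot|$ is a fixed complete $L$-algebra norm on $B$, and $|e|$ for a matrix is the maximum of the norms of its entries ($\log0=-\infty$). *)

(* Defs.v *)
From HB Require Import structures.
From mathcomp Require Import all_boot all_order all_algebra.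
From mathcomp Require Import all_classical all_reals all_analysis.

Set Implicit Arguments.
Unset Strict Implicit.
Unset Printing Implicit Defensive.

Import Order.TTheory GRing.Theory Num.Theory.
Import numFieldNormedType.Exports.

Local Open Scope classical_set_scope.
Local Open Scope ring_scope.

(* A complete, smooth, geometrically irreducible curve [C] over [F_q] is given
  by its function field: a field extension of [F_q] of transcendence degree
  one, finitely generated, in which [F_q] is algebraically closed (as [F_q] is
  perfect, this last condition is geometric irreducibility).  The closed points
  of [C] are the nontrivial valuation rings of the function field that contain
  [F_q], namely the local rings of [C] at its closed points. *)

Definition is_function_field (k : finFieldType) (K : fieldType)
    (cst : {rmorphism k -> K}) : Prop :=
  (exists x : K,
     (forall p : {poly k}, (map_poly cst p).[x] = 0 -> p = 0) /\
     exists (n : nat) (y : 'I_n -> K), forall z : K,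
       exists (g : {poly k}) (f : 'I_n -> {poly k}), g != 0 /\
         (map_poly cst g).[x] * z = \sum_i (map_poly cst (f i)).[x] * y i) /\
  (forall (z : K) (p : {poly k}),
     p != 0 -> (map_poly cst p).[z] = 0 -> exists c, cst c = z).

Record is_place (k : finFieldType) (K : fieldType) (cst : {rmorphism k -> K})
    (O : set K) : Prop := IsPlace {
  place_cst : forall c, O (cst c);
  place_sub : forall x y, O x -> O y -> O (x - y);
  place_mul : forall x y, O x -> O y -> O (x * y);
  place_val : forall x, O x \/ O x^-1;
  place_proper : O <> setT }.

Record pointed_curve := PointedCurve {
  cfield : finFieldType;
  ffield : fieldType;
  cst : {rmorphism cfield -> ffield};
  ffieldP : is_function_field cst;
  infty : set ffield;
  inftyP : is_place cst infty }.

(* [A], as an abstract ring embedded in the function field; [creg_frac] says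
   that [K = Frac A] is the whole function field. *)
Record coordinate_ring (C : pointed_curve) := CoordinateRing {
  creg :> comNzRingType;
  ccst : {rmorphism cfield C -> creg};
  cemb : {rmorphism creg -> ffield C};
  cemb_cst : forall c, cemb (ccst c) = @cst C c;
  cemb_inj : injective cemb;
  cemb_range : range cemb =
    [set z | forall O, is_place (@cst C) O -> O <> @infty C -> O z];
  creg_frac : forall z, exists a b : creg, b != 0 /\ z = cemb a / cemb b }.

Section Convergence.
Variables (R : realType) (V : zmodType) (nrm : V -> R).

Definition ncvg (u : nat -> V) (l : V) : Prop :=
  (fun n => nrm (u n - l)) @ \oo --> (0 : R).

Definition ncauchy (u : nat -> V) : Prop :=
  forall e, 0 < e -> exists N : nat, forall m n : nat,
    (N <= m)%N -> (N <= n)%N -> nrm (u m - u n) < e.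

Definition ncomplete : Prop := forall u, ncauchy u -> exists l, ncvg u l.
End Convergence.

Record absolute_value (R : realType) (F : fieldType) (v : F -> R) : Prop :=
  AbsoluteValue {
    abs_ge0 : forall x, 0 <= v x;
    abs_eq0 : forall x, v x = 0 <-> x = 0;
    abs_mul : forall x y, v (x * y) = v x * v y;
    abs_add : forall x y, v (x + y) <= Num.max (v x) (v y) }.

(* [K_oo] is realized as the closure of [K] in [C_oo]. *)
Section Completion.
Variables (R : realType) (K F : fieldType) (v : F -> R).
Variable j : {rmorphism K -> F}.

Definition completion_in : set F :=
  [set z | exists u : nat -> K, ncvg v (fun n => j (u n)) z].

Definition algebraic_over (S : set F) : set F :=
  [set z | exists p : {poly F}, [/\ p != 0, forall i, S p`_i & p.[z] = 0]].

(* the elements algebraic over [completion_in] form an algebraic closure of it,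
   of which [F] is the completion *)
Record is_Cinf : Prop := IsCinf {
  Cinf_complete : ncomplete v;
  Cinf_closed : forall p : {poly F}, (1 < size p)%N ->
    (forall i, algebraic_over completion_in p`_i) -> exists z, p.[z] = 0;
  Cinf_dense : forall z, exists u : nat -> F,
    (forall n, algebraic_over completion_in (u n)) /\ ncvg v u z }.
End Completion.

Record valued_field (R : realType) (C : pointed_curve)
    (A : coordinate_ring C) := ValuedField {
  Cinf : fieldType;
  Cabs : Cinf -> R;
  CabsP : absolute_value Cabs;
  KtoC : {rmorphism ffield C -> Cinf};
  (* the absolute value is the one attached to the point [oo] *)
  Cabs_infty : forall z, Cabs (KtoC z) <= 1 <-> @infty C z;
  CinfP : is_Cinf Cabs KtoC;
  vfield :> fieldType;
  LtoC : {rmorphism vfield -> Cinf};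
  vabs := fun x => Cabs (LtoC x);
  vabs_complete : ncomplete vabs;
  Kinf_sub : completion_in Cabs KtoC `<=` range LtoC;
  iota : {rmorphism A -> vfield};
  iotaP : forall a, LtoC (iota a) = KtoC (cemb A a) }.

(* [comAlgType] excludes the zero algebra, hence rings with a structure
   morphism. *)

Definition is_ideal (B : comPzRingType) (I : set B) : Prop :=
  [/\ I 0, forall x y, I x -> I y -> I (x + y) & forall b x, I x -> I (b * x)].

(* the point set of [Sp B]; the map [Sp f] attached to a morphism [f] of
   affinoid algebras is [m' |-> f @^-1` m'] *)
Definition Sp (B : comPzRingType) : set (set B) :=
  [set m | [/\ is_ideal m, ~ m 1 &
     forall I, is_ideal I -> m `<=` I -> ~ I 1 -> I = m]].
Arguments Sp B : clear implicits.

Section Affinoid.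
Variables (R : realType) (L : fieldType) (absL : L -> R).

Record lalgebra := LAlgebra {
  lring :> comPzRingType;
  lstr : {rmorphism L -> lring} }.

Definition lalg_hom (B B' : lalgebra) (f : {rmorphism B -> B'}) : Prop :=
  forall c, f (lstr B c) = lstr B' c.

Definition monom (n : nat) := {ffun 'I_n -> nat}.

Definition series (n : nat) := monom n -> L.

Definition series_const n (c : L) : series n :=
  fun k => if k == [ffun=> 0%N] then c else 0.

Definition series_mul n (f g : series n) : series n := fun k =>
  \sum_(p \in [set p : monom n * monom n |
                 forall i, (p.1 i + p.2 i)%N = k i]) f p.1 * g p.2.

(* membership in the Tate algebra [T_n = L<X_1, ..., X_n>] *)
Definition tate n (f : series n) : Prop :=
  forall e, 0 < e -> finite_set [set k | e <= absL (f k)].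

Definition affinoid (B : lalgebra) : Prop :=
  exists (n : nat) (pi : series n -> B),
    [/\ forall f g, tate f -> tate g -> pi (fun k => f k + g k) = pi f + pi g,
        forall f g, tate f -> tate g -> pi (series_mul f g) = pi f * pi g,
        forall c, pi (@series_const n c) = lstr B c
      & forall b, exists2 f, tate f & pi f = b].

Definition Sp_preimage (B B' : lalgebra) (f : {rmorphism B -> B'})
    (U : set (set B)) : set (set B') :=
  [set m' | Sp B' m' /\ U (f @^-1` m')].

Definition Sp_into (B B' : lalgebra) (f : {rmorphism B -> B'})
    (U : set (set B)) : Prop := forall m', Sp B' m' -> U (f @^-1` m').

(* [U] is an affinoid subdomain of [Sp B], represented by [rho : B -> B'] *)
Definition represents (B B' : lalgebra) (U : set (set B))
    (rho : {rmorphism B -> B'}) : Prop :=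
  [/\ affinoid B', lalg_hom rho, Sp_into rho U &
      forall (D : lalgebra) (f : {rmorphism B -> D}),
        affinoid D -> lalg_hom f -> Sp_into f U ->
        exists g : {rmorphism B' -> D},
          [/\ lalg_hom g, forall b, g (rho b) = f b &
              forall g' : {rmorphism B' -> D}, lalg_hom g' ->
                (forall b, g' (rho b) = f b) -> g' =1 g]].

Definition subdomain (B : lalgebra) (U : set (set B)) : Prop :=
  U `<=` Sp B /\
  exists (B' : lalgebra) (rho : {rmorphism B -> B'}), represents U rho.

Definition finite_refinement (B : lalgebra) (G : set (set (set B))) : Prop :=
  exists H : set (set (set B)),
    [/\ finite_set H, forall W, H W -> subdomain W,
        \bigcup_(W in H) W = Sp B &
        forall W, H W -> exists2 V, G V & W `<=` V].

Definition quasi_cover (B : lalgebra) (U : set (set B))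
    (F : set (set (set B))) : Prop :=
  forall (D : lalgebra) (f : {rmorphism B -> D}),
    affinoid D -> lalg_hom f -> Sp_into f U ->
    finite_refinement (Sp_preimage f @` F).

(* the strong Grothendieck topology of [Sp B], as in BGR 9.1.4 *)
Definition strong_adm (B : lalgebra) (U : set (set B)) : Prop :=
  exists F : set (set (set B)),
    [/\ forall V, F V -> subdomain V, \bigcup_(V in F) V = U &
        quasi_cover U F].

Definition strong_cov (B : lalgebra) (U : set (set B))
    (F : set (set (set B))) : Prop :=
  [/\ strong_adm U, forall V, F V -> strong_adm V, \bigcup_(V in F) V = U &
      quasi_cover U F].

End Affinoid.

(* Spaces with a Grothendieck topology; a covering is given by its set of
   members.  [adm_local], [cov_coarser] and the admissibility of [set0] and
   [setT] are the usual saturation conditions (G0)-(G2). *)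
Record gtop := GTop {
  gpt :> Type;
  adm : set (set gpt);
  cov : set gpt -> set (set gpt) -> Prop;
  adm_set0 : adm set0;
  adm_setT : adm setT;
  adm_setI : forall U V, adm U -> adm V -> adm (U `&` V);
  cov_adm : forall U F, cov U F -> adm U /\ F `<=` adm;
  cov_cover : forall U F, cov U F -> \bigcup_(V in F) V = U;
  cov_id : forall U, adm U -> cov U [set U];
  cov_trans : forall U F (G : set gpt -> set (set gpt)),
    cov U F -> (forall V, F V -> cov V (G V)) -> cov U (\bigcup_(V in F) G V);
  cov_pull : forall U V F,
    cov U F -> adm V -> V `<=` U -> cov V ((fun W => V `&` W) @` F);
  adm_local : forall U V F,
    cov U F -> V `<=` U -> (forall W, F W -> adm (V `&` W)) -> adm V;
  cov_coarser : forall U F G,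
    cov U F -> G `<=` adm -> \bigcup_(V in G) V = U ->
    (forall W, F W -> exists2 V, G V & W `<=` V) -> cov U G }.

Record opens (X : gtop) := Opens { oset :> set X; oadm : adm oset }.

Definition otop (X : gtop) : opens X := Opens (adm_setT X).

Definition subo (X : gtop) (V U : opens X) : Prop := oset V `<=` oset U.

Definition subo_trans (X : gtop) (U V W : opens X) (h : subo W V)
  (h' : subo V U) : subo W U := fun x hx => h' x (h x hx).

Lemma subo_otop (X : gtop) (U : opens X) : subo U (otop X).
Proof. by []. Qed.

Section Rigid.
Variables (R : realType) (L : fieldType) (absL : L -> R).

(* A family indexed by all opens is used to state gluing; only its values on
   the members of the covering matter. *)
Record gringed := GRinged {
  gr_top :> gtop;
  sec : opens gr_top -> lalgebra L;
  res : forall U V : opens gr_top, subo V U -> {rmorphism sec U -> sec V};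
  res_str : forall U V (h : subo V U), lalg_hom (res h);
  res_id : forall U (h : subo U U) f, res h f = f;
  res_comp : forall U V W (h : subo V U) (h' : subo W V) (h'' : subo W U) f,
    res h' (res h f) = res h'' f;
  res_glue : forall (U : opens gr_top) F, cov U F ->
    forall s : forall V : opens gr_top, sec V,
    (forall V V' W (h : subo W V) (h' : subo W V'), F V -> F V' ->
       res h (s V) = res h' (s V')) ->
    exists! t : sec U, forall V (h : subo V U), F V -> res h t = s V }.

(* the germ of [f] at [x] is not a unit *)
Definition vanishes (X : gringed) (x : X) (U : opens X) (f : sec U) : Prop :=
  forall (V : opens X) (h : subo V U), oset V x ->
    ~ exists g : sec V, res h f * g = 1.

Definition locally_ringed (X : gringed) : Prop :=
  forall (x : X) (U : opens X), oset U x ->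
    vanishes x (0 : sec U) /\
    forall f g : sec U, vanishes x f -> vanishes x g -> vanishes x (f + g).

Definition pt_ideal (X : gringed) (U : opens X) (x : X) : set (sec U) :=
  [set f | vanishes x f].
Arguments pt_ideal {X} U x.

(* [(U, O_X|U)] is isomorphic to [Sp (O_X U)]; the isomorphism is necessarily
   [x |-> pt_ideal U x] on points, and the sheaves agree as soon as they agree
   on affinoid subdomains *)
Record affinoid_open (X : gringed) (U : opens X) : Prop := AffinoidOpen {
  ao_affinoid : affinoid absL (sec U);
  ao_bij : set_bij (oset U) (Sp (sec U)) (pt_ideal U);
  ao_adm : forall V : set X, V `<=` oset U ->
    adm V <-> strong_adm absL (pt_ideal U @` V);
  ao_cov : forall (V : set X) (F : set (set X)),
    V `<=` oset U -> (forall W, F W -> W `<=` oset U) ->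
    cov V F <->
    strong_cov absL (pt_ideal U @` V) ((fun W => pt_ideal U @` W) @` F);
  ao_sheaf : forall (V : opens X) (h : subo V U),
    subdomain absL (pt_ideal U @` oset V) ->
    represents absL (pt_ideal U @` oset V) (res h) }.

Definition affinoid_covering (X : gringed) (F : set (set X)) : Prop :=
  cov setT F /\ forall U : opens X, F U -> affinoid_open U.

Record rigid_space := RigidSpace {
  rs_space :> gringed;
  rs_local : locally_ringed rs_space;
  rs_affinoid : exists F : set (set rs_space), affinoid_covering F }.

Section Sheaves.
Variable X : rigid_space.

Record osheaf := OSheaf {
  msec : forall U : opens X, lmodType (sec U);
  mres : forall U V : opens X, subo V U -> msec U -> msec V;
  mres_lin : forall U V (h : subo V U) (c : sec U) (s t : msec U),
    mres h (c *: s + t) = res h c *: mres h s + mres h t;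
  mres_id : forall U (h : subo U U) s, mres h s = s;
  mres_comp : forall U V W (h : subo V U) (h' : subo W V) (h'' : subo W U) s,
    mres h' (mres h s) = mres h'' s;
  mres_glue : forall (U : opens X) F, cov (oset U) F ->
    forall s : forall V : opens X, msec V,
    (forall V V' W (h : subo W V) (h' : subo W V'),
       F (oset V) -> F (oset V') -> mres h (s V) = mres h' (s V')) ->
    exists! t : msec U, forall V (h : subo V U), F (oset V) -> mres h t = s V }.

(* the object [G_a] of [Vec(X)], i.e. the sheaf [O_X] *)
Definition Ga_sec (U : opens X) : lmodType (sec U) := (sec U : comPzRingType)^o.

Definition Ga_res (U V : opens X) (h : subo V U) : Ga_sec U -> Ga_sec V :=
  res h.

Lemma Ga_res_lin U V (h : subo V U) (c : sec U) (s t : Ga_sec U) :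
  Ga_res h (c *: s + t) = res h c *: Ga_res h s + Ga_res h t.
Proof. by rewrite /Ga_res rmorphD; congr (_ + _); exact: rmorphM. Qed.

Definition Ga : osheaf :=
  @OSheaf Ga_sec Ga_res Ga_res_lin (@res_id X) (@res_comp X) (@res_glue X).

Section Frames.
Variables (E : osheaf) (n : nat).

Definition lincomb (U V : opens X) (h : subo V U) (b : 'I_n -> msec E U)
    (z : 'cV[sec V]_n) : msec E V := \sum_i z i 0 *: mres h (b i).

Definition frame (U : opens X) (b : 'I_n -> msec E U) : Prop :=
  forall (V : opens X) (h : subo V U) (s : msec E V),
    exists! z : 'cV[sec V]_n, lincomb h b z = s.

Definition free_on (U : opens X) : Prop := exists b, @frame U b.

Definition vector_bundle : Prop :=
  exists F : set (set X),
    affinoid_covering F /\ forall U : opens X, F (oset U) -> free_on U.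
End Frames.

(* A polynomial [sum A_nu sigma^nu] over an [L]-algebra [B] is determined by its
  values on [B^n], [L] being infinite; so maps are maps of sheaves of sets. *)

Variable q : nat.

Definition frob (B : comPzRingType) n (j : nat) (z : 'cV[B]_n) : 'cV[B]_n :=
  map_mx (fun x => x ^+ (q ^ j)) z.

Definition sheaf_map (E E' : osheaf) := forall V : opens X, msec E V -> msec E' V.

Definition sheaf_map_on (U : opens X) (E E' : osheaf) :=
  forall V : opens X, subo V U -> msec E V -> msec E' V.

Definition restr_map (U : opens X) (E E' : osheaf) (f : sheaf_map E E') :
  sheaf_map_on U E E' := fun V _ => f V.

Definition restr_map_on (U W : opens X) (h : subo W U) (E E' : osheaf)
    (f : sheaf_map_on U E E') : sheaf_map_on W E E' :=
  fun V h' => f V (subo_trans h' h).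

Definition natural_on (U : opens X) (E E' : osheaf)
    (f : sheaf_map_on U E E') : Prop :=
  forall V W (hV : subo V U) (hW : subo W U) (h : subo W V) s,
    f W hW (mres h s) = mres h (f V hV s).

(* on [W], in the given frames, [f] is [sum_(nu <= m) A_nu sigma^nu] *)
Definition given_by (U W : opens X) (h : subo W U) (E E' : osheaf) n n'
    (b : 'I_n -> msec E W) (b' : 'I_n' -> msec E' W)
    (f : sheaf_map_on U E E') (m : nat) (A : nat -> 'M[sec W]_(n', n)) : Prop :=
  forall (V : opens X) (hV : subo V W) (z : 'cV[sec V]_n),
    f V (subo_trans hV h) (lincomb hV b z) =
    lincomb hV b' (\sum_(nu < m.+1) map_mx (res hV) (A nu) *m frob nu z).

(* [f] is a morphism [E|U -> E'|U] in [Vec(U)]; the ranks are [n] and [n'] *)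
Definition vec_hom_on (U : opens X) (E E' : osheaf) n n'
    (f : sheaf_map_on U E E') : Prop :=
  natural_on f /\
  exists F, cov (oset U) F /\
    forall (W : opens X) (h : subo W U), F (oset W) -> affinoid_open W /\
      exists (b : 'I_n -> msec E W) (b' : 'I_n' -> msec E' W) m A,
        [/\ frame b, frame b' & given_by h b b' f m A].

Definition vec_hom (E E' : osheaf) n n' (f : sheaf_map E E') : Prop :=
  @vec_hom_on (otop X) E E' n n' (restr_map (U := otop X) f).

(* [f'] is the differential of [f]: locally [f = sum A_nu sigma^nu] and
   [f' = A_0].  The tangent space [Lie E] of the vector bundle [E] along its
   zero section is identified with [E]. *)
Definition is_differential (E E' : osheaf) n n' (f f' : sheaf_map E E') : Prop :=
  natural_on (restr_map (U := otop X) f') /\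
  exists F, affinoid_covering F /\
    forall (W : opens X), F (oset W) ->
      exists (b : 'I_n -> msec E W) (b' : 'I_n' -> msec E' W) m A,
        [/\ frame b, frame b',
            given_by (@subo_otop X W) b b' (restr_map (U := otop X) f) m A &
            given_by (@subo_otop X W) b b' (restr_map (U := otop X) f') 0
              (fun=> A 0%N)].
End Sheaves.
End Rigid.

(* [sum_i x_i (x) m_i = 0] in [N (x)_S M] *)
Definition tensor_zero (S : comPzRingType) (N M : lmodType S) n
    (x : 'I_n -> N) (m : 'I_n -> M) : Prop :=
  forall (P : lmodType S) (beta : N -> M -> P),
    (forall c y y' w, beta (c *: y + y') w = c *: beta y w + beta y' w) ->
    (forall c y w w', beta y (c *: w + w') = c *: beta y w + beta y w') ->
    \sum_i beta (x i) (m i) = 0.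

Definition flat (S : comPzRingType) (M : lmodType S) : Prop :=
  forall (N N' : lmodType S) (u : {linear N -> N'}), injective u ->
  forall n (x : 'I_n -> N) (m : 'I_n -> M),
    tensor_zero (fun i => u (x i)) m -> tensor_zero x m.

(* [N[1/s]] is free of rank [r] over [T[1/s]], on the images of [v] *)
Definition free_away (T : comPzRingType) (N : lmodType T) (r : nat) (s : T) :
    Prop :=
  exists v : 'I_r -> N,
    (forall y, exists (k : nat) (c : 'I_r -> T),
       s ^+ k *: y = \sum_i c i *: v i) /\
    (forall c : 'I_r -> T, \sum_i c i *: v i = 0 ->
       exists k : nat, forall i, s ^+ k * c i = 0).

Definition locally_free (T : comPzRingType) (N : lmodType T) (r : nat) : Prop :=
  exists n (s t : 'I_n -> T),
    \sum_i t i * s i = 1 /\ forall i, free_away N r (s i).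

(* [T], with [u] and [w], is the tensor product over [k0] of the commutative
   [k0]-algebras [k] and [A] *)
Definition is_tensor_algebra (k0 k A T : comPzRingType)
    (f : {rmorphism k0 -> k}) (g : {rmorphism k0 -> A})
    (u : {rmorphism k -> T}) (w : {rmorphism A -> T}) : Prop :=
  (forall c, u (f c) = w (g c)) /\
  forall (S : comPzRingType) (u' : {rmorphism k -> S})
    (w' : {rmorphism A -> S}), (forall c, u' (f c) = w' (g c)) ->
    exists t : {rmorphism T -> S},
      [/\ forall x, t (u x) = u' x, forall a, t (w a) = w' a &
          forall t' : {rmorphism T -> S}, (forall x, t' (u x) = u' x) ->
            (forall a, t' (w a) = w' a) -> t' =1 t].

Section Abelian.
Variables (R : realType) (C : pointed_curve) (A : coordinate_ring C).
Variable L : valued_field R A.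
Variable X : rigid_space (@vabs _ _ _ L).
Variables (d r : nat) (E : osheaf X).
Variables phi dphi : A -> sheaf_map E E.

Local Notation q := #|cfield C|.

(* sections over [U] of [M(E) = Hom_Vec(X)(E, G_a)] *)
Definition ME_on (U : opens X) : set (sheaf_map_on U E (Ga X)) :=
  [set m | @vec_hom_on _ _ _ X q U E (Ga X) d 1 m].

(* [(iota(a) - phi_a')^{n_{i,a}} Lie E|X_i = 0] on a covering [F] of [X] *)
Definition nilpotent_on (F : set (set X)) : Prop :=
  cov setT F /\
  exists n : set X -> A -> nat, forall (U : opens X), F (oset U) ->
    forall (a : A) (V : opens X), subo V U -> forall s : msec E V,
      iter (n (oset U) a)
        (fun t : msec E V => lstr (sec V) (iota L a) *: t - dphi a t) s = 0.

Definition ME_finitely_generated : Prop :=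
  exists F, cov (setT : set X) F /\ forall U : opens X, F (oset U) ->
    exists n (g : 'I_n -> sheaf_map_on U E (Ga X)), (forall i, ME_on (g i)) /\
      forall (V : opens X) (hV : subo V U) (m : sheaf_map_on V E (Ga X)),
        ME_on m ->
        exists G, cov (oset V) G /\
          forall (W : opens X) (hW : subo W V), G (oset W) ->
            exists l (c : 'I_l -> sec W) (a : 'I_l -> A) (k : 'I_l -> 'I_n),
              forall (Y : opens X) (hY : subo Y W) (s : msec E Y),
                m Y (subo_trans hY hW) s =
                \sum_j res hY (c j) *
                  g (k j) Y (subo_trans (subo_trans hY hW) hV)
                    (phi (a j) s).

(* [Ox], with [germ], is the stalk of [O_X] at [x] *)
Record is_stalk (x : X) (Ox : lalgebra L)
    (germ : forall U : opens X, oset U x -> {rmorphism sec U -> Ox}) : Prop :=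
  IsStalk {
    stalk_str : forall U hU, lalg_hom (germ U hU);
    stalk_res : forall (U V : opens X) (h : subo V U) hU hV f,
      germ V hV (res h f) = germ U hU f;
    stalk_surj : forall y, exists (U : opens X) hU f, germ U hU f = y;
    stalk_zero : forall (U : opens X) hU f, germ U hU f = 0 <->
      exists (V : opens X) (h : subo V U), oset V x /\ res h f = 0 }.

(* [Mx], with [mgerm], is the stalk of [M(E)] at [x] *)
Record is_ME_stalk (x : X) (Ox : lalgebra L)
    (germ : forall U : opens X, oset U x -> {rmorphism sec U -> Ox})
    (Mx : lmodType Ox)
    (mgerm : forall U : opens X, oset U x ->
       sheaf_map_on U E (Ga X) -> Mx) : Prop :=
  IsMEStalk {
    mstalk_res : forall (U V : opens X) (h : subo V U) hU hV m, ME_on m ->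
      mgerm V hV (restr_map_on h m) = mgerm U hU m;
    mstalk_lin : forall (U : opens X) hU c m m', ME_on m -> ME_on m' ->
      mgerm U hU (fun V h s => res h c * m V h s + m' V h s) =
      germ U hU c *: mgerm U hU m + mgerm U hU m';
    mstalk_surj : forall y, exists (U : opens X) hU m,
      ME_on m /\ mgerm U hU m = y;
    mstalk_zero : forall (U : opens X) hU m, ME_on m ->
      mgerm U hU m = 0 <->
      exists (V : opens X) (h : subo V U), oset V x /\
        forall W (hW : subo W V) s, m W (subo_trans hW h) s = 0 }.

(* [N] is the fiber of [M(E)] at [x], a module over [T = k(x) (x)_{F_q} A];
   here [ev : Ox -> k] is the residue field and [p : Mx -> N] the reduction,
   whose kernel is [m_x Mx].  The structure map of the [F_q]-algebra [k] goes
   through [F_q -> A -> L -> Ox]. *)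
Record is_ME_fiber (x : X) (Ox : lalgebra L) (Mx : lmodType Ox)
    (mgerm : forall U : opens X, oset U x -> sheaf_map_on U E (Ga X) -> Mx)
    (k : fieldType) (ev : {rmorphism Ox -> k}) (T : comPzRingType)
    (u : {rmorphism k -> T}) (w : {rmorphism A -> T}) (N : lmodType T)
    (p : Mx -> N) : Prop :=
  IsMEFiber {
    fiber_ev : forall y, exists f, ev f = y;
    fiber_tensor : is_tensor_algebra
      (ev \o (lstr Ox \o (iota L \o ccst A)))
      (ccst A) u w;
    fiber_lin : forall c m m', p (c *: m + m') = u (ev c) *: p m + p m';
    fiber_act : forall (U : opens X) hU a m, ME_on m ->
      p (mgerm U hU (fun V h s => m V h (phi a s))) = w a *: p (mgerm U hU m);
    fiber_surj : forall y, exists m, p m = y;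
    fiber_ker : forall m, p m = 0 <->
      exists n (c : 'I_n -> Ox) (m' : 'I_n -> Mx),
        (forall i, ev (c i) = 0) /\ m = \sum_i c i *: m' i }.

Record abelian_module : Prop := AbelianModule {
  am_bundle : vector_bundle E d;
  am_end : forall a, vec_hom q d d (phi a);
  am_diff : forall a, is_differential q d d (phi a) (dphi a);
  am_one : forall V (s : msec E V), phi 1 s = s;
  am_add : forall a b V (s : msec E V), phi (a + b) s = phi a s + phi b s;
  am_mul : forall a b V (s : msec E V), phi (a * b) s = phi a (phi b s);
  am_nilp : exists F, nilpotent_on F;
  am_fg : ME_finitely_generated;
  am_fibers : forall x : X, exists (Ox : lalgebra L) germ (Mx : lmodType Ox) mgerm,
    [/\ @is_stalk x Ox germ, is_ME_stalk germ mgerm, flat Mx &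
        exists (k : fieldType) (ev : {rmorphism Ox -> k}) (T : comPzRingType)
          (u : {rmorphism k -> T}) (w : {rmorphism A -> T})
          (N : lmodType T) (p : Mx -> N),
          is_ME_fiber mgerm ev u w p /\ locally_free N r] }.

(* an isomorphism [Gamma(U, E) = B^d] of [B]-modules, [B = O_X(U)] *)
Record coordinates (U : opens X) (kappa : msec E U -> 'cV[sec U]_d)
    (kinv : 'cV[sec U]_d -> msec E U) : Prop := Coordinates {
  coord_lin : forall c s t, kappa (c *: s + t) = c *: kappa s + kappa t;
  coord_can : cancel kappa kinv;
  coord_inv : cancel kinv kappa }.

End Abelian.

Record algebra_norm (R : realType) (L : fieldType) (absL : L -> R)
    (B : lalgebra L) (nrm : B -> R) : Prop := AlgebraNorm {
  nrm_ge0 : forall b, 0 <= nrm b;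
  nrm_eq0 : forall b, nrm b = 0 <-> b = 0;
  nrm_add : forall b b', nrm (b + b') <= Num.max (nrm b) (nrm b');
  nrm_mul : forall b b', nrm (b * b') <= nrm b * nrm b';
  nrm_one : nrm 1 <= 1;
  nrm_scale : forall c b, nrm (lstr B c * b) = absL c * nrm b;
  nrm_complete : ncomplete nrm }.

Section Exponential.
Variables (R : realType) (B : comPzRingType) (nrm : B -> R) (q d : nat).

Definition mxnrm (e : 'M[B]_d) : R :=
  \big[Num.max/0]_i \big[Num.max/0]_j nrm (e i j).

(* [q^-j log |e_j| --> -oo]; [lne] is the logarithm with [lne 0 = -oo] *)
Definition entire (e : nat -> 'M[B]_d) : Prop :=
  (fun j => ((q%:R ^- j)%:E * lne (mxnrm (e j))%:E)%E) @ \oo --> (-oo : \bar R)%E.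

Definition is_sum (e : nat -> 'M[B]_d) (f : 'cV[B]_d -> 'cV[B]_d) : Prop :=
  forall z i,
    ncvg nrm (fun n => (\sum_(j < n) e j *m frob q j z) i 0) (f z i 0).
End Exponential.

(* Main.v *)
(* The heart of the matter is a single element [a] of [A] with
   [|iota a| > 1]; it exists because otherwise some transcendental element of
   [A] would have no pole at all, against Chevalley's extension theorem.
   Replacing [a] by [a ^ (q ^ m)] makes [phi'_a] a scalar
   [theta], since the nilpotent part dies in characteristic [p].  Comparing
   coefficients in [exp o theta = phi_a o exp] then gives
   [(theta ^ (q ^ j) - theta) e_j = sum_(k >= 1) G_k e_(j-k)^(k)], which
   determines the [e_j] from [e_0 = 1] and, [|theta|] being [> 1], forces
   [|e_j| <= (K lam ^ j) ^ (q ^ j)] with [lam < 1].  For any other [b] in [A],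
   both [exp o phi'_b] and [phi_b o exp] solve the functional equation of [a]
   with the same constant coefficient, so they coincide.

   That [phi_a] has finitely many coefficients on [Sp B] is not immediate: it
   is polynomial only locally, and the glued coefficients vanish for large
   index on each member of a finite set-theoretic covering by subdomains that
   is not known to be admissible.  They vanish on [Sp B] because affinoid
   algebras are noetherian, which is proved with Groebner bases over the Tate
   algebra. *)

Require Import Defs.
From HB Require Import structures.
From mathcomp Require Import all_boot all_order all_algebra finmap finfield.
From mathcomp Require Import all_classical all_reals all_analysis.
From mathcomp Require Import ring lra.

Set Implicit Arguments.
Unset Strict Implicit.
Unset Printing Implicit Defensive.

Import Order.TTheory GRing.Theory Num.Theory.
Import numFieldNormedType.Exports.

Local Open Scope classical_set_scope.
Local Open Scope ring_scope.

(** * Monomials *)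

(** The estimate rests on weighing $e_j$ by its $q^j$-th root. If $|e_j| \le b_j^{q^j}$, then
    $|e_{j-k}^{(k)}| \le b_{j-k}^{q^j}$, and dividing by $\theta^{q^j}-\theta$ gains
    $|\theta|^{-q^j}$; so one may take $b_j = C^{1/q^j}|\theta|^{-1}\max_{1\le k\le s} b_{j-k}$,
    with $C$ a bound of the $G_k$. As $C^{1/q^j}$ tends to $1$, a geometric sequence $K\lambda^j$
    works eventually as soon as $|\theta|\lambda^s>1$, which leaves room for $\lambda<1$.
    Coefficients are compared in two ways. Over $\mathrm{Sp}\,B$ there is a norm, and at an argument
    of small size $\theta^{-m}$ the first nonzero term of an additive series dominates. Over the
    smaller opens used for gluing no norm is given, and the distinctness of the $\theta^{q^k}$
    replaces it. In the Tate algebra the leading monomial is taken by absolute value of the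
    coefficient first, by lexicographic order second. One round of division is then exact only up to
    a factor $\varepsilon<1$; completeness of $L$ sums the corrections. *)

Section Monomials.
Variable n : nat.
Implicit Types (k l m : monom n).

Definition mdiv k l := forall i, (k i <= l i)%N.
Definition madd k l : monom n := [ffun i => (k i + l i)%N].
Definition msub k l : monom n := [ffun i => (k i - l i)%N].

Lemma msubK k l : mdiv k l -> madd (msub l k) k = l.
Proof. by move=> kl; apply/ffunP => i; rewrite !ffunE subnK. Qed.

Definition lexlt k l : Prop :=
  exists2 i : 'I_n, (k i < l i)%N & forall j : 'I_n, (j < i)%N -> k j = l j.

Lemma lexlt_irr k : ~ lexlt k k.
Proof. by move=> [i]; rewrite ltnn. Qed.

Lemma lexlt_trans k l m : lexlt k l -> lexlt l m -> lexlt k m.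
Proof.
move=> [i ki ei] [j lj ej]; case: (ltngtP i j) => [ij|ji|/val_inj ij].
- by exists i => [|t ti]; [rewrite -ej | rewrite ei // ej // (ltn_trans ti)].
- by exists j => [|t tj]; [rewrite ei | rewrite ei ?ej // (ltn_trans tj)].
- subst j; exists i => [|t ti]; first exact: ltn_trans lj.
  by rewrite ei // ej.
Qed.

Lemma lexlt_total k l : k = l \/ lexlt k l \/ lexlt l k.
Proof.
have [->|kl] := eqVneq k l; first by left.
right; have /existsP[i0 ki0] : [exists i, k i != l i].
  by apply: contraNT kl => /existsPn kl; apply/eqP/ffunP => i; apply/eqP/negPn.
case: (@arg_minnP _ i0 (fun i => k i != l i) val ki0) => i ki imin.
have ei (j : 'I_n) : (j < i)%N -> k j = l j.
  by move=> ji; apply/eqP/negPn/negP => /imin; rewrite leqNgt ji.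
case: (ltngtP (k i) (l i)) ki => // kli _; [left|right]; exists i => // j ji.
by rewrite ei.
Qed.

Lemma lexlt_addl m k l : lexlt k l -> lexlt (madd m k) (madd m l).
Proof.
move=> [i ki ei]; exists i => [|j ji]; first by rewrite !ffunE ltn_add2l.
by rewrite !ffunE ei.
Qed.

(** The minimum is found coordinate by coordinate: among the elements that agree with the current
    one before coordinate [p], one with the smallest coordinate [p] is taken. *)
Lemma lexlt_min (S : set (monom n)) : S !=set0 ->
  exists2 k, S k & forall l, S l -> ~ lexlt l k.
Proof.
move=> S0; suff [k Sk kmin] : exists2 k, S k & forall l, S l ->
    ~ exists i : 'I_n, [/\ (i < n)%N, (l i < k i)%N
       & forall j : 'I_n, (j < i)%N -> l j = k j].
  by exists k => // l /kmin lk [i li ei]; apply: lk; exists i; split.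
suff H : forall p, (p <= n)%N -> exists2 k, S k & forall l, S l ->
    ~ exists i : 'I_n, [/\ (i < p)%N, (l i < k i)%N
       & forall j : 'I_n, (j < i)%N -> l j = k j] by exact: H.
elim=> [_|p IH pn]; first by case: S0 => k Sk; exists k => // l _ [i []].
have [k Sk kmin] := IH (ltnW pn); pose i := Ordinal pn.
pose P x := `[< exists l, [/\ S l, forall j : 'I_n, (j < p)%N -> l j = k j & l i = x] >].
have exP : exists x, P x by exists (k i); apply/asboolP; exists k.
case: (ex_minnP exP) => x /asboolP[k' [Sk' ek' k'x]] xmin.
exists k' => // l Sl [j [jp lj ej]].
have [{}jp|pj|jp'] := ltngtP j p; last 1 first.
- have ji : j = i by apply: val_inj.
  subst j; have : P (l i).
    by apply/asboolP; exists l; split => // t tp; rewrite ej ?ek'.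
  by move/xmin; rewrite -k'x leqNgt lj.
- apply: (kmin l Sl); exists j; split => //; first by rewrite -ek'.
  by move=> t tj; rewrite ej // ek' // (ltn_trans tj).
- by move: jp; rewrite ltnS leqNgt pj.
Qed.

Lemma lexlt_ind (P : monom n -> Prop) :
  (forall k, (forall l, lexlt l k -> P l) -> P k) -> forall k, P k.
Proof.
move=> IH k; apply: contrapT => nPk.
have [|l nPl lmin] := @lexlt_min [set l | ~ P l]; first by exists k.
by apply: nPl; apply: IH => m ml; apply: contrapT => /lmin; apply.
Qed.

(** Dickson's lemma, by induction on the number [p] of coordinates that are compared. *)
Lemma dickson (S : set (monom n)) :
  exists2 s : seq (monom n), {in s, forall k, S k} &
    forall l, S l -> exists2 k, k \in s & mdiv k l.
Proof.
suff H p : (p <= n)%N -> forall S : set (monom n), exists2 s : seq (monom n), {in s, forall k, S k} &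
    forall l, S l -> exists2 k, k \in s & forall i : 'I_n, (i < p)%N -> (k i <= l i)%N.
  have [s sS Ss] := H n (leqnn n) S; exists s => // l /Ss[k ks kl].
  by exists k => // i; exact: kl.
elim: p => [_ {}S|p IH pn {}S].
  have [->|/set0P[k Sk]] := eqVneq S set0; first by exists [::].
  exists [:: k] => [l|l _]; first by rewrite inE => /eqP ->.
  by exists k; rewrite ?inE.
pose i := Ordinal pn.
have [s sS Ss] := IH (ltnW pn) S.
pose Q x (t : seq (monom n)) := {in t, forall k, S k /\ k i = x} /\
  forall l, S l -> l i = x ->
    exists2 k, k \in t & forall j : 'I_n, (j < p)%N -> (k j <= l j)%N.
have /choice[t tP] : forall x, exists t, Q x t.
  move=> x; have [t tS St] := IH (ltnW pn) [set l | S l /\ l i = x].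
  by exists t; split=> // l Sl lx; exact: St.
(* From height [D] in coordinate [i] on, the members of [s] suffice; each of the finitely many
   slices [l i = x] with [x < D] has its own finite list [t x]. *)
pose D := \max_(k <- s) k i.
exists (s ++ flatten [seq t x | x <- iota 0 D]) => [k|l Sl].
  rewrite mem_cat => /orP[/sS//|/flatten_mapP[x _ kt]].
  by have [/(_ _ kt)[]] := tP x.
have [Dl|lD] := leqP D (l i).
  have [k ks kl] := Ss l Sl; exists k; first by rewrite mem_cat ks.
  move=> j; rewrite ltnS leq_eqVlt => /orP[/eqP jp|]; last exact: kl.
  have -> : j = i by apply: val_inj.
  by apply: leq_trans Dl; apply: leq_bigmax_seq.
have [tS St] := tP (l i); have [k kt kl] := St l Sl erefl.
exists k.
  rewrite mem_cat; apply/orP; right; apply/flatten_mapP; exists (l i) => //.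
  by rewrite mem_iota.
move=> j; rewrite ltnS leq_eqVlt => /orP[/eqP jp|]; last exact: kl.
have -> : j = i by apply: val_inj.
by have [_ ->] := tS _ kt.
Qed.

(** Makes the sum over a set in [series_mul] an ordinary finite sum. *)
Lemma finite_mdecomp k :
  finite_set [set p : monom n * monom n | forall i, (p.1 i + p.2 i)%N = k i].
Proof.
pose N := (\max_i k i).+1.
pose F (p : {ffun 'I_n -> 'I_N} * {ffun 'I_n -> 'I_N}) : monom n * monom n :=
  ([ffun i => p.1 i : nat], [ffun i => p.2 i : nat]).
apply: (@sub_finite_set _ _ (F @` setT)); last exact/finite_image/finite_finset.
move=> [a b] /= ab.
have kN i x : (x <= k i)%N -> (x < N)%N.
  by move=> xk; rewrite ltnS (leq_trans xk) // leq_bigmax.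
have aN i : (a i < N)%N by apply: (kN i); rewrite -ab leq_addr.
have bN i : (b i < N)%N by apply: (kN i); rewrite -ab leq_addl.
exists ([ffun i => Ordinal (aN i)], [ffun i => Ordinal (bN i)]) => //.
by congr pair; apply/ffunP => i; rewrite !ffunE.
Qed.

End Monomials.

Lemma seq_max (T : eqType) (r : T -> T -> Prop) (s : seq T) x0 :
  (forall x y, r x y \/ r y x) -> (forall x y z, r x y -> r y z -> r x z) ->
  x0 \in s -> exists2 x, x \in s & forall y, y \in s -> r y x.
Proof.
move=> tot tr; elim: s x0 => // a s IH x0 _.
have rr x : r x x by case: (tot x x).
case: s IH => [_|b s IH].
  by exists a => [|y]; rewrite ?inE // => /eqP ->.
have [x xs xmax] := IH b (mem_head b s).
case: (tot a x) => ax; [exists x|exists a]; rewrite ?mem_head //.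
- by rewrite inE xs orbT.
- by move=> y; rewrite inE => /orP[/eqP->|/xmax].
- by move=> y; rewrite inE => /orP[/eqP->//|/xmax yx]; exact: tr ax.
Qed.

(** * Tate series *)

Section AbsoluteValue.
Variables (R : realType) (L : fieldType) (v : L -> R).
Hypothesis hv : absolute_value v.

Lemma abs0 : v 0 = 0.
Proof. exact/(abs_eq0 hv). Qed.

Lemma abs_gt0 x : x != 0 -> 0 < v x.
Proof.
move=> x0; rewrite lt_neqAle abs_ge0 // andbT eq_sym.
by apply: contra_neq x0 => /(abs_eq0 hv).
Qed.

Lemma abs1 : v 1 = 1.
Proof.
have := abs_mul hv 1 1; rewrite mulr1 => /eqP.
by rewrite -subr_eq0 -{1}[v 1]mulr1 -mulrBr mulf_eq0 gt_eqF ?abs_gt0 ?oner_neq0 //= subr_eq0 => /eqP.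
Qed.

Lemma absX x m : v (x ^+ m) = v x ^+ m.
Proof. by elim: m => [|m IH]; rewrite ?expr0 ?abs1 // !exprS abs_mul // IH. Qed.

Lemma absN1 : v (-1) = 1.
Proof.
apply/eqP; have := absX (-1) 2; rewrite sqrrN expr1n abs1 => /esym/eqP.
by rewrite sqrf_eq1 => /orP[//|/eqP h]; have := abs_ge0 hv (-1); rewrite h oppr_ge0 ler10.
Qed.

Lemma absN x : v (- x) = v x.
Proof. by rewrite -mulN1r abs_mul // absN1 mul1r. Qed.

Lemma absV x : v x^-1 = (v x)^-1.
Proof.
have [->|x0] := eqVneq x 0; first by rewrite invr0 abs0 invr0.
apply: (@mulfI _ (v x)); first by rewrite gt_eqF // abs_gt0.
by rewrite -abs_mul // divff // abs1 divff // gt_eqF // abs_gt0.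
Qed.

Lemma abs_addle c x y : v x <= c -> v y <= c -> v (x + y) <= c.
Proof. by move=> xc yc; rewrite (le_trans (abs_add hv _ _)) // ge_max xc. Qed.

Lemma abs_suble c x y : v x <= c -> v y <= c -> v (x - y) <= c.
Proof. by move=> xc yc; apply: abs_addle => //; rewrite absN. Qed.

Lemma abs_sum (I : Type) (s : seq I) (P : pred I) (F : I -> L) c :
  0 <= c -> (forall i, P i -> v (F i) <= c) -> v (\sum_(i <- s | P i) F i) <= c.
Proof.
move=> c0 Fc; apply: (big_ind (fun x => v x <= c)) => //; first by rewrite abs0.
exact: abs_addle.
Qed.

Section Series.
Variable n : nat.
Implicit Types (f g h : Defs.series L n) (k : monom n).

Definition gauss_le f (c : R) := forall k, v (f k) <= c.

Lemma gauss_ge0 f c : gauss_le f c -> 0 <= c.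
Proof. by move/(_ [ffun=> 0%N]); apply: le_trans; exact: abs_ge0. Qed.

Lemma tate_bound f : tate v f -> exists2 c, 0 < c & gauss_le f c.
Proof.
move=> /(_ 1 ltr01)/finite_seqP[s es].
exists (\big[Order.max/1]_(k <- s) v (f k)); first by exact: lt_le_trans ltr01 (bigmax_ge_id _ _ _ _).
move=> k; have [k1|/ltW k1] := leP 1 (v (f k)).
  apply: le_bigmax_seq => //.
  by have : [set` s] k by rewrite -es.
exact: le_trans k1 (bigmax_ge_id _ _ _ _).
Qed.

Lemma tate0 : tate v (fun _ : monom n => 0).
Proof.
move=> e e0; apply: (sub_finite_set _ (finite_set0 _)) => k /=.
by rewrite abs0 leNgt e0.
Qed.

Lemma tateD f g : tate v f -> tate v g -> tate v (fun k => f k + g k).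
Proof.
move=> tf tg e e0; apply: (@sub_finite_set _ _ ([set k | e <= v (f k)] `|` [set k | e <= v (g k)])).
  move=> k /= efg; have := le_trans efg (abs_add hv _ _).
  by rewrite le_max => /orP.
by rewrite finite_setU; split; [exact: tf|exact: tg].
Qed.

Lemma tateZ c f : tate v f -> tate v (fun k => c * f k).
Proof.
have [->|c0] := eqVneq c 0.
  by move=> _; have -> : (fun k => 0 * f k) = (fun=> 0); [apply/funext => k; rewrite mul0r|exact: tate0].
have vc := abs_gt0 c0.
move=> tf e e0; apply: sub_finite_set (tf (e / v c) (divr_gt0 e0 vc)) => k /=.
by rewrite abs_mul // ler_pdivrMr // mulrC.
Qed.

Lemma tateB f g : tate v f -> tate v g -> tate v (fun k => f k - g k).
Proof.
move=> tf tg; have := tateD tf (tateZ (-1) tg).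
by under [X in _ X -> _]funext do rewrite mulN1r.
Qed.

Lemma tate_sum (I : Type) (s : seq I) (F : I -> Defs.series L n) :
  (forall i, tate v (F i)) -> tate v (fun k => \sum_(i <- s) F i k).
Proof.
move=> tF; elim: s => [|a s IH].
  by under [X in _ X]funext do rewrite big_nil; exact: tate0.
by under [X in _ X]funext do rewrite big_cons; exact: tateD.
Qed.

Lemma tate_fin f (s : seq (monom n)) : (forall k, f k != 0 -> k \in s) -> tate v f.
Proof.
move=> fs e e0; apply: (@sub_finite_set _ _ [set` s]) => [k /= ek|]; last first.
  by apply/finite_seqP; exists s.
by apply: fs; apply: contraTneq ek => ->; rewrite abs0 -ltNge.
Qed.

Definition decomps (k : monom n) : seq (monom n * monom n) :=
  fset_set [set p : monom n * monom n | forall i, (p.1 i + p.2 i)%N = k i].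

Lemma mem_decomps k p : p \in decomps k <-> madd p.1 p.2 = k.
Proof.
rewrite /decomps in_fset_set; last exact: finite_mdecomp.
split => [/set_mem/= H|<-]; first by apply/ffunP => i; rewrite !ffunE.
by apply/mem_set => /= i; rewrite !ffunE.
Qed.

Lemma series_mulE f g k :
  series_mul f g k = \sum_(p <- decomps k) f p.1 * g p.2.
Proof. by rewrite /series_mul fsbig_finite //; exact: finite_mdecomp. Qed.

Lemma series_mulDl f h g k :
  series_mul (fun l => f l + h l) g k = series_mul f g k + series_mul h g k.
Proof. by rewrite !series_mulE -big_split; apply: eq_bigr => p _; rewrite /= mulrDl. Qed.

Lemma series_mulZl c f g k :
  series_mul (fun l => c * f l) g k = c * series_mul f g k.
Proof. by rewrite !series_mulE mulr_sumr; apply: eq_bigr => p _; rewrite mulrA. Qed.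

Lemma series_mul0l g k : series_mul (fun=> 0) g k = 0.
Proof. by rewrite series_mulE big1 // => p _; rewrite mul0r. Qed.

Lemma series_mul_le f g c c' :
  gauss_le f c -> gauss_le g c' -> gauss_le (series_mul f g) (c * c').
Proof.
move=> fc gc k; have c0 := gauss_ge0 fc; have c0' := gauss_ge0 gc.
rewrite series_mulE; apply: abs_sum => [|p _]; first exact: mulr_ge0.
by rewrite abs_mul // ler_pM // abs_ge0.
Qed.

Lemma tate_mul f g : tate v f -> tate v g -> tate v (series_mul f g).
Proof.
move=> tf tg e e0; have [c c0 fc] := tate_bound tf; have [c' c0' gc] := tate_bound tg.
apply: (@sub_finite_set _ _ [set madd k l | k in [set k | e / c' <= v (f k)] & l in [set l | e / c <= v (g l)]]); last first.
  by apply: finite_image2; [apply: tf|apply: tg]; rewrite divr_gt0.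
move=> k /= ek; apply: contrapT => nk.
have : v (series_mul f g k) < e; last by rewrite ltNge ek.
rewrite series_mulE big_seq; apply: (big_ind (fun x => v x < e)).
- by rewrite abs0.
- by move=> x y xe ye; rewrite (le_lt_trans (abs_add hv _ _)) // gt_max xe.
move=> p /mem_decomps pk; rewrite abs_mul // ltNge; apply/negP => pe; apply: nk.
exists p.1 => /=; last (exists p.2 => //=).
- rewrite ler_pdivrMr //; apply: (le_trans pe); apply: ler_wpM2l => //.
  exact: abs_ge0.
- rewrite ler_pdivrMr // mulrC; apply: (le_trans pe); apply: ler_wpM2r => //.
  exact: abs_ge0.
Qed.

Definition smon (c : L) (s : monom n) : Defs.series L n :=
  fun k => if k == s then c else 0.

Lemma tate_smon c s : tate v (smon c s).
Proof.
apply: (@tate_fin _ [:: s]) => k; rewrite /smon inE; case: ifP => //.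
by rewrite eqxx.
Qed.

Lemma smon_le c s : gauss_le (smon c s) (v c).
Proof. by move=> k; rewrite /smon; case: ifP => // _; rewrite abs0 abs_ge0. Qed.

Lemma smon_mulE c s g t : series_mul (smon c s) g (madd s t) = c * g t.
Proof.
rewrite series_mulE (bigD1_seq (s, t)) /=; last 2 first.
- exact/mem_decomps.
- exact: fset_uniq.
rewrite /smon eqxx big_seq_cond big1 ?addr0 // => -[a b] /andP[/mem_decomps/= ab nab].
case: eqP => [as_|]; last by rewrite mul0r.
case/eqP: nab; subst a; congr pair; apply/ffunP => i.
by have /ffunP/(_ i) := ab; rewrite !ffunE => /addnI.
Qed.

Lemma smon_mul_out c s g k : ~ mdiv s k -> series_mul (smon c s) g k = 0.
Proof.
move=> sk; rewrite series_mulE big_seq big1 // => -[a b] /mem_decomps/= ab.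
rewrite /smon; case: eqP => [as_|]; last by rewrite mul0r.
by case: sk => i; subst a; rewrite -ab !ffunE leq_addr.
Qed.


Lemma madd0 (k : monom n) : madd [ffun=> 0%N] k = k.
Proof. by apply/ffunP => i; rewrite !ffunE. Qed.

Lemma madd0r (k : monom n) : madd k [ffun=> 0%N] = k.
Proof. by apply/ffunP => i; rewrite !ffunE addn0. Qed.

Lemma smon0_mul c g : series_mul (series_const c) g = (fun k => c * g k).
Proof. by apply/funext => k; rewrite -{1}(madd0 k) smon_mulE. Qed.

Lemma series_mul1 f : series_mul f (series_const 1) = f.
Proof.
apply/funext => k; rewrite series_mulE (bigD1_seq (k, [ffun=> 0%N])) /=; last 2 first.
- by apply/mem_decomps; rewrite /= madd0r.
- exact: fset_uniq.
rewrite /series_const eqxx mulr1 big_seq_cond big1 ?addr0 // => -[a b] /andP[/mem_decomps/= ab nab].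
case: eqP => [b0|]; last by rewrite mulr0.
by case/eqP: nab; rewrite -ab b0 madd0r.
Qed.

(** Leading monomial for the order that compares absolute values of coefficients and breaks ties
    lexicographically. *)
Definition lead f k :=
  f k != 0 /\ forall t, v (f t) <= v (f k) /\ (lexlt k t -> v (f t) < v (f k)).

(** Only finitely many coefficients are at least as large as a given nonzero one, so a maximum over
    a finite list is enough. *)
Lemma lead_exists f : tate v f -> (exists k, f k != 0) -> exists k, lead f k.
Proof.
move=> tf [k0 fk0]; have vk0 := abs_gt0 fk0.
have /finite_seqP[s es] := tf _ vk0.
have sE k : (k \in s) <-> v (f k0) <= v (f k).
  by have : [set` s] k <-> v (f k0) <= v (f k) by rewrite -es.
pose r k t := v (f k) < v (f t) \/ (v (f k) = v (f t) /\ (k = t \/ lexlt k t)).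
have tot k t : r k t \/ r t k.
  rewrite /r; case: (ltgtP (v (f k)) (v (f t))) => [||e]; [by left; left|by right; left|].
  case: (lexlt_total k t) => [->|[]]; [by left; right; split; auto| |].
    by left; right; split; auto.
  by right; right; split; auto.
have tr k t u : r k t -> r t u -> r k u.
  move=> [kt|[kt kt']] [tu|[tu tu']].
  - by left; exact: lt_trans tu.
  - by left; rewrite -tu.
  - by left; rewrite kt.
  - right; split; first by rewrite kt.
    case: kt' => [->//|kt']; case: tu' => [<-|tu']; right => //.
    exact: lexlt_trans tu'.
have [k ks kmax] := seq_max tot tr ((sE k0).2 (lexx _)).
have kk0 := (sE k).1 ks.
exists k; split => [|t].
  by apply: contraTneq kk0 => ->; rewrite abs0 -ltNge.
have [tk0|/sE/kmax [tk|[tk tk']]] := ltP (v (f t)) (v (f k0)).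
- by have tk := lt_le_trans tk0 kk0; rewrite ltW.
- by rewrite ltW.
- rewrite tk; split=> // kt; case: tk' => [tk'|tk'].
    by subst t; case: (lexlt_irr kt).
  by case: (lexlt_irr (lexlt_trans kt tk')).
Qed.

(** Only finitely many coefficients reach 1/2, so those below 1 stay away from 1 even if the value
    group is dense. This is the source of the contraction factor [eps] of the division. *)
Lemma tate_gap f : tate v f ->
  exists e, [/\ 0 < e, e < 1 & forall t, v (f t) < 1 -> v (f t) <= e].
Proof.
have h2 : 0 < 2^-1 :> R by rewrite invr_gt0.
move=> /(_ _ h2)/finite_seqP[s es].
exists (\big[Order.max/2^-1]_(k <- s | v (f k) < 1) v (f k)); split.
- by apply: lt_le_trans (bigmax_ge_id _ _ _ _); rewrite invr_gt0.
- apply: (big_ind (fun x => x < 1)) => //; last by move=> x y; rewrite gt_max => -> ->.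
  by rewrite invf_lt1 // ltr1n.
- move=> t t1; have [t2|/ltW t2] := leP 2^-1 (v (f t)).
    apply: le_bigmax_seq => //.
    by have : [set` s] t by rewrite -es.
  exact: le_trans (bigmax_ge_id _ _ _ _).
Qed.

End Series.
End AbsoluteValue.

(** * Division of Tate series *)

Section UltraLimit.
Variables (R : realType) (V : zmodType) (nrm : V -> R).
Hypothesis nrm0 : nrm 0 = 0.
Hypothesis nrmN : forall x, nrm (- x) = nrm x.
Hypothesis nrmD : forall x y, nrm (x + y) <= Num.max (nrm x) (nrm y).
Hypothesis nrm_cpl : ncomplete nrm.

Lemma ncvgP u l : (forall x, 0 <= nrm x) -> ncvg nrm u l <->
  forall e, 0 < e -> exists N : nat, forall m, (N <= m)%N -> nrm (u m - l) < e.
Proof.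
move=> nrm_ge0; split => [/cvgrPdist_lt ul e /ul[N _ uN]|ul].
  exists N => m /uN; rewrite sub0r normrN ger0_norm //.
apply/cvgrPdist_lt => e /ul[N uN]; exists N => // m /uN.
by rewrite sub0r normrN ger0_norm.
Qed.

(** By the ultrametric inequality the bound on one step bounds all later displacements, and the
    limit inherits it without loss. *)
Lemma ultra_limit (u : nat -> V) (e : nat -> R) : (forall x, 0 <= nrm x) ->
  (forall m m', (m <= m')%N -> e m' <= e m) ->
  (forall d, 0 < d -> exists m, e m < d) ->
  (forall m, nrm (u m.+1 - u m) <= e m) ->
  exists l, forall m, nrm (l - u m) <= e m.
Proof.
move=> nrm_ge0 emono e0 ue.
have nD x y c : nrm x <= c -> nrm y <= c -> nrm (x + y) <= c.
  by move=> xc yc; apply: le_trans (nrmD _ _) _; rewrite ge_max xc.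
have ue' m p : nrm (u (m + p)%N - u m) <= e m.
  elim: p => [|p IH].
    by rewrite addn0 subrr nrm0 (le_trans _ (ue m)).
  rewrite addnS -(subrK (u (m + p)%N) (u _)) -addrA; apply: nD => //.
  by apply: le_trans (ue _) _; apply: emono; rewrite leq_addr.
have cu : ncauchy nrm u.
  move=> d /e0[N eN]; exists N => m m' Nm Nm'.
  apply: le_lt_trans eN; rewrite -(subrK (u N) (u m)) -addrA; apply: nD.
    by rewrite -(subnKC Nm).
  by rewrite -nrmN opprB -(subnKC Nm').
have [l /(ncvgP _ _ nrm_ge0) ul] := nrm_cpl cu; exists l => m.
apply/ler_addgt0Pl => d d0; have [N uN] := ul _ d0.
rewrite -(subrK (u (m + N)%N) l) -addrA; apply: nD.
  rewrite -nrmN opprB; apply: (le_trans (ltW (uN _ (leq_addl _ _)))).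
  by rewrite lerDl (le_trans (nrm_ge0 _) (ue m)).
by apply: (le_trans (ue' _ _)); rewrite lerDr ltW.
Qed.

End UltraLimit.

Lemma exp_small (R : realType) (e c d : R) : 0 <= e -> e < 1 -> 0 < d ->
  exists m, e ^+ m * c < d.
Proof.
move=> e0 e1 d0.
have /cvgrPdist_lt/(_ _ d0)[N _ H] : (fun m => e ^+ m * c) @ \oo --> (0 : R).
  rewrite -[X in _ --> X](mul0r c); apply: cvgMl.
  by apply: cvg_expr; rewrite ger0_norm.
by exists N; have := H N (leqnn N); rewrite /= sub0r normrN => /(le_lt_trans (ler_norm _)).
Qed.

Section Division.
Variables (R : realType) (L : fieldType) (v : L -> R).
Hypothesis hv : absolute_value v.
Hypothesis v_complete : ncomplete v.
Variables (n r : nat) (gen : 'I_r -> Defs.series L n) (lm : 'I_r -> monom n).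
Variable eps : R.
Hypothesis gen_tate : forall i, tate v (gen i).
Hypothesis gen_lm : forall i, gen i (lm i) = 1.
Hypothesis gen_le : forall i, gauss_le v (gen i) 1.
Hypothesis gen_lt : forall i t, lexlt (lm i) t -> v (gen i t) < 1.
Hypothesis eps_gt0 : 0 < eps.
Hypothesis eps_lt1 : eps < 1.
Hypothesis gen_gap : forall i t, v (gen i t) < 1 -> v (gen i t) <= eps.

(* Index [None] carries the remainder of the division, the indices [Some i] the quotients. *)
Definition divisor (o : option 'I_r) : Defs.series L n :=
  if o is Some i then gen i else series_const 1.

Definition allowed (o : option 'I_r) (k : monom n) : Prop :=
  if o is Some i then True else ~ exists i, mdiv (lm i) k.

Definition combine (w : option 'I_r -> Defs.series L n) : Defs.series L n :=
  fun k => \sum_o series_mul (w o) (divisor o) k.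

Definition division_data (c : R) (w : option 'I_r -> Defs.series L n) :=
  forall o, [/\ tate v (w o), gauss_le v (w o) c & forall k, w o k != 0 -> allowed o k].

Lemma divisor_le o : gauss_le v (divisor o) 1.
Proof. by case: o => [i|] //=; rewrite -(abs1 hv); exact: smon_le. Qed.

Lemma divisor_tate o : tate v (divisor o).
Proof. by case: o => [i|] //=; exact: tate_smon. Qed.

Lemma combineD w w' k :
  combine (fun o l => w o l + w' o l) k = combine w k + combine w' k.
Proof. by rewrite /combine -big_split; apply: eq_bigr => o _; rewrite series_mulDl. Qed.

Lemma combineZ c w k : combine (fun o l => c * w o l) k = c * combine w k.
Proof. by rewrite /combine mulr_sumr; apply: eq_bigr => o _; rewrite series_mulZl. Qed.

Lemma combine0 k : combine (fun _ _ => 0) k = 0.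
Proof. by rewrite /combine big1 // => o _; rewrite series_mul0l. Qed.

Lemma combine_sum (T : Type) (s : seq T) (c : T -> L) (w : T -> option 'I_r -> Defs.series L n) k :
  combine (fun o l => \sum_(t <- s) c t * w t o l) k = \sum_(t <- s) c t * combine (w t) k.
Proof.
elim: s => [|a s IH].
  rewrite big_nil -[RHS](combine0 k); congr (combine _ k).
  by apply/funext => o; apply/funext => l; rewrite big_nil.
rewrite big_cons -IH -combineZ -combineD; congr (combine _ k).
by apply/funext => o; apply/funext => l; rewrite big_cons.
Qed.

Lemma combine_le c w : (forall o, gauss_le v (w o) c) -> gauss_le v (combine w) c.
Proof.
move=> wc k; apply: abs_sum => //; first exact: (gauss_ge0 hv (wc None)).
move=> o _; rewrite -[c]mulr1; apply: series_mul_le => //; exact: divisor_le.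
Qed.

Lemma combine_tate c w : division_data c w -> tate v (combine w).
Proof.
move=> dw; apply: (tate_sum hv (index_enum _) (F := fun o => series_mul (w o) (divisor o))) => o.
by apply: tate_mul => //; [have [] := dw o|exact: divisor_tate].
Qed.

Lemma division_data_sum (T : Type) (s : seq T) (b : T -> L) (w : T -> option 'I_r -> Defs.series L n) c :
  0 <= c -> (forall t, v (b t) <= c) -> (forall t, division_data 1 (w t)) ->
  division_data c (fun o l => \sum_(t <- s) b t * w t o l).
Proof.
move=> c0 bc dw o; split.
- by apply: (tate_sum hv s (F := fun t k => b t * w t o k)) => t; apply: tateZ => //; have [] := dw t o.
- move=> k; apply: abs_sum => // t _; rewrite abs_mul // -[c]mulr1 ler_pM ?abs_ge0 //.
  by have [_ ->] := dw t o.
- move=> k; apply: contra_neqP => ak; rewrite big1 // => t _.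
  have [_ _ /(_ k) H] := dw t o; have [->|/H//] := eqVneq (w t o k) 0.
  by rewrite mulr0.
Qed.

Lemma division_dataD c w w' : division_data c w -> division_data c w' ->
  division_data c (fun o l => w o l + w' o l).
Proof.
move=> dw dw' o; have [tw lw aw] := dw o; have [tw' lw' aw'] := dw' o; split.
- exact: tateD.
- by move=> k; exact: abs_addle.
- move=> k; have [->|/aw//] := eqVneq (w o k) 0; rewrite add0r; exact: aw'.
Qed.

Lemma sum_smon (T : seq (monom n)) (b : monom n -> L) l : uniq T ->
  \sum_(t <- T) b t * smon 1 t l = if l \in T then b l else 0.
Proof.
move=> uT; case: ifPn => lT.
  rewrite (bigD1_seq l) //= {1}/smon eqxx mulr1 big1 ?addr0 // => t tl.
  by rewrite /smon eq_sym (negbTE tl) mulr0.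
rewrite big_seq big1 // => t tT; rewrite /smon; case: eqP => [lt|]; last by rewrite mulr0.
by rewrite lt tT in lT.
Qed.

(** Lexicographic induction. If [k = s + lm i], subtracting [X^s gen i] trades [X^k] for the
    monomials [s + t] with [|gen i t| = 1], which are all smaller; the remaining coefficients are at
    most [eps] and go into the error. *)
Lemma divide_monomial k : exists w, division_data 1 w /\
  gauss_le v (fun l => smon 1 k l - combine w l) eps.
Proof.
elim/lexlt_ind: k => k IH.
have [[i ik]|nk] := pselect (exists i, mdiv (lm i) k); last first.
  exists (fun o => if o is Some i then fun=> 0 else smon 1 k); split.
    move=> [i|]; split => //=.
    - exact: tate0.
    - by move=> l; rewrite abs0.
    - exact: tate_smon.
    - by rewrite -(abs1 hv); exact: smon_le.
    - by move=> l; rewrite /smon; have [->|] := eqVneq l k; rewrite ?eqxx.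
  move=> l; rewrite /combine (bigD1 None) //= big1 ?addr0; last first.
    by move=> [i|] // _; rewrite series_mul0l.
  by rewrite series_mul1 // subrr abs0 // ltW.
pose s := msub k (lm i); have sk : madd s (lm i) = k by exact: msubK.
have Tfin : finite_set [set t | eps <= v (gen i t) /\ v (gen i t) = 1 /\ t <> lm i].
  by apply: sub_finite_set (gen_tate i eps_gt0) => t [].
pose T : seq (monom n) := fset_set [set t | eps <= v (gen i t) /\ v (gen i t) = 1 /\ t <> lm i].
have TE t : t \in T -> v (gen i t) = 1 /\ t <> lm i.
  by rewrite /T in_fset_set // => /set_mem[_ []].
have TE' t : t \notin T -> t <> lm i -> v (gen i t) <= eps.
  move=> tT tl; apply: gen_gap; rewrite lt_neqAle gen_le andbT.
  apply: contraNneq tT => t1; rewrite /T in_fset_set //; apply/mem_set.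
  by rewrite /= t1 ltW.
have uT : uniq T by exact: fset_uniq.
have /choice[w wP] : forall t, exists w, division_data 1 w /\
    (t \in T -> gauss_le v (fun l => smon 1 (madd s t) l - combine w l) eps).
  move=> t; have [tT|tT] := boolP (t \in T).
    have [|w [dw wle]] := IH (madd s t); last by exists w.
    rewrite -sk; apply: lexlt_addl; have [t1 tl] := TE _ tT.
    case: (lexlt_total t (lm i)) => [//|[//|/gen_lt]].
    by rewrite t1 ltxx.
  exists (fun _ _ => 0); split=> // o; split.
  - exact: tate0.
  - by move=> l; rewrite abs0.
  - by move=> l; rewrite eqxx.
pose w0 (o : option (ordinal r)) : Defs.series L n := if o == Some i then smon 1 s else fun=> 0.
exists (fun o l => w0 o l + \sum_(t <- T) (- gen i t) * w t o l); split.
  apply: division_dataD.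
    move=> o; rewrite /w0; case: eqP => [->|_]; split => //=.
    - exact: tate_smon.
    - by rewrite -(abs1 hv); exact: smon_le.
    - exact: tate0.
    - by move=> l; rewrite abs0.
    - by move=> l; rewrite eqxx.
  apply: division_data_sum => // [t|t]; first by rewrite absN //; exact: gen_le.
  by have [] := wP t.
move=> l; rewrite combineD combine_sum.
have -> : combine w0 l = series_mul (smon 1 s) (gen i) l.
  rewrite /combine (bigD1 (Some i)) //= {1}/w0 eqxx big1 ?addr0 // => o oi.
  by rewrite /w0 (negbTE oi) series_mul0l.
(* [A] puts back the terms of absolute value 1, so that [X^k - X^s gen i + A] is small; [D] gathers
   the errors of the induction hypothesis. *)
pose A := \sum_(t <- T) gen i t * smon 1 (madd s t) l.
pose D := \sum_(t <- T) gen i t * (smon 1 (madd s t) l - combine (w t) l).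
have -> : smon 1 k l - (series_mul (smon 1 s) (gen i) l + \sum_(t <- T) - gen i t * combine (w t) l) =
    (smon 1 k l - series_mul (smon 1 s) (gen i) l + A) - D.
  rewrite opprD addrA -[RHS]addrA; congr (_ + _).
  rewrite /A /D -!sumrN -big_split; apply: eq_bigr => t _ /=; ring.
apply: abs_suble => //; last first.
  rewrite /D big_seq; apply: abs_sum => // [|t tT]; first exact: ltW.
  rewrite abs_mul // -[eps]mul1r ler_pM ?abs_ge0 ?gen_le //.
  by have [_ /(_ tT l)] := wP t.
have madd_inj t t' : (madd s t == madd s t') = (t == t').
  apply/eqP/eqP => [/ffunP e|->//]; apply/ffunP => j.
  by have := e j; rewrite !ffunE => /addnI.
have [/msubK sl|sl] := pselect (mdiv s l).
  have {}sl : madd s (msub l s) = l.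
    by rewrite -{2}sl; apply/ffunP => j; rewrite !ffunE addnC.
  rewrite /A -sl smon_mulE // mul1r; set u := msub l s.
  have -> : \sum_(t <- T) gen i t * smon 1 (madd s t) (madd s u) =
            \sum_(t <- T) gen i t * smon 1 t u.
    by apply: eq_bigr => t _; rewrite /smon madd_inj.
  rewrite sum_smon // /smon -sk madd_inj.
  case: eqP => [->|ul].
    rewrite gen_lm subrr add0r; case: ifP => [/TE[]//|_]; first by rewrite abs0 // ltW.
  rewrite add0r; case: ifPn => [_|uT']; first by rewrite addNr abs0 // ltW.
  by rewrite addr0 absN //; exact: TE'.
have ns t : l != madd s t.
  by apply: contra_notN sl => /eqP -> j; rewrite !ffunE leq_addr.
rewrite smon_mul_out // /A /smon -sk (negbTE (ns _)) subr0 add0r big1 ?abs0 ?ltW // => t _.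
by rewrite (negbTE (ns _)) mulr0.
Qed.

(** Coefficients below [eps * c] may stay in the error, so only finitely many monomials have to be
    divided. *)
Lemma divide_approx f c : tate v f -> gauss_le v f c -> 0 < c ->
  exists w, division_data c w /\ gauss_le v (fun l => f l - combine w l) (eps * c).
Proof.
move=> tf fc c0; have ec0 := mulr_gt0 eps_gt0 c0.
have /choice[w wP] := divide_monomial.
pose T : seq (monom n) := fset_set [set k | eps * c <= v (f k)].
have TE k : (k \in T) = (eps * c <= v (f k)).
  rewrite /T in_fset_set; last exact: tf.
  by apply/idP/idP => [/set_mem//|?]; apply/mem_set.
have uT : uniq T by exact: fset_uniq.
exists (fun o l => \sum_(t <- T) f t * w t o l); split.
  by apply: division_data_sum; [exact: ltW| |move=> t; have [] := wP t].
move=> l; rewrite combine_sum.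
have -> : f l - \sum_(t <- T) f t * combine (w t) l =
   (f l - \sum_(t <- T) f t * smon 1 t l) + \sum_(t <- T) f t * (smon 1 t l - combine (w t) l).
  rewrite -addrA; congr (_ + _); rewrite -!sumrN -big_split; apply: eq_bigr => t _ /=; ring.
apply: abs_addle => //.
  rewrite sum_smon // TE; case: (leP (eps * c) (v (f l))) => [_|/ltW]; last by rewrite subr0.
  by rewrite subrr abs0 // ltW.
apply: abs_sum => // [|t _]; first exact: ltW.
rewrite abs_mul // mulrC ler_pM ?abs_ge0 //; by have [_] := wP t; apply.
Qed.

(** Approximate division is repeated on the error, which shrinks like [eps ^+ m]; the quotients and
    the remainder converge coefficientwise. *)
Lemma divide f : tate v f ->
  exists w, (forall o, tate v (w o) /\ forall k, w o k != 0 -> allowed o k) /\ f = combine w.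
Proof.
move=> tf; have [c c0 fc] := tate_bound tf.
have /choice[W WP] : forall p : Defs.series L n * R, exists w,
    tate v p.1 -> gauss_le v p.1 p.2 -> 0 < p.2 ->
    division_data p.2 w /\ gauss_le v (fun l => p.1 l - combine w l) (eps * p.2).
  move=> [g b] /=; have [[tg [gb b0]]|] := pselect (tate v g /\ gauss_le v g b /\ 0 < b).
    by have [w wP] := divide_approx tg gb b0; exists w.
  by move=> H; exists (fun _ _ => 0) => tg gb b0; case: H.
pose b m := eps ^+ m * c.
have b0 m : 0 < b m by rewrite mulr_gt0 // exprn_gt0.
pose F := fix F m := if m is m'.+1 then fun l => F m' l - combine (W (F m', b m')) l else f.
have FP m : tate v (F m) /\ gauss_le v (F m) (b m).
  elim: m => [|m [tF Fb]]; first by rewrite /b expr0 mul1r.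
  have [dw wb] := WP (F m, b m) tF Fb (b0 m); split.
    by apply: tateB => //; exact: combine_tate dw.
  by move=> l; rewrite /b exprS -mulrA; exact: wb.
pose w m := W (F m, b m).
have dw m : division_data (b m) (w m).
  by have [tF Fb] := FP m; have [] := WP (F m, b m) tF Fb (b0 m).
pose S m o l := \sum_(j < m) 1 * w j o l.
have SF m l : f l - combine (S m) l = F m l.
  rewrite /S combine_sum; elim: m => [|m IH]; first by rewrite big_ord0 subr0.
  by rewrite big_ord_recr /= opprD addrA IH mul1r.
have bmono m m' : (m <= m')%N -> b m' <= b m.
  move=> mm'; rewrite ler_pM2r //; apply: ler_wiXn2l => //; exact: ltW.
have bsmall d : 0 < d -> exists m, b m < d.
  by move=> d0; apply: exp_small => //; exact: ltW.
have /choice[q qP] : forall p : option 'I_r * monom n, exists x, forall m, v (x - S m p.1 p.2) <= b m.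
  move=> [i k] /=; apply: (@ultra_limit _ _ v).
  - exact: (abs0 hv).
  - by move=> x; exact: absN.
  - exact: abs_add.
  - exact: v_complete.
  - exact: (abs_ge0 hv).
  - exact: bmono.
  - exact: bsmall.
  - move=> m; rewrite /S big_ord_recr /= [X in v X]addrC addKr mul1r.
    by have [_ ->] := dw m i.
pose wl o k := q (o, k).
have wlP m o : gauss_le v (fun k => wl o k - S m o k) (b m) by move=> k; exact: (qP (o, k) m).
exists wl; split.
  move=> o; split.
    (* Where the limit has a coefficient of size at least [e], so has the partial sum [S m], which
       is a Tate series. *)
    move=> e e0; have [m bm] := bsmall e e0.
    have tS : tate v (S m o).
      apply: (tate_sum hv (index_enum _) (F := fun j k => 1 * w (val j) o k)) => j.
      by apply: tateZ => //; have [] := dw j o.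
    apply: sub_finite_set (tS e e0) => k /= ek.
    rewrite leNgt; apply/negP => Se; move: ek; rewrite leNgt => /negP; apply.
    rewrite -(subrK (S m o k) (wl o k)) (le_lt_trans (abs_add hv _ _)) // gt_max Se andbT.
    exact: le_lt_trans (wlP m o k) bm.
  move=> k; apply: contra_neqP => ak; apply/(abs_eq0 hv)/eqP.
  rewrite eq_le abs_ge0 // andbT; apply/ler_addgt0Pl => e /bsmall[m bm]; rewrite addr0.
  apply: le_trans (ltW bm); have := wlP m o k.
  suff -> : S m o k = 0 by rewrite subr0.
  rewrite /S big1 // => j _; rewrite mul1r; apply/eqP/negPn/negP => /= wj; apply: ak.
  by have [_ _ /(_ k)] := dw j o; apply.
apply/funext => k; apply/eqP; rewrite -subr_eq0; apply/eqP/(abs_eq0 hv)/eqP.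
rewrite eq_le abs_ge0 // andbT; apply/ler_addgt0Pl => e /bsmall[m bm]; rewrite addr0.
apply: le_trans (ltW bm).
have -> : f k - combine wl k = F m k - combine (fun o l => wl o l + -1 * S m o l) k.
  by rewrite -SF combineD combineZ; ring.
apply: abs_suble => //; first by have [_] := FP m; apply.
apply: combine_le => o l; rewrite mulN1r; exact: wlP.
Qed.

End Division.

(** * Noetherianity of affinoid algebras *)

Section Ideals.
Variable B : comPzRingType.
Implicit Types (I : set B) (x y : B).

Lemma idealB I x y : is_ideal I -> I x -> I y -> I (x - y).
Proof. by move=> [_ D M] Ix Iy; apply: D => //; rewrite -mulN1r; exact: M. Qed.

Lemma ideal_sum I (T : Type) (s : seq T) (P : pred T) (F : T -> B) :
  is_ideal I -> (forall t, P t -> I (F t)) -> I (\sum_(t <- s | P t) F t).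
Proof. by move=> [I0 D _] IF; apply: (big_ind I) => // *; exact: D. Qed.

End Ideals.

Section Noetherian.
Variables (R : realType) (L : fieldType) (v : L -> R).
Hypothesis hv : absolute_value v.
Hypothesis v_complete : ncomplete v.

(** By Dickson, finitely many monomials divide the leading monomials of all lifts of elements of all
    [J k]; [N] is a stage at which series realizing them have appeared. Dividing a lift of an
    element of [J k] by these series leaves a remainder with image in [J (maxn k N)]; if nonzero,
    its leading monomial would be one that the division excludes. *)
Lemma affinoid_noetherian (B : lalgebra L) (J : nat -> set B) : affinoid v B ->
  (forall k, is_ideal (J k)) -> (forall k, J k `<=` J k.+1) ->
  exists N, forall k, J k `<=` J N.
Proof.
move=> [n [pi [piD piM piC pi_surj]]] Jid Jmono.
have Jle k l : (k <= l)%N -> J k `<=` J l.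
  by move=> /subnK <-; elim: (l - k)%N => // p IH x /IH /Jmono.
have JZ k x y : J k y -> J k (x * y) by have [_ _] := Jid k; apply.
have pi0 : pi (fun=> 0) = 0.
  have t0 := @tate0 _ _ _ hv n.
  have := piD _ _ t0 t0; under [X in pi X = _ -> _]funext do rewrite addr0.
  by move/eqP; rewrite -subr_eq0 opprD addNKr oppr_eq0 => /eqP.
have pi_sum (T : Type) (s : seq T) (F : T -> Defs.series L n) : (forall t, tate v (F t)) ->
    pi (fun k => \sum_(t <- s) F t k) = \sum_(t <- s) pi (F t).
  move=> tF; elim: s => [|a s IH].
    by rewrite big_nil -[RHS]pi0; congr pi; apply/funext => k; rewrite big_nil.
  rewrite big_cons -IH -piD //; last exact: tate_sum.
  by congr pi; apply/funext => k; rewrite big_cons.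
pose S := [set m | exists kf : nat * Defs.series L n, [/\ tate v kf.2, J kf.1 (pi kf.2) & lead v kf.2 m]].
have [s sS Ss] := dickson S.
pose m0 : monom n := [ffun=> 0%N].
pose lm (i : 'I_(size s)) := nth m0 s i.
have /choice[kf kfP] : forall i : 'I_(size s), exists kf : nat * Defs.series L n,
    [/\ tate v kf.2, J kf.1 (pi kf.2) & lead v kf.2 (lm i)].
  by move=> i; apply: (sS (lm i)); exact: mem_nth.
pose c i := ((kf i).2 (lm i))^-1.
pose gen i : Defs.series L n := series_mul (series_const (c i)) (kf i).2.
have genE i k : gen i k = c i * (kf i).2 k by rewrite /gen smon0_mul.
have gen_tate i : tate v (gen i).
  by apply: tate_mul => //; [exact: tate_smon | have [] := kfP i].
have lead_neq0 i : (kf i).2 (lm i) != 0 by have [_ _ []] := kfP i.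
have gen_lm i : gen i (lm i) = 1 by rewrite genE mulVf.
have vc i x : v (c i * x) = v x / v ((kf i).2 (lm i)).
  by rewrite abs_mul // absV // mulrC.
have gen_le i : gauss_le v (gen i) 1.
  move=> k; rewrite genE vc ler_pdivrMr ?abs_gt0 // mul1r.
  by have [_ _ [_ /(_ k)[]]] := kfP i.
have gen_lt i t : lexlt (lm i) t -> v (gen i t) < 1.
  move=> lt_t; rewrite genE vc ltr_pdivrMr ?abs_gt0 // mul1r.
  by have [_ _ [_ /(_ t)[_]]] := kfP i; apply.
have /choice[e eP] i := tate_gap (gen_tate i).
pose eps := \big[Order.max/2^-1]_i e i.
have eps_gt0 : 0 < eps by apply: lt_le_trans (bigmax_ge_id _ _ _ _); rewrite invr_gt0.
have eps_lt1 : eps < 1.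
  apply: (big_ind (fun x => x < 1)); first by rewrite invf_lt1 // ltr1n.
    by move=> x y x1 y1; rewrite gt_max x1.
  by move=> i _; have [] := eP i.
have gen_gap i t : v (gen i t) < 1 -> v (gen i t) <= eps.
  move=> t1; have [_ _ /(_ t t1) h] := eP i; apply: (le_trans h).
  exact: le_bigmax.
pose N := \max_i (kf i).1.
have JN i : J N (pi (gen i)).
  rewrite piM; [|exact: tate_smon|by have [] := kfP i].
  apply: JZ; have [_ Jk _] := kfP i; apply: Jle Jk.
  exact: (leq_bigmax (F := fun i => (kf i).1)).
exists N => k b Jb; have [f tf fb] := pi_surj b; subst b.
have [w [wP fE]] := divide hv v_complete gen_tate gen_lm gen_le gen_lt eps_gt0 eps_lt1 gen_gap tf.
pose Q := \sum_(o | o != None) pi (w o) * pi (divisor gen o).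
have JQ : J N Q.
  by apply: ideal_sum => // -[i|] // _; apply: JZ; exact: JN.
have piw : pi f = Q + pi (w None).
  rewrite fE /combine pi_sum; last first.
    move=> i; apply: tate_mul => //; first by have [] := wP i.
    exact: divisor_tate.
  rewrite (bigD1 None) //= addrC; congr (_ + _); last first.
    rewrite piM; last exact: tate_smon; first last.
    - by have [] := wP None.
    - by rewrite piC rmorph1 mulr1.
  apply: eq_bigr => i _; rewrite piM //; first by have [] := wP i.
  exact: divisor_tate.
have rho0 : w None = fun=> 0.
  apply: contrapT => rho; have [tw aw] := wP None.
  have [m lm_m] : exists m, lead v (w None) m.
    apply: lead_exists => //; apply: contrapT => nw; apply: rho.
    by apply/funext => l; apply: contrapT => /eqP wl; apply: nw; exists l.
  have [/aw /= + _] := lm_m; apply.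
  have /Ss[l ls lm_l] : S m.
    exists (maxn k N, w None); split => //=.
    have -> : pi (w None) = pi f - Q.
      by rewrite piw addrC addKr.
    apply: idealB => //; first exact: Jle (leq_maxl _ _) _ Jb.
    exact: Jle (leq_maxr _ _) _ JQ.
  have ls' : (index l s < size s)%N by rewrite index_mem.
  by exists (Ordinal ls'); rewrite /lm /= nth_index.
by rewrite piw rho0 pi0 addr0.
Qed.

End Noetherian.

(** * Quotients by ideals given as sets *)

Section Quotient.
Variable B : comPzRingType.

(** The proof is bundled with the ideal so that the ring structure can be attached to the quotient
    by [I]. The unit ideal is allowed, with the zero ring as quotient. *)
Record ideal_of := IdealOf { ideal_set :> set B; idealP : is_ideal ideal_set }.

Variable I : ideal_of.

Definition ideal_pred : {pred B} := fun x => `[< ideal_set I x >].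

Lemma ideal_pred_zmod : zmod_closed ideal_pred.
Proof.
split=> [|x y]; first by apply/asboolP; case: (idealP I).
rewrite !unfold_in => /asboolP Ix /asboolP Iy; apply/asboolP; apply: idealB => //.
exact: idealP.
Qed.

HB.instance Definition _ := GRing.isZmodClosed.Build B ideal_pred ideal_pred_zmod.

Definition quotient_ring := Quotient.quot ideal_pred.
HB.instance Definition _ := GRing.Zmodule.on quotient_ring.

Definition quotient_proj (x : B) : quotient_ring := (\pi x)%qT.

Lemma quotient_projE x y : quotient_proj x = quotient_proj y <-> ideal_set I (x - y).
Proof.
have H : ((x - y) \in ideal_pred) = (quotient_proj x == quotient_proj y).
  exact: Quotient.idealrBE.
split=> [/eqP|xy]; first by rewrite -H => /asboolP.
by apply/eqP; rewrite -H; apply/asboolP.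
Qed.

Definition quotient_repr (x : quotient_ring) : B := repr x.

Lemma quotient_reprK x : quotient_proj (quotient_repr x) = x.
Proof. exact: reprK. Qed.

Lemma quotient_projB : {morph quotient_proj : x y / x - y}.
Proof. exact: (raddfB (\pi_(Quotient.quot ideal_pred))%qT). Qed.

Lemma quotient_projD : {morph quotient_proj : x y / x + y}.
Proof. exact: (raddfD (\pi_(Quotient.quot ideal_pred))%qT). Qed.

Definition quotient_one := quotient_proj 1.
Definition quotient_mul x y := quotient_proj (quotient_repr x * quotient_repr y).

Lemma quotient_projM x y :
  quotient_proj (x * y) = quotient_mul (quotient_proj x) (quotient_proj y).
Proof.
apply/quotient_projE; set x' := quotient_repr _; set y' := quotient_repr _.
have [_ D M] := idealP I.
have Ix : ideal_set I (x - x') by apply/quotient_projE; rewrite quotient_reprK.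
have Iy : ideal_set I (y - y') by apply/quotient_projE; rewrite quotient_reprK.
have -> : x * y - x' * y' = x * (y - y') + y' * (x - x') by ring.
by apply: D; exact: M.
Qed.

Lemma quotient_mulA : associative quotient_mul.
Proof.
move=> x y z; rewrite -[x]quotient_reprK -[y]quotient_reprK -[z]quotient_reprK.
by rewrite -!quotient_projM mulrA.
Qed.

Lemma quotient_mulC : commutative quotient_mul.
Proof. by move=> x y; rewrite /quotient_mul mulrC. Qed.

Lemma quotient_mul1 : left_id quotient_one quotient_mul.
Proof. by move=> x; rewrite -[x]quotient_reprK -quotient_projM mul1r. Qed.

Lemma quotient_mulDl : left_distributive quotient_mul +%R.
Proof.
move=> x y z; rewrite -[x]quotient_reprK -[y]quotient_reprK -[z]quotient_reprK.
by rewrite -(quotient_projD (quotient_repr x)) -!quotient_projM -quotient_projD -mulrDl.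
Qed.

HB.instance Definition _ := GRing.Zmodule_isComPzRing.Build quotient_ring
  quotient_mulA quotient_mulC quotient_mul1 quotient_mulDl.

HB.instance Definition _ := GRing.isZmodMorphism.Build B quotient_ring quotient_proj
  quotient_projB.
HB.instance Definition _ := GRing.isMonoidMorphism.Build B quotient_ring quotient_proj
  (conj erefl quotient_projM).

End Quotient.

(** * Coverings by affinoid subdomains *)

(** The empty set is adjoined to [Q] to take care of the empty chain; if the maximal element found
    is empty, maximality forces [S0] to be empty as well. *)
Lemma Zorn_chain (T : Type) (Q : set (set T)) (S0 : set T) : Q S0 ->
  (forall F : set (set T), F `<=` Q -> F !=set0 -> total_on F subset ->
     Q (\bigcup_(X in F) X)) ->
  exists A, Q A /\ forall A', A `<=` A' -> Q A' -> A' = A.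
Proof.
move=> QS0 Qchain.
have [|A [PA Amax]] := @Zorn_bigcup _ [set X | X = set0 \/ Q X].
  move=> F FP totF; have [[X [FX QX]]|noQ] := pselect (exists X, F X /\ Q X).
    right; have -> : \bigcup_(X in F) X = \bigcup_(X in F `&` Q) X.
      apply/seteqP; split => x [Y FY Yx]; last by exists Y => //; case: FY.
      exists Y => //; split => //; case: (FP _ FY) => // Y0.
      by rewrite Y0 in Yx.
    apply: Qchain => [Y []//||Y Z [FY _] [FZ _]]; first by exists X.
    exact: totF.
  left; rewrite -subset0 => x [Y FY Yx]; case: (FP _ FY) => [Y0|QY].
    by rewrite Y0 in Yx.
  by case: noQ; exists Y.
have Amax' A' : A `<=` A' -> Q A' -> A' = A.
  move=> AA' QA'; apply: contrapT => ne; apply: (Amax A'); last by right.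
  rewrite properEneq; split=> //; apply/eqP => AA; exact: ne.
case: PA => [A0|QA]; last by exists A.
by subst A; exists S0; split => // A' _ QA'; rewrite (Amax' _ _ QA') // (Amax' _ _ QS0).
Qed.

Section MaximalIdeals.
Variable B : comPzRingType.
Implicit Types (I m : set B) (x : B).

Definition ideal_adjoin I x : set B := [set z | exists a b, I a /\ z = a + b * x].

Lemma ideal_adjoinP I x : is_ideal I -> is_ideal (ideal_adjoin I x).
Proof.
move=> [I0 D M]; split.
- by exists 0, 0; split => //; rewrite mul0r addr0.
- move=> _ _ [a [b [Ia ->]]] [a' [b' [Ia' ->]]]; exists (a + a'), (b + b').
  by split; [exact: D | ring].
- move=> c _ [a [b [Ia ->]]]; exists (c * a), (c * b); split; [exact: M | ring].
Qed.

Lemma sub_ideal_adjoin I x : I `<=` ideal_adjoin I x.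
Proof. by move=> a Ia; exists a, 0; split => //; rewrite mul0r addr0. Qed.

Lemma mem_ideal_adjoin I x : is_ideal I -> ideal_adjoin I x x.
Proof. by move=> [I0 _ _]; exists 0, 1; split => //; rewrite mul1r add0r. Qed.

(** If [x] is outside [m], then [1 = a + b x] with [a] in [m]; multiplying by [x ^+ N] leads from
    [x ^+ N.+1] in [m] to [x ^+ N] in [m], and down to 1. *)
Lemma Sp_radical m x N : Sp B m -> m (x ^+ N) -> m x.
Proof.
move=> [hm m1 mmax] mxN; apply: contrapT => mx.
have [a [b [ma ab]]] : ideal_adjoin m x 1.
  apply: contrapT => n1.
  have e := mmax _ (ideal_adjoinP x hm) (@sub_ideal_adjoin m x) n1.
  by apply: mx; rewrite -e; exact: mem_ideal_adjoin.
case: hm => m0 D M.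
elim: N mxN => [|N IH mxN]; first by rewrite expr0.
apply: IH; rewrite -[x ^+ N]mulr1 ab.
have -> : x ^+ N * (a + b * x) = x ^+ N * a + b * x ^+ N.+1 by rewrite exprS; ring.
by apply: D; exact: M.
Qed.

End MaximalIdeals.

Section Injectivity.
Variables (R : realType) (L : fieldType) (v : L -> R).
Hypothesis hv : absolute_value v.
Hypothesis v_complete : ncomplete v.

Lemma affinoid_quotient (B : lalgebra L) (I : ideal_of B) : affinoid v B ->
  affinoid v (LAlgebra (quotient_proj I \o lstr B)).
Proof.
move=> [n [pi [piD piM piC pi_surj]]].
exists n, (quotient_proj I \o pi); split => /=.
- by move=> f g tf tg; rewrite piD // rmorphD.
- by move=> f g tf tg; rewrite piM // rmorphM.
- by move=> c; rewrite piC.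
- move=> b; have [f tf fb] := pi_surj (quotient_repr b); exists f => //.
  by rewrite fb quotient_reprK.
Qed.

(* If [f != 0], an ideal [I] maximal among those not containing [f] lies in a
   single maximal ideal [m = (I : f)], because [B] is noetherian; so
   [B -> B/I] factors through a subdomain containing [m], on which [f]
   vanishes. *)
Lemma subdomain_cover_inj (B : lalgebra L) (H : set (set (set B))) (f : B) :
  affinoid v B -> \bigcup_(W in H) W = Sp B ->
  (forall W, H W -> exists (B' : lalgebra L) (rho : {rmorphism B -> B'}),
     represents v W rho /\ rho f = 0) ->
  f = 0.
Proof.
move=> affB Hcov Hf; apply: contrapT => f0.
have [||I [[idI nIf] Imax]] := @Zorn_chain _ [set I | is_ideal I /\ ~ I f] [set 0].
- split=> [|/=]; last exact: f0.
  split=> [//|x y -> ->|b x ->]; [by rewrite addr0|by rewrite mulr0].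
- move=> F FQ [I0 FI0] totF; split; last by move=> [I /FQ[_]].
  split.
  + by exists I0 => //; have [[]] := FQ _ FI0.
  + move=> x y [I FI Ix] [J FJ Jy]; case: (totF _ _ FI FJ) => [IJ|JI].
    * by exists J => //; have [[_ D _] _] := FQ _ FJ; apply: D => //; exact: IJ.
    * by exists I => //; have [[_ D _] _] := FQ _ FI; apply: D => //; exact: JI.
  + by move=> b x [I FI Ix]; exists I => //; have [[_ _ M] _] := FQ _ FI; exact: M.
have [I0 D M] := idI.
have Iadj x : ~ I x -> exists a b, I a /\ f = a + b * x.
  move=> nIx; apply: contrapT => nf; apply: nIx.
  have /(_ _)<- := Imax _ (@sub_ideal_adjoin _ I x); first exact: mem_ideal_adjoin.
  by split=> //; exact: ideal_adjoinP.
pose m := [set x | I (x * f)].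
have idm : is_ideal m.
  split; rewrite /m /=; first by rewrite mul0r.
    by move=> x y Ix Iy; rewrite mulrDl; exact: D.
  by move=> b x Ix; rewrite -mulrA; exact: M.
have Spm : Sp B m.
  split => //; first by rewrite /m /= mul1r.
  move=> J idJ mJ nJ1; apply/seteqP; split=> // x Jx; rewrite /m /=.
  apply: contrapT => nIx; apply: nJ1; have [a [b [Ia fE]]] := Iadj _ nIx.
  have [_ DJ MJ] := idJ.
  have -> : 1 = (1 - b * x) + b * x by ring.
  apply: DJ; last exact: MJ.
  apply: mJ; rewrite /m /=; suff -> : (1 - b * x) * f = a by [].
  by rewrite mulrBl mul1r {1}fE; ring.
(* The chain of ideals [(I : x^k)] is stationary from some [N] on. If [x^N] were outside [I], then
   [f = a + b x^N] with [a] in [I]; as [x f] is in [I], [b] is in [(I : x^(N+1))], hence in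
   [(I : x^N)], and [f] would be in [I]. *)
have m_nil x : m x -> exists N, I (x ^+ N).
  move=> mx; pose J k := [set y | I (y * x ^+ k)].
  have [|k|N JN] := affinoid_noetherian hv v_complete (J := J) affB.
  - move=> k; split; rewrite /J /=; first by rewrite mul0r.
      by move=> y z Iy Iz; rewrite mulrDl; exact: D.
    by move=> b y Iy; rewrite -mulrA; exact: M.
  - move=> y; rewrite /J /= => Iy.
    by have -> : y * x ^+ k.+1 = x * (y * x ^+ k); [rewrite exprS; ring|exact: M].
  exists N; apply: contrapT => /Iadj[a [b [Ia fE]]]; apply: nIf; rewrite fE.
  apply: D => //; apply: (JN N.+1); rewrite /J /=.
  have -> : b * x ^+ N.+1 = x * f - x * a by rewrite fE exprS; ring.
  by apply: idealB => //; exact: M.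
have [W HW Wm] : (\bigcup_(W in H) W) m by rewrite Hcov.
have [B' [rho [[_ _ _ rho_univ] rhof]]] := Hf _ HW.
pose Io := IdealOf idI.
pose D' := LAlgebra (quotient_proj Io \o lstr B).
(* The preimage of a maximal ideal of [B/I] contains a power of each element of [m], hence contains
   [m], hence equals it. *)
have into : @Sp_into L B D' (quotient_proj Io) W.
  move=> m' Spm'; suff -> : (quotient_proj Io) @^-1` m' = m by [].
  have [[m'0 m'D m'M] nm'1 _] := Spm'; have [_ _ mmax] := Spm; apply: mmax.
  - split; rewrite /preimage /=.
    + by rewrite rmorph0.
    + by move=> x y; rewrite rmorphD; exact: m'D.
    + by move=> b x; rewrite rmorphM; exact: m'M.
  - move=> x /m_nil[N IN]; apply: (@Sp_radical D' m' _ N Spm').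
    have e : quotient_proj Io x ^+ N = 0 :> quotient_ring Io.
      by rewrite -rmorphXn -(rmorph0 (quotient_proj Io)); apply/quotient_projE; rewrite subr0.
    exact: (eq_ind_r m' m'0 e).
  - by rewrite /preimage /= rmorph1.
have [g [_ grho _]] := rho_univ D' (quotient_proj Io) (affinoid_quotient Io affB) (fun c => erefl) into.
apply: nIf; suff : ideal_set Io (f - 0) by rewrite subr0.
by apply/quotient_projE; rewrite rmorph0 -grho rhof rmorph0.
Qed.

Lemma represents_Sp (B : lalgebra L) : affinoid v B ->
  represents v (Sp B) (idfun : {rmorphism B -> B}).
Proof.
move=> affB; split => // D f affD Lf _; by exists f.
Qed.

(** A morphism into [W] pulls the family with the single member [W] back to all of [Sp D], which is
    a finite refinement by itself. *)
Lemma strong_adm_subdomain (B : lalgebra L) (W : set (set B)) :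
  subdomain v W -> strong_adm v W.
Proof.
move=> sW; exists [set W]; split => [V ->//||D f affD Lf fW].
  by rewrite bigcup_set1.
exists [set Sp D]; split => // [V ->||V ->].
- by split => //; exists D, idfun; exact: represents_Sp.
- by rewrite bigcup_set1.
- exists (Sp_preimage f W); first by exists W.
  by move=> m' Sm'; split => //; exact: fW.
Qed.

End Injectivity.

(** * Elements with a pole at infinity *)

Lemma expV_mul (K : fieldType) (x : K) i n :
  x != 0 -> (i <= n)%N -> x^-1 ^+ i * x ^+ n = x ^+ (n - i).
Proof. by move=> x0 i_n; rewrite -{1}(subnKC i_n) exprD exprVn mulKf // expf_neq0. Qed.

Section Chevalley.
Variables (k : finFieldType) (K : fieldType) (c : {rmorphism k -> K}).
Variable beta : K.
Hypothesis beta_tr : forall p : {poly k}, p != 0 -> (map_poly c p).[beta] != 0.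

Let t := beta^-1.

Lemma tr_neq0 : beta != 0.
Proof. by have := beta_tr (negbT (polyX_eq0 _)); rewrite map_polyX hornerX. Qed.

(* [beta] outside [S] says that [1 / beta] is not a unit of [S]. *)
Definition avoiding (S : set K) : Prop :=
  [/\ forall a, S (c a), forall x y, S x -> S y -> S (x - y),
      forall x y, S x -> S y -> S (x * y), S t & ~ S beta].

Definition polyring (S : set K) (y : K) : set K :=
  [set z | exists p : {poly K}, (forall i, S p`_i) /\ z = p.[y]].

Definition kpolyring : set K := [set z | exists p : {poly k}, z = (map_poly c p).[t]].

(** A relation [beta = p(1 / beta)], multiplied by [beta ^+ n] with [n = size p], would make [beta]
    a root of a monic polynomial of degree [n + 1] over the constants. *)
Lemma kpolyring_avoiding : avoiding kpolyring.
Proof.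
split.
- by move=> a; exists a%:P; rewrite map_polyC hornerC.
- by move=> _ _ [p ->] [p' ->]; exists (p - p'); rewrite rmorphB hornerD hornerN.
- by move=> _ _ [p ->] [p' ->]; exists (p * p'); rewrite rmorphM hornerM.
- by exists 'X; rewrite map_polyX hornerX.
move=> [p betaE]; have b0 := tr_neq0.
pose n := size p.
pose P : {poly k} := 'X^(n.+1) - \sum_(i < n) p`_i *: 'X^(n - i).
have P0 : P != 0.
  have Pn : P`_n.+1 = 1.
    rewrite coefB coefXn eqxx coef_sum big1 ?subr0 // => i _.
    by rewrite coefZ coefXn gtn_eqF ?mulr0 // ltnS leq_subr.
  by apply/eqP => P0; have /eqP := Pn; rewrite P0 coef0 eq_sym oner_eq0.
have /negP[] := beta_tr P0.
rewrite /P rmorphB /= map_polyXn hornerD hornerN hornerXn rmorph_sum horner_sum.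
rewrite subr_eq0 {1}exprS {1}betaE horner_coef mulr_suml size_map_poly; apply/eqP.
apply: eq_bigr => i _; rewrite [in RHS]/= map_polyZ /= map_polyXn hornerZ hornerXn coef_map /= -mulrA; congr (_ * _).
by rewrite (expV_mul b0 (ltnW (ltn_ord i))).
Qed.

Lemma avoiding_chain (F : set (set K)) :
  F `<=` avoiding -> F !=set0 -> total_on F subset -> avoiding (\bigcup_(X in F) X).
Proof.
move=> FQ [S0 FS0] totF.
have H (op : K -> K -> K) : (forall S, F S -> forall x y, S x -> S y -> S (op x y)) ->
   forall x y, (\bigcup_(X in F) X) x -> (\bigcup_(X in F) X) y -> (\bigcup_(X in F) X) (op x y).
  move=> Hop x y [S FS Sx] [S' FS' Sy]; case: (totF _ _ FS FS') => SS'.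
    by exists S' => //; apply: Hop => //; exact: SS'.
  by exists S => //; apply: Hop => //; exact: SS'.
split.
- by move=> a; exists S0 => //; have [+ _ _ _ _] := FQ _ FS0; apply.
- by apply: (H (fun x y => x - y)) => S FS; have [_ + _ _ _] := FQ _ FS; apply.
- by apply: (H (fun x y => x * y)) => S FS; have [_ _ + _ _] := FQ _ FS; apply.
- by exists S0 => //; have [_ _ _ + _] := FQ _ FS0; apply.
- by move=> [S FS]; have [_ _ _ _ +] := FQ _ FS; apply.
Qed.

Section Maximal.
Variable S : set K.
Hypothesis avS : avoiding S.
Hypothesis maxS : forall S', S `<=` S' -> avoiding S' -> S' = S.

Let Sc a : S (c a). Proof. by case: avS. Qed.
Let SB x y : S x -> S y -> S (x - y). Proof. by case: avS => _ H _ _ _; exact: H. Qed.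
Let SM x y : S x -> S y -> S (x * y). Proof. by case: avS => _ _ H _ _; exact: H. Qed.
Let St : S t. Proof. by case: avS. Qed.
Let Sb : ~ S beta. Proof. by case: avS. Qed.
Let S0 : S 0. Proof. by rewrite -(rmorph0 c). Qed.
Let S1 : S 1. Proof. by rewrite -(rmorph1 c). Qed.
Let SD x y : S x -> S y -> S (x + y).
Proof. by move=> Sx Sy; rewrite -[y]opprK -[- y]add0r; apply: SB => //; exact: SB. Qed.
Let S_sum (I : Type) (s : seq I) (P : pred I) (F : I -> K) :
  (forall i, P i -> S (F i)) -> S (\sum_(i <- s | P i) F i).
Proof. by move=> SF; apply: (big_ind S) => // *; exact: SD. Qed.
Let SX x n : S x -> S (x ^+ n).
Proof. by move=> Sx; elim: n => [|n IH]; rewrite ?expr0 // exprS; exact: SM. Qed.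

(** [S[y]] is a ring strictly larger than [S] containing the constants and [t], so by maximality it
    fails to avoid [beta]. *)
Lemma maximal_adjoin y : ~ S y -> polyring S y beta.
Proof.
move=> nSy; apply: contrapT => nb; apply: nSy.
have SS : S `<=` polyring S y.
  move=> x Sx; exists x%:P; rewrite hornerC; split=> // i; rewrite coefC.
  by case: ifP.
rewrite -(maxS SS); first by exists 'X; rewrite hornerX; split=> // i; rewrite coefX; case: eqP.
split => //.
- by move=> a; exact/SS.
- move=> _ _ [p [Sp ->]] [p' [Sp' ->]]; exists (p - p'); rewrite hornerD hornerN; split=> // i.
  by rewrite coefB; exact: SB.
- move=> _ _ [p [Sp ->]] [p' [Sp' ->]]; exists (p * p'); rewrite hornerM; split=> // i.
  by rewrite coefM; apply: S_sum => j _; exact: SM.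
- exact/SS.
Qed.

(** Put [u = 1 - t s]. If [beta] is a polynomial in [1 / u], clearing denominators puts [beta u^n]
    in [S]; but [u^n = 1 - t w] with [w] in [S], so [beta u^n = beta - w] and [beta] would be in
    [S]. *)
Lemma maximal_unit s : S s -> S (1 - t * s)^-1.
Proof.
move=> Ss; apply: contrapT => /maximal_adjoin[p [Sp bE]]; apply: Sb.
set u := 1 - t * s in bE; have b0 := tr_neq0.
have u0 : u != 0.
  apply: contra_notN Sb; rewrite subr_eq0 => /eqP us.
  by have -> : beta = s by rewrite -[RHS](mulVKf b0) -/t -us mulr1.
have Su : S u by apply: SB => //; exact: SM.
have [w Sw uw] : exists2 w, S w & u ^+ size p = 1 - t * w.
  elim: (size p) => [|n [w Sw IH]]; first by exists 0; rewrite ?mulr0 ?subr0.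
  exists (w + s - t * (s * w)); last by rewrite exprS IH /u; ring.
  by apply: SB; [exact: SD|apply: SM => //; exact: SM].
have : S (beta * u ^+ size p).
  rewrite {1}bE horner_coef mulr_suml; apply: S_sum => i _; rewrite -mulrA.
  rewrite (expV_mul u0 (ltnW (ltn_ord i))); apply: SM; [exact: Sp|exact: SX].
have -> : beta * u ^+ size p = beta - w.
  by rewrite uw mulrBr mulr1 mulrA /t divff // mul1r.
by move=> Sbw; rewrite -[beta](subrK w); exact: SD.
Qed.

Definition span (n : nat) (y : K) : set K :=
  [set z | exists2 s : nat -> K, (forall i, S (s i)) & z = \sum_(i < n) s i * y ^+ i].

Lemma spanD n y z z' : span n y z -> span n y z' -> span n y (z + z').
Proof.
move=> [s Ss ->] [s' Ss' ->]; exists (fun i => s i + s' i) => [i|]; first exact: SD.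
by rewrite -big_split; apply: eq_bigr => i _; rewrite /= mulrDl.
Qed.

Lemma spanZ n y a z : S a -> span n y z -> span n y (a * z).
Proof.
move=> Sa [s Ss ->]; exists (fun i => a * s i) => [i|]; first exact: SM.
by rewrite mulr_sumr; apply: eq_bigr => i _; rewrite mulrA.
Qed.

Lemma spanX n y i : (i < n)%N -> span n y (y ^+ i).
Proof.
move=> ni; exists (fun j => if j == i then 1 else 0) => [j|]; first by case: ifP.
rewrite (bigD1 (Ordinal ni)) //= eqxx mul1r big1 ?addr0 // => j ji.
by rewrite (_ : (j : nat) == i = false) ?mul0r //; exact: negbTE ji.
Qed.

Lemma span0 n y : span n y 0.
Proof. by exists (fun=> 0) => //; rewrite big1 // => i _; rewrite mul0r. Qed.

(** The relation in [1 / x] gives [beta (1 - t s'_0)] as a combination of negative powers of [x]. As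
    [1 - t s'_0] is a unit and [t beta = 1], multiplying by [t] and by the top power of [x]
    expresses that power through lower ones, which shortens the relation in [x]. *)
Lemma maximal_descent n m x : x != 0 -> (m <= n)%N ->
  span n x beta -> span m x^-1 beta -> span n.-1 x beta.
Proof.
move=> x0 mn [s Ss bE] [s' Ss' bE']; have b0 := tr_neq0.
case: n mn bE => [|n] mn bE; first by move: b0; rewrite bE big_ord0 eqxx.
case: m mn bE' => [|m] mn bE'; first by move: b0; rewrite bE' big_ord0 eqxx.
rewrite ltnS in mn; rewrite /= {1}bE big_ord_recr /=; apply: spanD; first by exists s.
apply: spanZ => //.
pose u := 1 - t * s' 0%N.
have u0 : u != 0.
  apply: contra_notN Sb; rewrite subr_eq0 => /eqP us.
  by have -> : beta = s' 0%N by rewrite -[RHS](mulVKf b0) -/t -us mulr1.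
have bu : beta * u = \sum_(j < m) s' j.+1 * x ^- j.+1.
  rewrite /u mulrBr mulr1 mulrA /t divff // mul1r {1}bE' big_ord_recl /= expr0 mulr1.
  rewrite addrC addKr; apply: eq_bigr => j _; by rewrite exprVn.
have -> : x ^+ n = u^-1 * (t * ((beta * u) * x ^+ n)).
  rewrite mulrAC [t * _]mulrA [t * _]mulrA /t mulVf // mul1r mulrC -mulrA mulfV ?mulr1 //.
apply: spanZ; first exact: maximal_unit.
apply: spanZ => //; rewrite bu mulr_suml.
apply: (big_ind (span n x)); [exact: span0|exact: spanD|move=> j _].
rewrite -mulrA; apply: spanZ => //.
have jn : (j.+1 <= n)%N by apply: leq_trans mn; exact: ltn_ord.
rewrite -{2}(subnKC jn) exprD mulKf ?expf_neq0 //; apply: spanX.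
by rewrite ltn_subrL; case: (n) jn.
Qed.

(** If neither [x] nor [1 / x] is in [S], then [beta] is a polynomial in each; with both lengths
    minimal, the descent shortens the longer one. *)
Lemma maximal_place : is_place c S.
Proof.
split=> //; last by move=> ST; apply: Sb; rewrite ST.
move=> x; apply: contrapT => /not_orP[nx nx'].
have x0 : x != 0 by apply: contra_notN nx => /eqP ->.
have toN y : ~ S y -> exists n, `[< span n y beta >].
  move=> /maximal_adjoin[p [Sp ->]]; exists (size p); apply/asboolP.
  by exists (fun i => p`_i) => //; rewrite horner_coef.
case: (ex_minnP (toN _ nx)) => n /asboolP bn nmin.
case: (ex_minnP (toN _ nx')) => m /asboolP bm mmin.
have pos p y : span p y beta -> (0 < p)%N.
  case: p => // -[s _]; rewrite big_ord0 => /eqP; by rewrite (negbTE tr_neq0).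
have [mn|/ltnW nm] := leqP m n.
  have := nmin _ (introT (asboolP _) (maximal_descent x0 mn bn bm)).
  by rewrite leqNgt prednK ?leqnn // (pos _ _ bn).
have bn' : span n x^-1^-1 beta by rewrite invrK.
have := mmin _ (introT (asboolP _) (maximal_descent (invr_neq0 x0) nm bm bn')).
by rewrite leqNgt prednK ?leqnn // (pos _ _ bm).
Qed.

End Maximal.

Lemma place_avoiding : exists2 O : set K, is_place c O & ~ O beta.
Proof.
have [S [avS maxS]] := Zorn_chain kpolyring_avoiding avoiding_chain.
by exists S; [exact: maximal_place|case: avS].
Qed.

End Chevalley.

Lemma exists_pole (C : pointed_curve) (A : coordinate_ring C) :
  exists a : A, ~ @infty C (cemb A a).
Proof.
apply: contrapT => /forallNP/(_ _)/contrapT Ainf.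
have [Oc OB OM Oval Oproper] := inftyP C.
have [z nOz] : exists z, ~ @infty C z.
  by apply: contrapT => /forallNP nz; apply: Oproper; apply/seteqP; split => // z _; exact: contrapT.
(* The denominator [beta] of a function with a pole at infinity has [1 / beta] outside [infty], so
   it is not a constant; algebraic elements being constants, it is transcendental. *)
have [a [b [b0 zE]]] := creg_frac A z.
set beta := cemb A b in zE; have Ob : @infty C beta by exact: Ainf.
have beta0 : beta != 0 by rewrite -(rmorph0 (cemb A)); apply: contra_neq b0 => /cemb_inj.
have nObV : ~ @infty C beta^-1.
  by move=> ObV; apply: nOz; rewrite zE; apply: OM => //; exact: Ainf.
have tr p : p != 0 -> (map_poly (@Defs.cst C) p).[beta] != 0.
  move=> p0; apply: contra_notN nObV => /eqP /(proj2 (ffieldP C) _ _ p0)[c cE].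
  by rewrite -cE -fmorphV; exact: Oc.
have [S placeS nSb] := place_avoiding tr.
apply: (nSb); have : range (cemb A) beta by exists b.
(* [beta], lying in [A], is regular at all places but [infty], and at [infty] by assumption; no
   place is left for its pole. *)
rewrite cemb_range; apply => //; by move=> SO; move: Ob; rewrite -SO.
Qed.

(** * Twisted matrices and norms *)

Section Twist.
Variables (B : comPzRingType) (q : nat).
Hypothesis q_gt0 : (0 < q)%N.
Hypothesis powD : forall j (x y : B), (x + y) ^+ (q ^ j) = x ^+ (q ^ j) + y ^+ (q ^ j).

Definition twist m n j (M : 'M[B]_(m, n)) : 'M[B]_(m, n) := map_mx (fun x => x ^+ (q ^ j)) M.

Lemma frob_twist n j (z : 'cV[B]_n) : frob q j z = twist j z.
Proof. by []. Qed.

Lemma pow0 j : 0 ^+ (q ^ j) = 0 :> B.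
Proof. by rewrite expr0n expn_eq0 eqn0Ngt q_gt0. Qed.

Lemma pow_sum j (T : Type) (s : seq T) (F : T -> B) :
  (\sum_(t <- s) F t) ^+ (q ^ j) = \sum_(t <- s) F t ^+ (q ^ j).
Proof. by apply: (big_morph (fun x => x ^+ (q ^ j)) (powD j)); exact: pow0. Qed.

Lemma powB j (x y : B) : (x - y) ^+ (q ^ j) = x ^+ (q ^ j) - y ^+ (q ^ j).
Proof. by apply/eqP; rewrite -subr_eq opprK -powD subrK. Qed.

Lemma twistD m n j (M N : 'M[B]_(m, n)) : twist j (M + N) = twist j M + twist j N.
Proof. by apply/matrixP => i k; rewrite !mxE powD. Qed.

Lemma twist0m m n j : twist j (0 : 'M[B]_(m, n)) = 0.
Proof. by apply/matrixP => i k; rewrite !mxE pow0. Qed.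

Lemma twist_sum m n j (T : Type) (s : seq T) (F : T -> 'M[B]_(m, n)) :
  twist j (\sum_(t <- s) F t) = \sum_(t <- s) twist j (F t).
Proof. by apply: (big_morph (twist j) (twistD j)); exact: twist0m. Qed.

Lemma twistM m n p j (M : 'M[B]_(m, n)) (N : 'M[B]_(n, p)) :
  twist j (M *m N) = twist j M *m twist j N.
Proof.
apply/matrixP => i k; rewrite !mxE pow_sum; apply: eq_bigr => l _.
by rewrite !mxE exprMn.
Qed.

Lemma twist_twist m n j k (M : 'M[B]_(m, n)) : twist j (twist k M) = twist (j + k) M.
Proof. by apply/matrixP => i l; rewrite !mxE -exprM -expnD addnC. Qed.

Lemma twist0 m n (M : 'M[B]_(m, n)) : twist 0 M = M.
Proof. by apply/matrixP => i l; rewrite !mxE expn0 expr1. Qed.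

Lemma twist_scalar n j (c : B) : twist j (c%:M : 'M[B]_n) = (c ^+ (q ^ j))%:M.
Proof.
apply/matrixP => i k; rewrite !mxE; case: (i == k); rewrite ?mulr1n //.
by rewrite !mulr0n pow0.
Qed.

(** The coefficients of [G sigma^k] composed with the series [e], by the rule
    [sigma^k e_j = e_j^(k) sigma^k]; [twcomp] is the product of twisted series, its left factor cut
    off at [s]. *)
Definition twshift d k (G : 'M[B]_d) (e : nat -> 'M[B]_d) n : 'M[B]_d :=
  if (n < k)%N then 0 else G *m twist k (e (n - k)%N).

Definition twcomp d s (G e : nat -> 'M[B]_d) n : 'M[B]_d :=
  \sum_(k < s.+1) twshift k (G k) e n.

Definition twsum d (e : nat -> 'M[B]_d) N (z : 'cV[B]_d) := \sum_(j < N) e j *m frob q j z.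

Lemma twsum_shift d k (G : 'M[B]_d) e N z :
  twsum (twshift k G e) (k + N) z = G *m frob q k (twsum e N z).
Proof.
rewrite /twsum big_split_ord /= big1 ?add0r; last first.
  by move=> i _; rewrite /twshift ltn_ord mul0mx.
rewrite frob_twist twist_sum mulmx_sumr; apply: eq_bigr => j _.
rewrite /twshift ltnNge leq_addr /= addKn !frob_twist.
by rewrite twistM twist_twist mulmxA.
Qed.

Lemma twsum_compose d s (G e : nat -> 'M[B]_d) N z :
  twsum (twcomp s G e) N z = \sum_(k < s.+1) twsum (twshift k (G k) e) N z.
Proof. by rewrite exchange_big; apply: eq_bigr => j _; rewrite /twcomp mulmx_suml. Qed.

End Twist.

Section Norm.
Variables (R : realType) (L : fieldType) (v : L -> R) (B : lalgebra L) (nrm : B -> R).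
Hypothesis hv : absolute_value v.
Hypothesis hn : algebra_norm v nrm.

Lemma nrm0 : nrm 0 = 0.
Proof. exact/(nrm_eq0 hn). Qed.

Lemma nrmN x : nrm (- x) = nrm x.
Proof. by rewrite -mulN1r -(rmorph1 (lstr B)) -rmorphN (nrm_scale hn) (absN1 hv) mul1r. Qed.


Lemma nrm_addle c x y : nrm x <= c -> nrm y <= c -> nrm (x + y) <= c.
Proof. by move=> xc yc; rewrite (le_trans (nrm_add hn _ _)) // ge_max xc. Qed.

Lemma nrm_addlt c x y : nrm x < c -> nrm y < c -> nrm (x + y) < c.
Proof. by move=> xc yc; rewrite (le_lt_trans (nrm_add hn _ _)) // gt_max xc. Qed.

Lemma nrm_sum (T : Type) (s : seq T) (P : pred T) (F : T -> B) c :
  0 <= c -> (forall t, P t -> nrm (F t) <= c) -> nrm (\sum_(t <- s | P t) F t) <= c.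
Proof.
move=> c0 Fc; apply: (big_ind (fun x => nrm x <= c)) => //; first by rewrite nrm0.
exact: nrm_addle.
Qed.

Lemma nrmX x m : nrm (x ^+ m) <= nrm x ^+ m.
Proof.
elim: m => [|m IH]; first by rewrite !expr0 (nrm_one hn).
rewrite !exprS (le_trans (nrm_mul hn _ _)) // ler_pM // (nrm_ge0 hn) //.
Qed.

Lemma ncvg_nrmP u l : ncvg nrm u l <->
  forall e, 0 < e -> exists N : nat, forall m, (N <= m)%N -> nrm (u m - l) < e.
Proof. by apply: ncvgP; exact: (nrm_ge0 hn). Qed.

Lemma ncvg_uniq u l l' : ncvg nrm u l -> ncvg nrm u l' -> l = l'.
Proof.
move=> /ncvg_nrmP ul /ncvg_nrmP ul'; apply/eqP; rewrite -subr_eq0; apply/eqP/(nrm_eq0 hn)/eqP.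
rewrite eq_le (nrm_ge0 hn) andbT; apply/ler_addgt0Pl => e e0; rewrite addr0 ltW //.
have [N uN] := ul _ e0; have [N' uN'] := ul' _ e0.
rewrite -(subrK (u (N + N')%N) l) -addrA; apply: nrm_addlt.
  by rewrite -nrmN opprB uN // leq_addr.
by rewrite uN' // leq_addl.
Qed.

Lemma ncvg_ext u u' l : (forall m, u m = u' m) -> ncvg nrm u l -> ncvg nrm u' l.
Proof. by move=> /funext ->. Qed.

Lemma ncvgD u u' l l' : ncvg nrm u l -> ncvg nrm u' l' ->
  ncvg nrm (fun m => u m + u' m) (l + l').
Proof.
move=> /ncvg_nrmP ul /ncvg_nrmP ul'; apply/ncvg_nrmP => e e0.
have [N uN] := ul _ e0; have [N' uN'] := ul' _ e0.
exists (N + N')%N => m Nm; rewrite opprD addrACA; apply: nrm_addlt.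
  by apply: uN; apply: leq_trans Nm; rewrite leq_addr.
by apply: uN'; apply: leq_trans Nm; rewrite leq_addl.
Qed.

Lemma ncvg_cst l : ncvg nrm (fun=> l) l.
Proof. by apply/ncvg_nrmP => e e0; exists 0%N => m _; rewrite subrr nrm0. Qed.

Lemma ncvg_sum (T : Type) (s : seq T) (u : T -> nat -> B) (l : T -> B) :
  (forall t, ncvg nrm (u t) (l t)) ->
  ncvg nrm (fun m => \sum_(t <- s) u t m) (\sum_(t <- s) l t).
Proof.
move=> ul; elim: s => [|a s IH].
  by rewrite big_nil; apply: ncvg_ext (ncvg_cst 0) => m; rewrite big_nil.
rewrite big_cons; apply: ncvg_ext (ncvgD (ul a) IH) => m; by rewrite big_cons.
Qed.

Lemma ncvgMl c u l : ncvg nrm u l -> ncvg nrm (fun m => c * u m) (c * l).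
Proof.
move=> /ncvg_nrmP ul; apply/ncvg_nrmP => e e0.
have c1 : 0 < nrm c + 1 by rewrite ltr_wpDl // (nrm_ge0 hn).
have [N uN] := ul _ (divr_gt0 e0 c1); exists N => m /uN.
rewrite -mulrBr ltr_pdivlMr // => H; apply: le_lt_trans (nrm_mul hn _ _) _.
apply: le_lt_trans H; rewrite mulrC ler_wpM2l ?(nrm_ge0 hn) // lerDl //.
Qed.

Lemma ncvg_shift k u l : ncvg nrm (fun m => u (k + m)%N) l <-> ncvg nrm u l.
Proof.
split=> /ncvg_nrmP ul; apply/ncvg_nrmP => e /ul[N uN].
  exists (k + N)%N => m kNm; have km : (k <= m)%N by apply: leq_trans kNm; rewrite leq_addr.
  by rewrite -(subnKC km); apply: uN; rewrite leq_subRL.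
by exists N => m Nm; apply: uN; apply: leq_trans Nm _; rewrite leq_addl.
Qed.

(** By additivity the difference of the powers is the power of the difference, which is no larger
    than the difference once that is below 1. *)
Lemma ncvg_pow q k u l : (0 < q)%N ->
  (forall j (x y : B), (x + y) ^+ (q ^ j) = x ^+ (q ^ j) + y ^+ (q ^ j)) ->
  ncvg nrm u l -> ncvg nrm (fun m => u m ^+ (q ^ k)) (l ^+ (q ^ k)).
Proof.
move=> q0 powD /ncvg_nrmP ul; apply/ncvg_nrmP => e e0.
have e1 : 0 < Num.min e 1 by rewrite lt_min e0 ltr01.
have [N uN] := ul _ e1; exists N => m /uN; rewrite lt_min => /andP[ue u1].
rewrite -powB //; apply: le_lt_trans (nrmX _ _) _; apply: le_lt_trans ue.
rewrite -[leRHS]expr1; apply: ler_wiXn2l; rewrite ?(nrm_ge0 hn) ?ltW //.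
by rewrite expn_gt0 q0.
Qed.

Definition mxle m n (M : 'M[B]_(m, n)) (c : R) := forall i j, nrm (M i j) <= c.

Lemma mxle_mul m n p (M : 'M[B]_(m, n)) (N : 'M[B]_(n, p)) a b :
  0 <= a -> 0 <= b -> mxle M a -> mxle N b -> mxle (M *m N) (a * b).
Proof.
move=> a0 b0 Ma Nb i j; rewrite mxE; apply: nrm_sum => [|k _]; first exact: mulr_ge0.
by apply: le_trans (nrm_mul hn _ _) _; rewrite ler_pM // (nrm_ge0 hn).
Qed.

Lemma mxle_sum m n (T : Type) (s : seq T) (P : pred T) (F : T -> 'M[B]_(m, n)) c :
  0 <= c -> (forall t, P t -> mxle (F t) c) -> mxle (\sum_(t <- s | P t) F t) c.
Proof.
by move=> c0 Fc i j; rewrite summxE; apply: nrm_sum => // t Pt; exact: Fc.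
Qed.

Lemma mxle_twist q m n k (M : 'M[B]_(m, n)) c : mxle M c -> mxle (twist q k M) (c ^+ (q ^ k)).
Proof.
move=> Mc i j; rewrite mxE; apply: le_trans (nrmX _ _) _.
by apply: lerXn2r; rewrite ?nnegrE ?(nrm_ge0 hn) // (le_trans (nrm_ge0 hn _) (Mc i j)).
Qed.

Lemma mxle_exists m n (M : 'M[B]_(m, n)) : exists2 c, 1 <= c & mxle M c.
Proof.
exists (1 + \sum_i \sum_j nrm (M i j)).
  by rewrite lerDl sumr_ge0 // => i _; rewrite sumr_ge0 // => j _; exact: (nrm_ge0 hn).
move=> i j; rewrite ler_wpDl // (bigD1 i) //= (bigD1 j) //= -addrA lerDl.
rewrite addr_ge0 ?sumr_ge0 // => k _; rewrite ?(nrm_ge0 hn) // sumr_ge0 // => l _.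
exact: (nrm_ge0 hn).
Qed.

Lemma mxle_trans m n (M : 'M[B]_(m, n)) c c' : c <= c' -> mxle M c -> mxle M c'.
Proof. by move=> cc' Mc i j; apply: le_trans (Mc i j) cc'. Qed.

Lemma mxnrm_le d (M : 'M[B]_d) c : 0 <= c -> mxle M c -> mxnrm nrm M <= c.
Proof.
move=> c0 Mc; apply/bigmax_leP; split=> // i _.
by apply/bigmax_leP.
Qed.

End Norm.

(** * Exponential series *)

Section ExpSeries.
Variables (R : realType) (L : fieldType) (v : L -> R) (B : lalgebra L) (nrm : B -> R).
Hypothesis hv : absolute_value v.
Hypothesis hn : algebra_norm v nrm.
Variables (q d : nat).
Hypothesis q_gt1 : (1 < q)%N.
Hypothesis powD : forall j (x y : B), (x + y) ^+ (q ^ j) = x ^+ (q ^ j) + y ^+ (q ^ j).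
Variable theta : L.
Hypothesis theta_gt1 : 1 < v theta.

Let q_gt0 : (0 < q)%N := ltnW q_gt1.
Implicit Types (e h G : nat -> 'M[B]_d) (F : 'cV[B]_d -> 'cV[B]_d).

Definition twisted_poly s G (z : 'cV[B]_d) : 'cV[B]_d :=
  \sum_(k < s.+1) G k *m frob q k z.

(** The [k]-th summand truncated at [k + N] is exactly [G k sigma^k] applied to the truncation of
    [e] at [N], so each summand converges on its own after a shift by [k]. *)
Lemma is_sum_compose s G e F : is_sum nrm q e F ->
  is_sum nrm q (twcomp q s G e) (fun z => twisted_poly s G (F z)).
Proof.
move=> eF z i; rewrite /twisted_poly summxE.
apply: (ncvg_ext (u := fun N => \sum_(k < s.+1) twsum q (twshift q k (G k) e) N z i 0)).
  by move=> N; rewrite -summxE -twsum_compose.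
apply: (ncvg_sum hn) => k; apply/(ncvg_shift hn k).
apply: (ncvg_ext (u := fun N => \sum_l G k i l * (twsum q e N z l 0) ^+ (q ^ k))).
  move=> N; rewrite (twsum_shift q_gt0 powD) mxE; apply: eq_bigr => l _.
  by rewrite !mxE.
rewrite mxE; apply: (ncvg_sum hn) => l; apply: (ncvgMl hn); rewrite mxE.
apply: (ncvg_pow hn) => //; exact: eF.
Qed.

Lemma is_sum_mulr (M : 'M[B]_d) e F : is_sum nrm q e F ->
  is_sum nrm q (fun n => e n *m twist q n M) (fun z => F (M *m z)).
Proof.
move=> eF z i; apply: ncvg_ext (eF (M *m z) i) => N; congr (fun_of_matrix _ _ _).
apply: eq_bigr => j _; rewrite !frob_twist twistM // mulmxA //.
Qed.

Lemma is_sum_poly s G :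
  is_sum nrm q (fun n => if (n < s.+1)%N then G n else 0) (twisted_poly s G).
Proof.
move=> z i; apply/(ncvg_shift hn s.+1).
apply: ncvg_ext (ncvg_cst hn _) => N; congr (fun_of_matrix _ _ _).
rewrite /twisted_poly big_split_ord /= [X in _ = _ + X]big1 ?addr0.
  by apply: eq_bigr => k _; rewrite ltn_ord.
by move=> k _; rewrite ltnNge leq_addr mul0mx.
Qed.

Lemma theta_small (c e : R) : 0 < e -> exists m, (v theta)^-1 ^+ m * c < e.
Proof.
move=> e0; apply: exp_small => //; first by rewrite invr_ge0 abs_ge0.
by rewrite invf_lt1 // (lt_trans ltr01).
Qed.

(** Convergence at [c = 1] bounds the coefficients, since they are differences of consecutive
    partial sums; at small [c] the first nonzero term could then not be cancelled by the later
    ones. *)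
Lemma coef_zero (x : nat -> B) :
  (forall c : L, ncvg nrm (fun N => \sum_(n < N) x n * lstr B c ^+ (q ^ n)) 0) ->
  forall n, x n = 0.
Proof.
move=> xc; suff H n : (forall m, (m < n)%N -> x m = 0) -> x n = 0.
  by move=> n; elim/ltn_ind: n => n IH; exact: H.
move=> x0; apply/(nrm_eq0 hn)/eqP; rewrite eq_le (nrm_ge0 hn) andbT.
have [K K1 xK] : exists2 K, 1 <= K & forall m, nrm (x m) <= K.
  have /(ncvg_nrmP hn)/(_ 1 ltr01)[N xN] := xc 1.
  exists (1 + \sum_(i < N) nrm (x i)).
    by rewrite lerDl sumr_ge0 // => i _; exact: (nrm_ge0 hn).
  move=> m; have [Nm|mN] := leqP N m; last first.
    rewrite ler_wpDl // (bigD1 (Ordinal mN)) //= lerDl sumr_ge0 // => i _.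
    exact: (nrm_ge0 hn).
  apply: le_trans (_ : 1 <= _); last first.
    by rewrite lerDl sumr_ge0 // => i _; exact: (nrm_ge0 hn).
  have := xN _ (leqW Nm); have := xN _ Nm; rewrite !subr0 big_ord_recr /= rmorph1 expr1n mulr1.
  set A := \sum_(i < m) _ => A1 xA1.
  rewrite -[x m](addKr A); apply: (nrm_addle hn); last exact: ltW.
  by rewrite (nrmN hv hn) ltW.
(* Substituting [c = theta ^ - m] makes the term of index [n] dominate all later ones. *)
apply/ler_addgt0Pl => e e0; rewrite addr0.
have [m me] := theta_small K e0.
have vt0 : 0 < v theta by apply: lt_trans theta_gt1.
have th0 : theta != 0 by apply: contraTneq vt0 => ->; rewrite (abs0 hv) ltxx.
pose c := theta ^- m; have vc : v c = (v theta)^-1 ^+ m.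
  by rewrite /c -exprVn absX // absV.
have vc0 : 0 < v c by rewrite vc exprn_gt0 // invr_gt0.
have vc1 : v c <= 1.
  by rewrite vc exprn_ile1 // ?invr_ge0 ?(ltW vt0) // invf_le1 // ltW.
pose w := v c ^+ (q ^ n).
have w0 : 0 < w by rewrite exprn_gt0.
have nrm_term i : nrm (x i * lstr B c ^+ (q ^ i)) = v c ^+ (q ^ i) * nrm (x i).
  by rewrite -rmorphXn mulrC (nrm_scale hn) absX.
have dom : w * nrm (x n) <= w * e.
  apply/ler_addgt0Pl => d0 d00.
  have /(ncvg_nrmP hn)/(_ _ d00)[N xN] := xc c.
  have /xN : (N <= n.+1 + N)%N by rewrite leq_addl.
  rewrite subr0 big_split_ord /= big_ord_recr /= big1 ?add0r; last first.
    by move=> i _; rewrite x0 ?mul0r.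
  set A := \sum_(i < N) _ => xA.
  have Ae : nrm A <= w * e.
    apply: (nrm_sum hn) => [|i _]; first by rewrite mulr_ge0 // ltW.
    (* As [q ^ (n + i + 1) > q ^ n], at least one factor [v c] is left beside [w], and [v c * K < e]
       by the choice of [m]. *)
    rewrite nrm_term /w addSnnS expnD addnC.
    have -> : (q ^ n * q ^ i.+1 = q ^ n + (q ^ n * q ^ i.+1 - q ^ n))%N.
      by rewrite subnKC // leq_pmulr // expn_gt0 q_gt0.
    rewrite exprD -mulrA ler_wpM2l ?exprn_ge0 ?(ltW vc0) //.
    apply: le_trans (ltW me); rewrite -vc ler_pM ?exprn_ge0 ?(ltW vc0) ?(nrm_ge0 hn) //.
    rewrite -[leRHS]expr1; apply: ler_wiXn2l; rewrite ?(ltW vc0) //.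
    rewrite -{2}[(q ^ n)%N]muln1 -mulnBr muln_gt0 expn_gt0 q_gt0 subn_gt0 /=.
    by rewrite -{1}(expn0 q) ltn_exp2l.
  rewrite -nrm_term.
  have -> : x n * lstr B c ^+ (q ^ n) = (x n * lstr B c ^+ (q ^ n) + A) - A by rewrite addrK.
  apply: (nrm_addle hn); first by rewrite (le_trans (ltW xA)) // lerDl mulr_ge0 // ltW.
  by rewrite (nrmN hv hn) (le_trans Ae) // lerDr ltW.
by rewrite ler_pM2l in dom.
Qed.

(** Constant multiples of the [j]-th basis vector isolate the [j]-th columns, to which the scalar
    case applies entry by entry. *)
Lemma is_sum_coef e h F : is_sum nrm q e F -> is_sum nrm q h F -> forall n, e n = h n.
Proof.
move=> eF hF n; apply/matrixP => i j; apply/eqP; rewrite -subr_eq0; apply/eqP.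
apply: (coef_zero (x := fun n => e n i j - h n i j)) => c.
pose z : 'cV[B]_d := lstr B c *: delta_mx j 0.
have psumE g N : twsum q g N z i 0 = \sum_(n < N) g n i j * lstr B c ^+ (q ^ n).
  rewrite /twsum summxE; apply: eq_bigr => m _; rewrite mxE (bigD1 j) //= big1 ?addr0.
    by rewrite !mxE !eqxx mulr1.
  move=> l lj; rewrite !mxE (negbTE lj) /= mulr0 (pow0 _ q_gt0) mulr0 //.
have := ncvgD hn (eF z i) (ncvgMl hn (-1) (hF z i)).
rewrite mulN1r subrr; apply: ncvg_ext => N.
rewrite mulN1r -/(twsum q e N z) -/(twsum q h N z) !psumE -sumrN -big_split.
by apply: eq_bigr => m _; rewrite /= mulrBl.
Qed.

Lemma is_sum_uniq e F F' : is_sum nrm q e F -> is_sum nrm q e F' -> F =1 F'.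
Proof.
move=> eF eF' z; apply/matrixP => i j; rewrite (ord1 j).
exact: (ncvg_uniq hv hn (eF z i) (eF' z i)).
Qed.

Section Recursion.
Variables (s : nat) (G : nat -> 'M[B]_d).
Hypothesis G0 : G 0%N = (lstr B theta)%:M.

Definition rec_rhs e n := \sum_(k < s) twshift q k.+1 (G k.+1) e n.

Lemma twcomp_rec e n :
  twcomp q s G e n = lstr B theta *: e n + rec_rhs e n.
Proof.
by rewrite /twcomp big_ord_recl /= /twshift ltn0 subn0 twist0 G0 mul_scalar_mx.
Qed.

Definition gap n : L := theta ^+ (q ^ n) - theta.

(** For [n > 0] the power [theta ^+ (q ^ n)] strictly dominates [theta]. At [n = 0] the gap is 0,
    and this is why the recursion leaves [e_0] free. *)
Lemma abs_gap n : (0 < n)%N -> v (gap n)^-1 <= (v theta)^-1 ^+ (q ^ n) /\ gap n != 0.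
Proof.
move=> n0; have vt0 : 0 < v theta by apply: lt_trans theta_gt1.
have lt1 : v theta < v (theta ^+ (q ^ n)).
  rewrite absX // -[ltLHS]expr1 ltr_eXn2l //.
  by rewrite -{1}(expn0 q) ltn_exp2l.
have le1 : v (theta ^+ (q ^ n)) <= v (gap n).
  rewrite leNgt; apply/negP => lt2.
  have : v (theta ^+ (q ^ n)) < v (theta ^+ (q ^ n)); last by rewrite ltxx.
  rewrite -{1}(subrK theta (theta ^+ (q ^ n))).
  by rewrite (le_lt_trans (abs_add hv _ _)) // gt_max lt2.
have vg0 : 0 < v (gap n) by apply: lt_le_trans le1; apply: lt_trans lt1.
split; last by apply: contraTneq vg0 => ->; rewrite (abs0 hv) ltxx.
rewrite absV // exprVn -absX // lef_pV2 // posrE; exact: lt_trans lt1.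
Qed.

Lemma rec_of_functional e F : is_sum nrm q e F ->
  (forall z, F (lstr B theta *: z) = twisted_poly s G (F z)) ->
  forall n, lstr B (gap n) *: e n = rec_rhs e n.
Proof.
move=> eF Ftheta n.
have H1 := is_sum_compose s G eF.
have := is_sum_mulr ((lstr B theta)%:M) eF.
have -> : (fun z => F ((lstr B theta)%:M *m z)) = (fun z => twisted_poly s G (F z)).
  by apply/funext => z; rewrite mul_scalar_mx.
move=> H2; have := is_sum_coef H2 H1 n.
rewrite twcomp_rec twist_scalar // mul_mx_scalar => H.
by rewrite /gap rmorphB rmorphXn scalerBl; apply/eqP; rewrite subr_eq addrC; apply/eqP.
Qed.

Lemma rec_rhs_ext e h n : (0 < n)%N -> (forall m, (m < n)%N -> e m = h m) ->
  rec_rhs e n = rec_rhs h n.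
Proof.
move=> n0 eh; apply: eq_bigr => k _; rewrite /twshift; case: ltnP => // kn.
by rewrite eh // subnS prednK ?leq_subr // subn_gt0.
Qed.

Lemma lstr_gapK n (M : 'M[B]_d) : (0 < n)%N -> lstr B (gap n)^-1 *: (lstr B (gap n) *: M) = M.
Proof.
by move=> /abs_gap[_ g0]; rewrite scalerA -rmorphM mulVf // rmorph1 scale1r.
Qed.

Lemma rec_unique e h : e 0%N = h 0%N ->
  (forall n, lstr B (gap n) *: e n = rec_rhs e n) ->
  (forall n, lstr B (gap n) *: h n = rec_rhs h n) -> forall n, e n = h n.
Proof.
move=> eh0 eR hR; elim/ltn_ind => -[//|n] IH.
rewrite -[LHS](lstr_gapK _ (ltn0Sn n)) eR (rec_rhs_ext (h := h)) // -hR lstr_gapK //.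
Qed.

(** Course-of-values recursion: the function at stage [n] holds all coefficients up to index [n],
    and its values at larger indices are junk. *)
Fixpoint exp_approx n : nat -> 'M[B]_d :=
  if n is n'.+1 then
    fun m => if (m <= n')%N then exp_approx n' m
             else lstr B (gap n)^-1 *: rec_rhs (exp_approx n') n
  else fun=> 1%:M.

Definition exp_coef n := exp_approx n n.

Lemma exp_approxE n m : (m <= n)%N -> exp_approx n m = exp_coef m.
Proof.
elim: n => [|n IH]; first by rewrite leqn0 => /eqP ->.
rewrite leq_eqVlt => /orP[/eqP ->//|mn]; rewrite ltnS in mn.
by rewrite /= mn IH.
Qed.

Lemma exp_coef_rec n : (0 < n)%N ->
  exp_coef n = lstr B (gap n)^-1 *: rec_rhs exp_coef n.
Proof.
case: n => // n _; rewrite {1}/exp_coef /= ltnn; congr (_ *: _).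
by apply: rec_rhs_ext => // m mn; apply: exp_approxE.
Qed.

Lemma exp_coef_functional n : lstr B (gap n) *: exp_coef n = rec_rhs exp_coef n.
Proof.
case: n => [|n].
  rewrite /gap expn0 expr1 subrr rmorph0 scale0r /rec_rhs big1 // => k _.
by rewrite {1}exp_coef_rec // scalerA -rmorphM mulfV ?rmorph1 ?scale1r //; have [] := @abs_gap n.+1.
Qed.

Lemma exp_coef_bound : exists K lam, [/\ 0 < K, 0 < lam, lam < 1 &
  forall n, mxle nrm (exp_coef n) ((K * lam ^+ n) ^+ (q ^ n))].
Proof.
pose t := v theta; have t0 : 0 < t by apply: lt_trans theta_gt1.
have [lam [lam0 lam1 lamt]] : exists lam, [/\ 0 < lam, lam < 1 & 1 < t * lam ^+ s].
  (* With this [a], Bernoulli's inequality gives [(1 - a)^s >= 1 - s a > 1 / t], so [lam = 1 - a] is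
     as required. *)
  pose a := (1 - t^-1) / (2 * s.+1%:R).
  have tV : t^-1 < 1 by rewrite invf_lt1 ?theta_gt1.
  have tV0 : 0 < t^-1 by rewrite invr_gt0 t0.
  have s2 : 0 < 2 * s.+1%:R :> R by rewrite mulr_gt0 // ltr0n.
  have a0 : 0 < a by rewrite divr_gt0 // subr_gt0.
  have as2 : a * (2 * s.+1%:R) = 1 - t^-1 by rewrite /a divfK // gt_eqF.
  have s1 : 1 <= s.+1%:R :> R by rewrite ler1n.
  have a1 : a < 1 by nra.
  exists (1 - a); split; [lra|lra|].
  have bern m : 1 - m%:R * a <= (1 - a) ^+ m.
    elim: m => [|m IH]; first by rewrite mul0r subr0 expr0.
    rewrite exprS -natr1; have m0 : 0 <= m%:R :> R by [].
    have : (1 - a) * (1 - m%:R * a) <= (1 - a) * (1 - a) ^+ m by rewrite ler_wpM2l // subr_ge0 ltW.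
    by apply: le_trans; nra.
  have := bern s; rewrite -natr1 in as2 => bs.
  have s0 : 0 <= s%:R :> R by [].
  have lb : t^-1 < (1 - a) ^+ s by apply: lt_le_trans bs; nra.
  by rewrite -ltr_pdivrMl // mulr1.
pose mu := t * lam ^+ s; have mu0 : 0 < mu by apply: lt_trans lamt.
have /choice[cG cGP] : forall k, exists c, 1 <= c /\ mxle nrm (G k) c.
  by move=> k; have [c c1 Gc] := mxle_exists hn (G k); exists c.
pose C := 1 + \sum_(k < s.+1) cG k.
have cG0 k : 0 <= cG k by apply: le_trans ler01 _; have [] := cGP k.
have C1 : 1 <= C by rewrite lerDl sumr_ge0.
have C0 : 0 <= C by exact: le_trans C1.
have GC k : (k < s.+1)%N -> mxle nrm (G k) C.
  move=> ks; have [_] := cGP k; apply: mxle_trans.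
  by rewrite /C ler_wpDl // (bigD1 (Ordinal ks)) //= lerDl sumr_ge0.
(* For [n > J] the constant [C] is absorbed by [mu ^+ (q ^ n)], because [q ^ n > n]. *)
have [J JC] : exists J, mu^-1 ^+ J * C < 1.
  by apply: exp_small => //; [rewrite invr_ge0 ltW|rewrite invf_lt1].
have {}JC : C < mu ^+ J by rewrite exprVn mulrC ltr_pdivrMr ?exprn_gt0 // mul1r in JC.
have /choice[ce ceP] : forall n, exists c, 1 <= c /\ mxle nrm (exp_coef n) c.
  by move=> k; have [c c1 Gc] := mxle_exists hn (exp_coef k); exists c.
have ce0 k : 0 <= ce k by apply: le_trans ler01 _; have [] := ceP k.
(* For [n <= J] this makes [K lam^n >= ce n >= 1], and raising to the power [q ^ n] only enlarges
   it; so the initial coefficients obey the bound. *)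
pose K := (lam ^- J) * (1 + \sum_(n < J.+1) ce n).
have sum0 : 0 < 1 + \sum_(n < J.+1) ce n by rewrite ltr_pwDl // sumr_ge0.
have K0 : 0 < K by rewrite mulr_gt0 // invr_gt0 exprn_gt0.
exists K, lam; split => //.
elim/ltn_ind => n IH.
have [nJ|Jn] := leqP n J.
  have [c1 ec] := ceP n; apply: mxle_trans ec.
  have cK : ce n <= K * lam ^+ n.
    rewrite /K mulrAC -[leLHS]mul1r ler_pM //.
      rewrite mulrC ler_pdivlMr ?exprn_gt0 // mul1r.
      by apply: ler_wiXn2l; rewrite ?(ltW lam0) ?(ltW lam1).
    have nJ' : (n < J.+1)%N by [].
    by rewrite ler_wpDl // (bigD1 (Ordinal nJ')) //= lerDl sumr_ge0.
  apply: (le_trans cK); rewrite -{1}[K * _]expr1; apply: ler_weXn2l.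
    exact: le_trans c1 cK.
  by rewrite expn_gt0 q_gt0.
have n0 : (0 < n)%N by apply: leq_ltn_trans Jn.
pose Y := K * lam ^+ n; have Y0 : 0 < Y by rewrite mulr_gt0 // exprn_gt0.
have ls0 : 0 < lam ^- s by rewrite invr_gt0 exprn_gt0.
have rhs_le : mxle nrm (rec_rhs exp_coef n) (C * (Y * lam ^- s) ^+ (q ^ n)).
  have X0 : 0 <= C * (Y * lam ^- s) ^+ (q ^ n).
    by rewrite mulr_ge0 // exprn_ge0 // mulr_ge0 // ltW.
  apply: (mxle_sum hn) => // k _; rewrite /twshift; case: ltnP => kn.
    by move=> i j; rewrite mxE (nrm0 hn).
  have lt_nk : (n - k.+1 < n)%N by rewrite ltn_subrL.
  have Z0 : 0 <= K * lam ^+ (n - k.+1) by rewrite mulr_ge0 ?exprn_ge0 // ltW.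
  have := mxle_twist hn q k.+1 (IH _ lt_nk).
  rewrite -exprM -expnD subnK // => tw.
  have := mxle_mul hn C0 (exprn_ge0 _ Z0) (GC k.+1 _) tw; rewrite ltnS ltn_ord => /(_ isT).
  apply: mxle_trans; rewrite ler_wpM2l //.
  have XY : K * lam ^+ (n - k.+1) <= Y * lam ^- s.
    rewrite /Y -mulrA ler_pM2l // ler_pdivlMr ?exprn_gt0 // -exprD.
    apply: ler_wiXn2l; rewrite ?(ltW lam0) ?(ltW lam1) //.
    by rewrite -{1}(subnK kn) leq_add2l ltn_ord.
  by apply: lerXn2r => //; rewrite nnegrE // (le_trans Z0).
rewrite exp_coef_rec // => i j; rewrite mxE (nrm_scale hn).
have [gap_le _] := abs_gap n0.
apply: le_trans (_ : t^-1 ^+ (q ^ n) * (C * (Y * lam ^- s) ^+ (q ^ n)) <= _).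
  by apply: ler_pM; [exact: (abs_ge0 hv)|exact: (nrm_ge0 hn)|exact: gap_le|exact: rhs_le].
have -> : t^-1 ^+ (q ^ n) * (C * (Y * lam ^- s) ^+ (q ^ n)) = (C * mu^-1 ^+ (q ^ n)) * Y ^+ (q ^ n).
  rewrite mulrCA -exprMn -mulrA -exprMn; congr (_ * _ ^+ _).
  by rewrite /mu invfM; ring.
rewrite -[leRHS]mul1r ler_pM2r ?exprn_gt0 // exprVn ler_pdivrMr ?exprn_gt0 // mul1r.
apply: le_trans (ltW JC) _; apply: ler_weXn2l; first exact: ltW.
by apply: leq_trans (ltnW Jn) _; apply: ltnW; exact: ltn_expl.
Qed.

End Recursion.
End ExpSeries.

(** * Convergence, existence and uniqueness of the exponential *)

Section ExpExists.
Variables (R : realType) (L : fieldType) (v : L -> R) (B : lalgebra L) (nrm : B -> R).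
Hypothesis hv : absolute_value v.
Hypothesis hn : algebra_norm v nrm.
Variables (q d : nat).
Hypothesis q_gt1 : (1 < q)%N.
Hypothesis powD : forall j (x y : B), (x + y) ^+ (q ^ j) = x ^+ (q ^ j) + y ^+ (q ^ j).

Let q_gt0 : (0 < q)%N := ltnW q_gt1.

Section Bounded.
Variables (e : nat -> 'M[B]_d) (K lam : R).
Hypothesis K_gt0 : 0 < K.
Hypothesis lam_gt0 : 0 < lam.
Hypothesis lam_lt1 : lam < 1.
Hypothesis e_le : forall n, mxle nrm (e n) ((K * lam ^+ n) ^+ (q ^ n)).

(** The bound gives [q^-j log |e_j| <= log (K lam^j)], which tends to minus infinity; a coefficient
    of norm 0 has logarithm [-oo] outright. *)
Lemma entire_of_bound : entire nrm q e.
Proof.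
apply/cvgeNyPle => M; have [N HN] := exp_small K (ltW lam_gt0) lam_lt1 (expR_gt0 M).
exists N => // j /= Nj.
have KM : K * lam ^+ j <= expR M.
  apply: le_trans (ltW HN); rewrite mulrC ler_wpM2r ?(ltW K_gt0) //.
  by apply: ler_wiXn2l; rewrite ?(ltW lam_gt0) ?(ltW lam_lt1).
have K0 : 0 <= K * lam ^+ j by rewrite mulr_ge0 ?exprn_ge0 // ltW.
have eM : mxnrm nrm (e j) <= expR M ^+ (q ^ j).
  apply: le_trans (_ : (K * lam ^+ j) ^+ (q ^ j) <= _).
    by apply: mxnrm_le; [exact: exprn_ge0|exact: e_le].
  by apply: lerXn2r => //; rewrite nnegrE // expR_ge0.
have qj : 0 < q%:R ^- j :> R by rewrite invr_gt0 exprn_gt0 // ltr0n.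
have [x0|x0] := leP (mxnrm nrm (e j)) 0.
  by rewrite gt0_muleNy ?lte_fin // leNye.
rewrite -EFinM lee_fin mulrC ler_pdivrMr ?exprn_gt0 ?ltr0n //.
have := eM; rewrite -ler_ln ?posrE ?exprn_gt0 ?expR_gt0 // lnXn ?expR_gt0 // expRK.
by rewrite -[X in _ <= X -> _]mulr_natr natrX.
Qed.

(** If the entries of [z] are bounded by [c], the [n]-th term is at most [(K lam^n c)^(q^n)], and
    the base is below 1/2 from some [J] on. *)
Lemma is_sum_of_bound : exists F, is_sum nrm q e F.
Proof.
suff H : forall zi : 'cV[B]_d * 'I_d, exists l, ncvg nrm (fun N => twsum q e N zi.1 zi.2 0) l.
  have [l lP] := choice H; exists (fun z => \col_i l (z, i)) => z i.
  by rewrite mxE; exact: (lP (z, i)).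
move=> [z i] /=; have [c c1 zc] := mxle_exists hn z.
have c0 : 0 < c by exact: lt_le_trans c1.
have half : 0 < 2^-1 :> R by rewrite invr_gt0.
have half1 : 2^-1 < 1 :> R by rewrite invf_lt1 // ltr1n.
have [J HJ] := exp_small (K * c) (ltW lam_gt0) lam_lt1 half.
have term_le m : nrm ((e (J + m)%N *m frob q (J + m) z) i 0) <= 2^-1 ^+ m.
  set n := (J + m)%N.
  have b0 : 0 <= (K * lam ^+ n) ^+ (q ^ n) by rewrite exprn_ge0 // mulr_ge0 ?exprn_ge0 // ltW.
  have cn0 : 0 <= c ^+ (q ^ n) by rewrite exprn_ge0 // ltW.
  apply: le_trans (mxle_mul hn b0 cn0 (e_le n) (mxle_twist hn q n zc) i 0) _.
  rewrite -exprMn; apply: le_trans (_ : 2^-1 ^+ (q ^ n) <= _).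
    apply: lerXn2r; rewrite ?nnegrE ?(ltW half) //.
      by rewrite !mulr_ge0 ?exprn_ge0 // ltW.
    apply: le_trans (ltW HJ); rewrite mulrAC mulrC ler_pM2r ?mulr_gt0 //.
    by apply: ler_wiXn2l; rewrite ?(ltW lam_gt0) ?(ltW lam_lt1) // leq_addr.
  apply: ler_wiXn2l; rewrite ?(ltW half) ?(ltW half1) //.
  apply: leq_trans (ltnW (ltn_expl n q_gt1)); exact: leq_addl.
have [||||l lP] := @ultra_limit _ _ nrm (nrm0 hn) (nrmN hv hn) (nrm_add hn)
    (nrm_complete hn) (fun m => twsum q e (J + m) z i 0) (fun m => 2^-1 ^+ m).
- exact: (nrm_ge0 hn).
- by move=> m m' mm'; apply: ler_wiXn2l; rewrite ?(ltW half) ?(ltW half1).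
- move=> e0 /(exp_small 1 (ltW half) half1)[m]; rewrite mulr1 => H; by exists m.
- move=> m; rewrite addnS /twsum big_ord_recr /= mxE [X in nrm X]addrC addKr.
  exact: term_le.
exists l; apply/(ncvg_shift hn J)/(ncvg_nrmP hn) => e0 e00.
have [N] := exp_small 1 (ltW half) half1 e00; rewrite mulr1 => HN.
exists N => m Nm; rewrite -(nrmN hv hn) opprB; apply: le_lt_trans (lP m) _.
by apply: le_lt_trans HN; apply: ler_wiXn2l; rewrite ?(ltW half) ?(ltW half1).
Qed.

End Bounded.

(* [exp] solves the functional equation of the single index [a0]; then
   [exp o G b] and [Phi_b o exp] solve it as well and have the same constant
   coefficient, hence coincide. *)
Lemma exp_exists_unique (T : Type) (s : T -> nat) (G : T -> nat -> 'M[B]_d) (a0 : T)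
    (theta : L) :
  1 < v theta -> G a0 0%N = (lstr B theta)%:M ->
  (forall b z, twisted_poly q (s a0) (G a0) (twisted_poly q (s b) (G b) z) =
               twisted_poly q (s b) (G b) (twisted_poly q (s a0) (G a0) z)) ->
  exists! e : nat -> 'M[B]_d,
    [/\ e 0%N = 1%:M, entire nrm q e &
        exists F : 'cV[B]_d -> 'cV[B]_d, is_sum nrm q e F /\
          forall a z, F (G a 0%N *m z) = twisted_poly q (s a) (G a) (F z)].
Proof.
move=> th1 Ga0 comm.
pose e := exp_coef q theta (s a0) (G a0).
have [K [lam [K0 lam0 lam1 e_le]]] := exp_coef_bound hv hn q_gt1 th1 (s a0) (G a0).
have [F eF] := is_sum_of_bound K0 lam0 lam1 e_le.
have e0 : e 0%N = 1%:M by [].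
have eR := exp_coef_functional hv q_gt1 th1 (s a0) (G a0).
have Fa0 z : F (lstr B theta *: z) = twisted_poly q (s a0) (G a0) (F z).
  rewrite -mul_scalar_mx.
  have H1 := is_sum_compose hn q_gt1 powD (s a0) (G a0) eF.
  have H2 := is_sum_mulr q_gt1 powD ((lstr B theta)%:M) eF.
  suff E : (fun n => e n *m twist q n (lstr B theta)%:M) = twcomp q (s a0) (G a0) e.
    by rewrite E in H2; exact: (is_sum_uniq hv hn H2 H1 z).
  apply/funext => n; rewrite (@twcomp_rec _ _ _ _ _ _ _ Ga0) -eR twist_scalar // mul_mx_scalar.
  by rewrite -scalerDl -rmorphD /gap addrC subrK rmorphXn.
exists e; split.
  split => //; first exact: entire_of_bound e_le.
  exists F; split=> // b z.
  have H1 := is_sum_mulr q_gt1 powD (G b 0%N) eF.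
  have H2 := is_sum_compose hn q_gt1 powD (s b) (G b) eF.
  pose h n := e n *m twist q n (G b 0%N).
  suff E : h = twcomp q (s b) (G b) e.
    by rewrite -/h E in H1; exact: (is_sum_uniq hv hn H1 H2 z).
  apply/funext; apply: (rec_unique hv q_gt1 th1 (s := s a0) (G := G a0)).
  - rewrite /h e0 mul1mx twist0 /twcomp big_ord_recl /= big1 ?addr0.
      by rewrite /twshift /= subn0 twist0 e0 mulmx1.
    by move=> k _; rewrite /twshift ltn0Sn.
  - apply: (rec_of_functional hv hn q_gt1 powD th1 Ga0 H1) => {}z.
    by rewrite -Fa0 -scalemxAr.
  - apply: (rec_of_functional hv hn q_gt1 powD th1 Ga0 H2) => {}z.
    by rewrite Fa0 comm.
move=> e' [e'0 _ [F' [e'F' F'G]]]; apply/funext => n.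
apply: (rec_unique hv q_gt1 th1 (etrans e0 (esym e'0)) eR).
apply: (rec_of_functional hv hn q_gt1 powD th1 Ga0 e'F') => z.
by rewrite -F'G Ga0 mul_scalar_mx.
Qed.

End ExpExists.

(** * Coefficients of twisted polynomials *)

Section PolyCoef.
Variables (R : realType) (L : fieldType) (v : L -> R) (B : lalgebra L).
Hypothesis hv : absolute_value v.
Variables (q d : nat).
Hypothesis q_gt1 : (1 < q)%N.
Variable theta : L.
Hypothesis theta_gt1 : 1 < v theta.

Let q_gt0 : (0 < q)%N := ltnW q_gt1.

Lemma theta_pow_inj i j : theta ^+ (q ^ i) = theta ^+ (q ^ j) -> i = j.
Proof.
wlog ij : i j / (i <= j)%N.
  by move=> H e; case: (leqP i j) => [|/ltnW] ij; [exact: H|apply/esym/H].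
move=> /(congr1 v); rewrite !absX // => e; apply/eqP; rewrite eqn_leq ij /=.
rewrite leqNgt; apply/negP => ji.
have : v theta ^+ (q ^ i) < v theta ^+ (q ^ j) by rewrite ltr_eXn2l // ltn_exp2l.
by rewrite e ltxx.
Qed.

(** Artin's argument for the independence of characters: the relation at [theta * c] minus
    [theta ^+ (q ^ M)] times the relation at [c], with [M] the top index, loses its top term and
    multiplies [x k] by a nonzero constant. It is algebraic, and so applies to sections over opens
    on which no norm is given. *)
Lemma poly_coef_zero M (x : nat -> B) :
  (forall c : L, \sum_(k < M) x k * lstr B c ^+ (q ^ k) = 0) ->
  forall k, (k < M)%N -> x k = 0.
Proof.
elim: M x => // M IH x xc.
have xM k : (k < M)%N -> x k = 0.
  move=> kM; pose g := theta ^+ (q ^ k) - theta ^+ (q ^ M).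
  have g0 : g != 0.
    by rewrite subr_eq0; apply: contraTneq kM => /theta_pow_inj ->; rewrite ltnn.
  pose y j := x j * lstr B (theta ^+ (q ^ j) - theta ^+ (q ^ M)).
  have y0 : y k = 0.
    apply: IH kM => c.
    have := xc (theta * c); have := xc c; rewrite !big_ord_recr /= => e1 e2.
    have : (\sum_(i < M) x i * lstr B (theta * c) ^+ (q ^ i) + x M * lstr B (theta * c) ^+ (q ^ M))
      - lstr B theta ^+ (q ^ M) * (\sum_(i < M) x i * lstr B c ^+ (q ^ i) + x M * lstr B c ^+ (q ^ M)) = 0.
      by rewrite e1 e2 mulr0 subr0.
    move=> e; rewrite -[RHS]e mulrDr opprD addrACA mulr_sumr -sumrN -big_split /=.
    rewrite [X in _ = _ + X](_ : _ = 0) ?addr0; last by rewrite rmorphM exprMn; ring.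
    apply: eq_bigr => i _; rewrite /y rmorphB !rmorphXn rmorphM exprMn; ring.
  rewrite -[x k]mulr1 -(rmorph1 (lstr B)) -(mulfV g0) rmorphM mulrA.
  by rewrite (_ : x k * lstr B g = 0) ?mul0r.
move=> k; rewrite ltnS leq_eqVlt => /orP[/eqP ->|]; last exact: xM.
have := xc 1; rewrite big_ord_recr /= big1 ?add0r; last by move=> i _; rewrite xM ?mul0r.
by rewrite rmorph1 expr1n mulr1.
Qed.

Lemma twisted_poly_pad s M (G : nat -> 'M[B]_d) z : (s <= M)%N ->
  (forall k, (s < k)%N -> G k = 0) -> twisted_poly q s G z = twisted_poly q M G z.
Proof.
move=> sM G0; rewrite /twisted_poly -(subnKC sM) -addSn big_split_ord /=.
rewrite [X in _ = _ + X]big1 ?addr0 // => i _; rewrite G0 ?mul0mx //.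
by rewrite addSn ltnS leq_addr.
Qed.

Lemma twisted_poly_coef s s' (G G' : nat -> 'M[B]_d) :
  (forall k, (s < k)%N -> G k = 0) -> (forall k, (s' < k)%N -> G' k = 0) ->
  (forall z, twisted_poly q s G z = twisted_poly q s' G' z) -> forall k, G k = G' k.
Proof.
move=> G0 G'0 GG' k; pose M := maxn (maxn s s') k.
apply/matrixP => i j; apply/eqP; rewrite -subr_eq0; apply/eqP.
have kM : (k < M.+1)%N by rewrite ltnS leq_maxr.
apply: (poly_coef_zero (x := fun k => G k i j - G' k i j) _ kM) => c.
pose z : 'cV[B]_d := lstr B c *: delta_mx j 0.
have polyE (H : nat -> 'M[B]_d) : twisted_poly q M H z i 0 = \sum_(k < M.+1) H k i j * lstr B c ^+ (q ^ k).
  rewrite /twisted_poly summxE; apply: eq_bigr => m _; rewrite mxE (bigD1 j) //= big1 ?addr0.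
    by rewrite !mxE !eqxx mulr1.
  by move=> l lj; rewrite !mxE (negbTE lj) /= mulr0 (pow0 _ q_gt0) mulr0.
transitivity (twisted_poly q M G z i 0 - twisted_poly q M G' z i 0).
  by rewrite !polyE -sumrB; apply: eq_bigr => m _; rewrite mulrBl.
rewrite -(@twisted_poly_pad s) // ?leq_max ?leqnn // -(@twisted_poly_pad s' M G') // ?leq_max ?leqnn ?orbT //.
by rewrite GG' subrr.
Qed.

End PolyCoef.

(** * Frames, their restriction and change *)

Section Frames.
Variables (R : realType) (L : fieldType) (v : L -> R) (X : rigid_space v) (E : osheaf X).
Variable d : nat.

Lemma mresD (U V : opens X) (h : subo V U) (s t : msec E U) :
  mres h (s + t) = mres h s + mres h t.
Proof. by rewrite -[s in LHS]scale1r mres_lin rmorph1 scale1r. Qed.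

Lemma mres0 (U V : opens X) (h : subo V U) : mres h (0 : msec E U) = 0.
Proof. by apply: (addrI (mres h (0 : msec E U))); rewrite -mresD !addr0. Qed.

Lemma mresZ (U V : opens X) (h : subo V U) c (s : msec E U) :
  mres h (c *: s) = res h c *: mres h s.
Proof. by rewrite -[c *: s]addr0 mres_lin mres0 addr0. Qed.

Lemma mres_sum (U V : opens X) (h : subo V U) (T : Type) (r : seq T) (F : T -> msec E U) :
  mres h (\sum_(t <- r) F t) = \sum_(t <- r) mres h (F t).
Proof. by apply: (big_morph (mres h) (mresD h)); exact: mres0. Qed.

Lemma mres_lincomb (U V V' : opens X) (h : subo V U) (h' : subo V' V) (h'' : subo V' U)
    (b : 'I_d -> msec E U) (z : 'cV[sec V]_d) :
  mres h' (lincomb h b z) = lincomb h'' b (map_mx (res h') z).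
Proof.
rewrite /lincomb mres_sum; apply: eq_bigr => i _; rewrite mresZ mxE.
by rewrite (mres_comp h h' h'').
Qed.


Lemma frame_inj (U V : opens X) (h : subo V U) (b : 'I_d -> msec E U) (z z' : 'cV[sec V]_d) :
  frame b -> lincomb h b z = lincomb h b z' -> z = z'.
Proof. by move=> fb e; have [y [_ yu]] := fb V h (lincomb h b z); rewrite -(yu z) // -(yu z'). Qed.

(** The matrix [P] is found once over [V], from the coordinates of the [b i] in the frame [c]; its
    restrictions serve on all smaller opens. *)
Lemma frame_change (U W V : opens X) (hU : subo V U) (hW : subo V W)
    (b : 'I_d -> msec E U) (c : 'I_d -> msec E W) : frame c ->
  exists P : 'M[sec V]_d, forall (V' : opens X) (h : subo V' V) (hU' : subo V' U)
    (hW' : subo V' W) (z : 'cV[sec V']_d),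
    lincomb hU' b z = lincomb hW' c (map_mx (res h) P *m z).
Proof.
move=> fc.
have /choice[p pP] : forall i, exists p : 'cV[sec V]_d, lincomb hW c p = mres hU (b i).
  by move=> i; have [p [pE _]] := fc V hW (mres hU (b i)); exists p.
exists (\matrix_(l, i) p i l 0) => V' h hU' hW' z.
transitivity (\sum_i \sum_l (z i 0 * res h (p i l 0)) *: mres hW' (c l)).
  apply: eq_bigr => i _; rewrite -(mres_comp hU h hU') -pP (mres_lincomb hW h hW').
  rewrite /lincomb scaler_sumr; apply: eq_bigr => l _.
  by rewrite scalerA mxE.
rewrite exchange_big; apply: eq_bigr => l _ /=; rewrite -scaler_suml; congr (_ *: _).
by rewrite mxE; apply: eq_bigr => i _; rewrite !mxE mulrC.
Qed.

(** The uniqueness half of [res_glue]. The family has to be given on all opens and is put equal to 0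
    on those outside [U]. *)
Lemma res_inj (U : opens X) (F : set (set X)) (t t' : sec U) : cov (oset U) F ->
  (forall V (h : subo V U), F (oset V) -> res h t = res h t') -> t = t'.
Proof.
move=> covF tt'.
pose s (V : opens X) : sec V :=
  if pselect (subo V U) is left h then res h t else 0.
have sE (V : opens X) (h : subo V U) : s V = res h t.
  by rewrite /s; case: pselect => // h'; rewrite (Prop_irrelevance h' h).
have [|y [_ yu]] := res_glue covF (s := s).
  move=> V V' W h h' FV FV'.
  have VU : subo V U by move=> x Vx; rewrite -(cov_cover covF); exists (oset V).
  have VU' : subo V' U by move=> x Vx; rewrite -(cov_cover covF); exists (oset V').
  by rewrite (sE V VU) (sE V' VU') (res_comp _ _ (subo_trans h VU)) (res_comp _ _ (subo_trans h VU)).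
by rewrite -(yu t) ?(yu t') // => V h FV; rewrite (sE V h) // tt'.
Qed.

End Frames.

(** * Gluing *)

Lemma finite_set_bound (T : Type) (H : set T) (P : T -> nat -> Prop) :
  finite_set H -> (forall W n m, (n <= m)%N -> P W n -> P W m) ->
  (forall W, H W -> exists n, P W n) -> exists N, forall W, H W -> P W N.
Proof.
move=> finH Pmono HP.
have /choice[n nP] : forall W, exists n, H W -> P W n.
  by move=> W; have [/HP[n Pn]|nH] := pselect (H W); [exists n|exists 0%N].
have /finite_seqP[s es] := finite_image n finH.
exists (\max_(m <- s) m) => W HW; apply: Pmono (nP W HW).
by apply: leq_bigmax_seq => //; have : [set` s] (n W) by rewrite -es; exists W.
Qed.

Section Glue.
Variables (R : realType) (L : fieldType) (v : L -> R).
Hypothesis hv : absolute_value v.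
Hypothesis v_complete : ncomplete v.
Variables (X : rigid_space v) (E : osheaf X) (q d : nat).
Hypothesis q_gt1 : (1 < q)%N.
Hypothesis powD : forall (B : lalgebra L) j (x y : B),
  (x + y) ^+ (q ^ j) = x ^+ (q ^ j) + y ^+ (q ^ j).
Variable theta : L.
Hypothesis theta_gt1 : 1 < v theta.
Variables (f f' : sheaf_map E E).
Hypothesis f_nat : natural_on (restr_map (U := otop X) f).
Hypothesis diff_f : is_differential q d d f f'.
Variables (U : opens X) (b : 'I_d -> msec E U).
Hypothesis affU : affinoid_open v U.
Hypothesis frb : frame b.

Let q_gt0 : (0 < q)%N := ltnW q_gt1.

Lemma sheaf_map_nat (g : sheaf_map E E) : natural_on (restr_map (U := otop X) g) ->
  forall (V W : opens X) (h : subo W V) s, g W (mres h s) = mres h (g V s).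
Proof. by move=> g_nat V W h s; exact: (g_nat V W (@subo_otop X V) (@subo_otop X W) h s). Qed.

(** Coefficients over [V], but in the fixed frame [b] of [U], so that those of different members of
    a covering can be compared. The sequence is padded by zeros for the same purpose. *)
Definition local_coef (V : opens X) (m : nat) (A : nat -> 'M[sec V]_d) : Prop :=
  (forall k, (m < k)%N -> A k = 0) /\
  forall (V' : opens X) (h : subo V' V) (hU : subo V' U) (z : 'cV[sec V']_d),
    f (lincomb hU b z) = lincomb hU b (twisted_poly q m (fun k => map_mx (res h) (A k)) z) /\
    f' (lincomb hU b z) = lincomb hU b (map_mx (res h) (A 0%N) *m z).

(** Passing from the frames [c], [c'] to [b] turns [A_k sigma^k] into [Q A_k P^(k) sigma^k]. *)
Lemma local_coef_exists (W V : opens X) (hW : subo V W) (hU : subo V U)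
    (c c' : 'I_d -> msec E W) m (A : nat -> 'M[sec W]_d) :
  frame c -> frame c' ->
  given_by q (@subo_otop _ W) c c' (restr_map (U := otop X) f) m A ->
  given_by q (@subo_otop _ W) c c' (restr_map (U := otop X) f') 0 (fun=> A 0%N) ->
  exists m A, @local_coef V m A.
Proof.
move=> fc fc' gf gf'.
have [P PE] := frame_change hU hW b fc.
have [Q QE] := frame_change hW hU c' frb.
exists m, (fun k => if (k <= m)%N then Q *m map_mx (res hW) (A k) *m twist q k P else 0).
split=> [k|V' h hU' z]; first by rewrite ltnNge; case: (k <= m)%N.
have hW' : subo V' W := subo_trans h hW.
have resE k : map_mx (res h) (map_mx (res hW) (A k)) = map_mx (res hW') (A k).
  by apply/matrixP => i j; rewrite !mxE (res_comp _ _ hW').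
have res_twist k : map_mx (res h) (twist q k P) = twist q k (map_mx (res h) P).
  by apply/matrixP => i j; rewrite !mxE rmorphXn.
rewrite !(PE V' h hU' hW' z); split.
  have -> : f (lincomb hW' c (map_mx (res h) P *m z)) = _ := gf V' hW' _.
  rewrite (QE V' h hW' hU'); congr (lincomb _ _ _).
  rewrite mulmx_sumr; apply: eq_bigr => k _ /=.
  rewrite -ltnS ltn_ord !map_mxM resE res_twist !frob_twist twistM //.
  by rewrite !mulmxA.
have -> : f' (lincomb hW' c (map_mx (res h) P *m z)) = _ := gf' V' hW' _.
rewrite (QE V' h hW' hU') big_ord_recl big_ord0 addr0; congr (lincomb _ _ _).
rewrite leq0n twist0 !map_mxM resE frob_twist twist0.
by rewrite !mulmxA.
Qed.

Lemma local_coef_unique (V V' W : opens X) (h : subo W V) (h' : subo W V')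
    (hU : subo W U) m A m' A' : @local_coef V m A -> @local_coef V' m' A' ->
  forall k, map_mx (res h) (A k) = map_mx (res h') (A' k).
Proof.
move=> [A0 AE] [A'0 A'E]; apply: (twisted_poly_coef hv q_gt1 theta_gt1 (s := m) (s' := m')).
- by move=> k /A0 ->; rewrite map_mx0.
- by move=> k /A'0 ->; rewrite map_mx0.
move=> z; apply: (frame_inj (h := hU) frb).
by have [<- _] := AE W h hU z; have [<- _] := A'E W h' hU z.
Qed.

(** Carries subdomains of the spectrum of [sec U] back to opens of [X], where the local coefficients
    live. *)
Lemma subdomain_open (W : set (set (sec U))) : subdomain v W -> exists V : opens X,
  exists h : subo V U, pt_ideal (U := U) @` oset V = W /\ represents v W (res h).
Proof.
move=> sW; have [WSp _] := sW.
have [bij1 bij2 bij3] := ao_bij affU.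
have VE : pt_ideal (U := U) @` [set x | oset U x /\ W (pt_ideal (U := U) x)] = W.
  apply/seteqP; split=> [_ [x [Ux Wx] <-]//|m Wm].
  by have [x Ux xm] := bij3 _ (WSp _ Wm); exists x => //; split => //; rewrite xm.
have Vadm : adm [set x | oset U x /\ W (pt_ideal (U := U) x)].
  apply/(ao_adm affU) => [x []//|]; rewrite VE.
  exact: strong_adm_subdomain.
pose V := Opens Vadm; have h : subo V U by move=> x [].
exists V, h; split => //; rewrite -{1}VE; apply: (ao_sheaf affU (V := V) h).
by rewrite VE.
Qed.

Lemma glued_coef : exists s (G : nat -> 'M[sec U]_d),
  (forall k, (s < k)%N -> G k = 0) /\
  forall (h : subo U U) (z : 'cV[sec U]_d),
    f (lincomb h b z) = lincomb h b (twisted_poly q s G z) /\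
    f' (lincomb h b z) = lincomb h b (G 0%N *m z).
Proof.
have [f'_nat [F [[covF _] Fdiff]]] := diff_f.
pose F' := (fun W => oset U `&` W) @` F.
have covF' : cov (oset U) F' by apply: cov_pull covF (oadm U) _.
have F'U (V : opens X) : F' (oset V) -> subo V U by move=> [W _ VE] x; rewrite -VE => -[].
have loc (V : opens X) : exists p : nat * (nat -> 'M[sec V]_d),
    F' (oset V) -> local_coef p.1 p.2.
  have [F'V|nF'] := pselect (F' (oset V)); last by exists (0%N, fun=> 0).
  have hU := F'U _ F'V; have [W FW VE] := F'V.
  have Wadm : adm W by have [_] := cov_adm covF; apply.
  pose Wo := Opens Wadm; have hW : subo V Wo by move=> x; rewrite -VE => -[].
  have [c [c' [m [A [fc fc' gf gf']]]]] := Fdiff Wo FW.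
  have [m' [A' lc]] := local_coef_exists hW hU fc fc' gf gf'.
  by exists (m', A').
pose p (V : opens X) := projT1 (cid (loc V)).
have pP (V : opens X) : F' (oset V) -> local_coef (p V).1 (p V).2 := projT2 (cid (loc V)).
have glue k i j : exists t : sec U, forall V (h : subo V U), F' (oset V) -> res h t = (p V).2 k i j.
  have [|t [tP _]] := res_glue covF' (s := fun V => (p V).2 k i j); last by exists t.
  move=> V V' W h h' F'V F'V'.
  have := local_coef_unique h h' (subo_trans h (F'U _ F'V)) (pP _ F'V) (pP _ F'V') k.
  by move/matrixP/(_ i j); rewrite !mxE.
pose G k : 'M[sec U]_d := \matrix_(i, j) projT1 (cid (glue k i j)).
have GE k V (h : subo V U) : F' (oset V) -> map_mx (res h) (G k) = (p V).2 k.
  by move=> F'V; apply/matrixP => i j; rewrite !mxE; exact: (projT2 (cid (glue k i j))).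
have [bij1 bij2 bij3] := ao_bij affU.
have F'sub W : F' W -> W `<=` oset U by move=> [W' _ <-] x [].
have [_ _ _ qc] := (ao_cov affU (@subset_refl _ (oset U)) F'sub).1 covF'.
have affB := ao_affinoid affU.
(* The covering property is tested at the identity of [sec U], which yields a finite refinement of
   the covering itself. *)
have into : @Sp_into L (sec U) (sec U) idfun (pt_ideal (U := U) @` oset U).
  by move=> m Sm; have [x Ux xm] := bij3 m Sm; exists x.
have [H [finH subH covH refH]] := qc (sec U) idfun affB (fun=> erefl) into.
(* Each [W] in [H] lies in the image of a member of [F'], and beyond the degree valid on that member
   the glued entries vanish on [W]; finiteness of [H] gives a common [N]. *)
have [N GN] : exists N, forall W, H W -> forall k i j, (N < k)%N ->
    exists (B' : lalgebra L) (rho : {rmorphism sec U -> B'}),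
      represents v W rho /\ rho (G k i j) = 0.
  apply: (finite_set_bound (P := fun W N => forall k i j, (N < k)%N ->
    exists (B' : lalgebra L) (rho : {rmorphism sec U -> B'}),
      represents v W rho /\ rho (G k i j) = 0)) finH _ _.
    by move=> W n m nm Pn k i j mk; apply: Pn; exact: leq_ltn_trans mk.
  move=> W HW; have [V1 [h1 [V1E rep]]] := subdomain_open (subH _ HW).
  have [_ [_ [V F'V <-] <-] WV] := refH _ HW.
  have Vadm : adm V by have [_] := cov_adm covF'; apply.
  pose Vo := Opens Vadm; have hVU : subo Vo U by exact: F'U.
  (* Points of [U] are determined by their ideals, so an inclusion of images is an inclusion of
     opens. *)
  have h2 : subo V1 Vo.
    move=> x V1x; have Wx : W (pt_ideal (U := U) x) by rewrite -V1E; exists x.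
    have [_ [y Vy yx]] := WV _ Wx.
    suff -> : x = y by [].
    by apply: bij2; rewrite ?inE //; [exact: (h1 _ V1x)|exact: (hVU _ Vy)].
  exists (p Vo).1 => k i j mk; exists (sec V1), (res h1); split => //.
  rewrite -(res_comp hVU h2 h1).
  have [A0 _] := pP Vo F'V; have := GE k Vo hVU F'V; rewrite (A0 k mk).
  by move/matrixP/(_ i j); rewrite !mxE => ->; rewrite rmorph0.
have GN0 k : (N < k)%N -> G k = 0.
  move=> Nk; apply/matrixP => i j; rewrite [RHS]mxE.
  apply: (subdomain_cover_inj hv v_complete affB covH) => W HW.
  exact: GN.
exists N, G; split=> // h z.
have [y [yE _]] := frb h (f (lincomb h b z)).
have [y' [y'E _]] := frb h (f' (lincomb h b z)).
rewrite -yE -y'E; split; congr (lincomb _ _ _); apply/matrixP => i j; rewrite (ord1 j) {j}.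
  apply: (res_inj covF') => V hVU F'V.
  have [A0 AE] := pP V F'V.
  have [e _] := AE V (fun x Vx => Vx) hVU (map_mx (res hVU) z).
  have : map_mx (res hVU) y = map_mx (res hVU) (twisted_poly q N G z).
    apply: (frame_inj (h := hVU) frb).
    rewrite -(mres_lincomb h hVU hVU) yE -(sheaf_map_nat f_nat) (mres_lincomb h hVU hVU) e.
    (* The local degree may exceed [N] or fall short of it; both sums are padded to the larger of
       the two. *)
    congr (lincomb _ _ _); rewrite (@twisted_poly_pad _ _ q d (p V).1 (maxn (p V).1 N)) ?leq_maxl //; last first.
      by move=> k /A0 ->; rewrite map_mx0.
    rewrite (@twisted_poly_pad _ _ q d N (maxn (p V).1 N)) ?leq_maxr //.
    rewrite /twisted_poly map_mx_sum; apply: eq_bigr => k _.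
    rewrite map_mxM (GE k V hVU F'V); congr (_ *m _).
      by apply/matrixP => i' j'; rewrite !mxE res_id.
    by apply/matrixP => i' j'; rewrite !mxE rmorphXn.
  by move/matrixP/(_ i 0); rewrite !mxE.
apply: (res_inj covF') => V hVU F'V.
have [A0 AE] := pP V F'V.
have [_ e] := AE V (fun x Vx => Vx) hVU (map_mx (res hVU) z).
have : map_mx (res hVU) y' = map_mx (res hVU) (G 0%N *m z).
  apply: (frame_inj (h := hVU) frb).
  rewrite -(mres_lincomb h hVU hVU) y'E -(sheaf_map_nat f'_nat) (mres_lincomb h hVU hVU) e.
  congr (lincomb _ _ _); rewrite map_mxM (GE 0%N V hVU F'V); congr (_ *m _).
  by apply/matrixP => i' j'; rewrite !mxE res_id.
by move/matrixP/(_ i 0); rewrite !mxE.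
Qed.

End Glue.

(** * The exponential of an abelian module *)

Section Frobenius.
Variables (S : pzRingType) (p : nat).
Hypothesis p_prime : prime p.
Hypothesis p0 : p%:R = 0 :> S.

(** Stated for commuting elements because it is applied to the matrix ring as well, to a
    differential and its nilpotent defect. *)
Lemma expD_char_comm (x y : S) m : GRing.comm x y ->
  (x + y) ^+ (p ^ m) = x ^+ (p ^ m) + y ^+ (p ^ m).
Proof.
elim: m x y => [|m IH] x y cxy; first by rewrite expn0 !expr1.
rewrite expnS !exprM -IH; last by apply: commrX; apply: commr_sym; exact: commrX.
congr (_ ^+ _); have defp := prednK (prime_gt0 p_prime).
rewrite exprDn_comm // big_ord_recr subnn -defp big_ord_recl /= defp.
rewrite subn0 mulr1 mul1r bin0 binn big1 ?addr0 // => i _.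
have /dvdnP[c ->] : (p %| 'C(p, bump 0 i))%N.
  by rewrite prime_dvd_bin //= -{2}defp ltnS ltn_ord.
by rewrite -mulr_natr natrM p0 mulr0 mulr0.
Qed.

End Frobenius.

Section FieldCard.
Variable k : finFieldType.

Lemma finField_card_pow : exists p n, [/\ prime p, p%:R = 0 :> k & #|k| = (p ^ n)%N].
Proof.
have [p pp pk] := finPcharP k; exists p, (logn p #|k|).
by split => //; [exact: pcharf0 | exact: (card_pprimeChar pk)].
Qed.

End FieldCard.

Section LeadingCoef.
Variables (R : realType) (L : fieldType) (v : L -> R) (B : lalgebra L) (nrm : B -> R).
Hypothesis hv : absolute_value v.
Hypothesis hn : algebra_norm v nrm.
Variables (q d : nat).
Hypothesis q_gt1 : (1 < q)%N.
Hypothesis powD : forall j (x y : B), (x + y) ^+ (q ^ j) = x ^+ (q ^ j) + y ^+ (q ^ j).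
Variable theta : L.
Hypothesis theta_gt1 : 1 < v theta.

(** Twisted polynomials are read as series that end, so that the uniqueness of coefficients applies
    to the composite. *)
Lemma twisted_poly_lead_mul s1 s2 s (G1 G2 G : nat -> 'M[B]_d) :
  (forall z, twisted_poly q s G z = twisted_poly q s1 G1 (twisted_poly q s2 G2 z)) ->
  G 0%N = G1 0%N *m G2 0%N.
Proof.
move=> GE.
have H := is_sum_compose hn q_gt1 powD s1 G1 (is_sum_poly hn q s2 G2).
have := is_sum_poly hn q s G; rewrite (funext GE) => H'.
have E : G 0%N = twcomp q s1 G1 _ 0%N := is_sum_coef hv hn q_gt1 theta_gt1 H' H 0%N.
rewrite E /twcomp big_ord_recl big1 ?addr0 => [|k _]; last by rewrite /twshift ltn0Sn.
by rewrite /twshift /= subn0 twist0.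
Qed.

End LeadingCoef.

Section Coordinates.
Variables (R : realType) (C : pointed_curve) (A : coordinate_ring C) (L : valued_field R A).
Variables (X : rigid_space (@vabs R C A L)) (d : nat) (E : osheaf X) (U : opens X).
Variables (kappa : msec E U -> 'cV[sec U]_d) (kinv : 'cV[sec U]_d -> msec E U).
Hypothesis hk : coordinates kappa kinv.

Lemma kappaD s t : kappa (s + t) = kappa s + kappa t.
Proof. by have := coord_lin hk 1 s t; rewrite !scale1r. Qed.

Lemma kappa0 : kappa 0 = 0.
Proof. by apply: (addrI (kappa 0)); rewrite -kappaD !addr0. Qed.

Lemma kappaZ c s : kappa (c *: s) = c *: kappa s.
Proof. by have := coord_lin hk c s 0; rewrite kappa0 !addr0. Qed.

Lemma kappa_sum (T : Type) (r : seq T) (F : T -> msec E U) :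
  kappa (\sum_(t <- r) F t) = \sum_(t <- r) kappa (F t).
Proof. by apply: (big_morph kappa kappaD); exact: kappa0. Qed.

(** The coordinates [kappa] are arbitrary, while coefficients are computed in a frame [b]; [M] and
    [N] translate between the two. *)
Lemma coordinates_frame (b : 'I_d -> msec E U) (h : subo U U) : frame b ->
  exists M N : 'M[sec U]_d, (forall z, kappa (lincomb h b z) = M *m z) /\
    (forall z, kinv z = lincomb h b (N *m z)).
Proof.
move=> fb.
have kb z : kappa (lincomb h b z) = (\matrix_(l, i) kappa (mres h (b i)) l 0) *m z.
  rewrite /lincomb kappa_sum; apply/matrixP => l j; rewrite (ord1 j) summxE !mxE.
  by apply: eq_bigr => i _; rewrite kappaZ !mxE mulrC.
have /choice[y yP] : forall i, exists y : 'cV[sec U]_d, lincomb h b y = kinv (delta_mx i 0).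
  by move=> i; have [y [yE _]] := fb U h (kinv (delta_mx i 0)); exists y.
exists (\matrix_(l, i) kappa (mres h (b i)) l 0), (\matrix_(l, i) y i l 0); split=> // z.
rewrite -[RHS](coord_can hk); congr kinv; rewrite kb mulmxA.
rewrite (_ : _ *m _ = 1%:M) ?mul1mx //; apply/matrixP => l i.
have := kb (y i); rewrite yP (coord_inv hk) => /matrixP/(_ l 0) e.
rewrite !mxE in e; rewrite !mxE eqxx andbT in e *; rewrite e.
by apply: eq_bigr => j _; rewrite !mxE.
Qed.

End Coordinates.

Theorem proposition8p7 (R : realType) (C : pointed_curve)
    (A : coordinate_ring C) (L : valued_field R A)
    (X : rigid_space (@vabs R C A L)) (d r : nat)
    (E : osheaf X) (phi dphi : A -> sheaf_map E E)
    (hE : @abelian_module R C A L X d r E phi dphi)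
    (Xi : set (set X)) (hXi : @nilpotent_on R C A L X E dphi Xi)
    (Bi : set (set X)) (hBi : affinoid_covering (@vabs R C A L) Bi)
    (hrefine : forall V, Bi V -> exists2 W, Xi W & V `<=` W)
    (U : opens X) (hU : Bi (oset U)) (hfree : free_on E d U)
    (kappa : msec E U -> 'cV[sec U]_d) (kinv : 'cV[sec U]_d -> msec E U)
    (hkappa : @coordinates R C A L X d E U kappa kinv)
    (nrm : sec U -> R) (hnrm : algebra_norm (@vabs R C A L) nrm) :
  exists! e : nat -> 'M[sec U]_d,
    [/\ e 0%N = 1%:M, entire nrm #|cfield C| e &
        exists Exp : 'cV[sec U]_d -> 'cV[sec U]_d,
          is_sum nrm #|cfield C| e Exp /\
          forall (a : A) (z : 'cV[sec U]_d),
            Exp (kappa (dphi a U (kinv z))) =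
            kappa (phi a U (kinv (Exp z)))].
Proof.
pose v := @vabs R C A L; pose q := #|cfield C|.
have hv : absolute_value v.
  have [ge0 eq0 mul add] := CabsP L; split => [x|x|x y|x y]; rewrite /v /vabs.
  - exact: ge0.
  - split=> [/eq0/eqP|->]; last by rewrite rmorph0; exact/eq0.
    by rewrite fmorph_eq0 => /eqP.
  - by rewrite rmorphM mul.
  - by rewrite rmorphD; exact: add.
have v_cpl : ncomplete v := @vabs_complete _ _ _ L.
have q_gt1 : (1 < q)%N := finNzRing_gt1 (cfield C).
have [p [f [p_prime p0 qE]]] := finField_card_pow (cfield C).
have p0L : p%:R = 0 :> L.
  by rewrite -(rmorph_nat (Defs.iota L \o ccst A)) p0 rmorph0.
have p0B (B : lalgebra L) : p%:R = 0 :> B by rewrite -(rmorph_nat (lstr B)) p0L rmorph0.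
have powD (B : lalgebra L) j (x y : B) : (x + y) ^+ (q ^ j) = x ^+ (q ^ j) + y ^+ (q ^ j).
  by rewrite /q qE -expnM; apply: (expD_char_comm p_prime (p0B B)); exact: mulrC.
have [a1 a1P] := exists_pole A.
have vgt1 a : ~ infty (cemb A a) -> 1 < v (Defs.iota L a).
  by move=> na; rewrite ltNge; apply/negP; rewrite /v /vabs iotaP => /Cabs_infty.
have th1 := vgt1 _ a1P.
have affU := hBi.2 U hU; have [b frb] := hfree.
pose hUU : subo U U := fun x Ux => Ux.
have [M [N [kM kN]]] := coordinates_frame hkappa hUU frb.
have /choice[sG sGP] : forall a, exists sG : nat * (nat -> 'M[sec U]_d), forall z,
    kappa (phi a U (kinv z)) = twisted_poly q sG.1 sG.2 z /\
    kappa (dphi a U (kinv z)) = sG.2 0%N *m z.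
  move=> a; have [phi_nat _] := am_end hE a.
  have [s [G [_ GE]]] := glued_coef hv v_cpl q_gt1 powD th1 phi_nat (am_diff hE a) affU frb.
  (* The change of coordinates turns [G_k sigma^k] into [M G_k N^(k) sigma^k]. *)
  exists (s, fun k => M *m G k *m twist q k N) => z /=.
  have [e1 e2] := GE hUU (N *m z); rewrite kN e1 e2 !kM twist0; split; last by rewrite !mulmxA.
  rewrite /twisted_poly mulmx_sumr; apply: eq_bigr => k _.
  by rewrite !frob_twist twistM ?(ltnW q_gt1) // !mulmxA.
pose s a := (sG a).1; pose G a := (sG a).2.
have phiE a z : kappa (phi a U (kinv z)) = twisted_poly q (s a) (G a) z by have [] := sGP a z.
have dphiE a z : kappa (dphi a U (kinv z)) = G a 0%N *m z by have [] := sGP a z.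
have phiM a a' z : twisted_poly q (s (a * a')) (G (a * a')) z =
    twisted_poly q (s a) (G a) (twisted_poly q (s a') (G a') z).
  by rewrite -!phiE (am_mul hE) (coord_can hkappa).
have GM a a' : G (a * a') 0%N = G a 0%N *m G a' 0%N.
  exact: (twisted_poly_lead_mul hv hnrm q_gt1 (powD _) th1 (phiM a a')).
have [W XiW UW] := hrefine _ hU.
have [covXi [n nP]] := hXi.
have Wadm : adm W by have [_] := cov_adm covXi; apply.
(* The exponent that kills [iota(a1) - phi'_(a1)] on the member [W] of [Xi] containing [U]. *)
pose m := n W a1.
pose Nil : 'M[sec U]_d := (lstr (sec U) (Defs.iota L a1))%:M - G a1 0%N.
(* In coordinates the iterated operator on sections is multiplication by a power of [Nil]; its
   vanishing on the basis vectors gives the columns. *)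
have Nil0 : Nil ^+ m = 0.
  have iterE j t : kappa (iter j (fun t : msec E U =>
      lstr (sec U) (Defs.iota L a1) *: t - dphi a1 U t) t) = Nil ^+ j *m kappa t.
    elim: j => [|j IH]; first by rewrite expr0 mul1mx.
    rewrite iterS; set t' := iter j _ _ in IH *.
    rewrite -[- dphi _ _ _]scaleN1r (kappaD hkappa) !(kappaZ hkappa) scaleN1r.
    rewrite -{2}(coord_can hkappa t') dphiE IH.
    by rewrite exprS -mulmxA mulmxBl mul_scalar_mx.
  apply/matrixP => i j; rewrite [RHS]mxE.
  have := iterE m (kinv (delta_mx j 0)).
  rewrite (nP (Opens Wadm) XiW a1 U UW) (kappa0 hkappa) (coord_inv hkappa) => /matrixP/(_ i 0).
  rewrite !mxE (bigD1 j) //= big1 ?addr0 => [|l lj]; last by rewrite mxE (negbTE lj) mulr0.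
  by rewrite mxE !eqxx mulr1.
(* In characteristic [p] a large power of [q] kills the nilpotent part. *)
pose a0 := a1 ^+ (q ^ m).
have Ga0 : G a0 0%N = (lstr (sec U) (Defs.iota L a0))%:M.
  have GX j : G (a1 ^+ j.+1) 0%N = G a1 0%N ^+ j.+1.
    by elim: j => [|j IH]; rewrite ?expr1 // exprS GM IH [RHS]exprS.
  have qm0 : (0 < q ^ m)%N by rewrite expn_gt0 (ltnW q_gt1).
  have -> : G a0 0%N = G a1 0%N ^+ (q ^ m) by rewrite /a0 -(prednK qm0) GX.
  have p0M : p%:R = 0 :> 'M[sec U]_d.
    by rewrite -(rmorph_nat (@scalar_mx (sec U) d)) p0B rmorph0.
  have NilX : Nil ^+ (q ^ m) = 0.
    by rewrite -(subnK (ltnW (ltn_expl m q_gt1))) exprD Nil0 mulr0.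
  have : (G a1 0%N + Nil) ^+ (q ^ m) = G a1 0%N ^+ (q ^ m) + Nil ^+ (q ^ m).
    rewrite /q qE -expnM; apply: (expD_char_comm p_prime p0M).
    by rewrite /GRing.comm /Nil mulrBr mulrBl; congr (_ - _); exact: scalar_mxC.
  rewrite NilX addr0 => <-; rewrite /Nil addrC subrK -(rmorphXn (@scalar_mx (sec U) d)).
  by rewrite -rmorphXn -rmorphXn.
have th0 : 1 < v (Defs.iota L a0).
  by rewrite /a0 rmorphXn absX // exprn_egt1 // expn_eq0 negb_and -lt0n (ltnW q_gt1).
(* This is where the commutativity of [A] enters. *)
have comm a z : twisted_poly q (s a0) (G a0) (twisted_poly q (s a) (G a) z) =
    twisted_poly q (s a) (G a) (twisted_poly q (s a0) (G a0) z).
  by rewrite -!phiM mulrC.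
have [e [[e0 ent [F [eF FE]]] euniq]] :=
  exp_exists_unique hv hnrm q_gt1 (powD _) th0 Ga0 comm.
exists e; split.
  by split => //; exists F; split => // a z; rewrite dphiE FE phiE.
move=> e' [e'0 ent' [F' [eF' FE']]]; apply: euniq; split => //.
by exists F'; split => // a z; rewrite -dphiE FE' phiE.
Qed.
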